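(* There is an algorithm which, given a skew-merged permutation $\tau$ of size $n$ and a skew-merged permutation $\pi$ of size $k$, determines whether $\tau$ contains $\pi$, and whose running time is $O(kn)$.
   Context: A permutation of size $n$ is a bijection $\sigma:[n]\to[n]$, identified with its set of points $\{(i,\sigma(i))\}$; $(i,\sigma(i))$ lies to the left of $(j,\sigma(j))$ if $i<j$ and below it if $\sigma(i)<\sigma(j)$. An embedding of $\pi$ into $\tau$ is an injective map from points of $\pi$ to points of $\tau$ preserving the relative horizontal and vertical order of every pair of points; $\tau$ contains $\pi$ if an embedding exists. A permutation is skew-merged if its set of points can be partitioned into an increasing subsequence and a decreasing subsequence (equivalently, it contains neither $3412$ nor $2143$). Running time is measured in the standard RAM model with inputs in one-line notation. *)

(* Defs.v *)
From mathcomp Require Import all_boot.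
Set Implicit Arguments. Unset Strict Implicit. Unset Printing Implicit Defensive.

(* s is a permutation of size n in one-line notation: s = [s(1); ...; s(n)],
   a rearrangement of 1..n.  Point i (0-based index) is (i, nth 0 s i). *)
Definition is_perm (n : nat) (s : seq nat) : Prop := perm_eq s (iota 1 n).

Definition embedding (pi tau : seq nat) (f : 'I_(size pi) -> 'I_(size tau)) : Prop :=
  injective f /\
  forall i j : 'I_(size pi),
    ((i < j) = (f i < f j)) /\
    ((nth 0 pi i < nth 0 pi j) = (nth 0 tau (f i) < nth 0 tau (f j))).

Definition contains (tau pi : seq nat) : Prop :=
  exists f : 'I_(size pi) -> 'I_(size tau), embedding f.

Definition skew_merged (s : seq nat) : Prop :=
  exists P : pred nat,
    forall i j, i < j < size s ->
      (P i -> P j -> nth 0 s i < nth 0 s j) /\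
      (~~ P i -> ~~ P j -> nth 0 s i > nth 0 s j).

(* Registers and memory cells hold natural numbers; memory is addressable
   indirectly.  Each instruction costs one time unit. *)
Inductive instr : Type :=
| IConst (r c : nat)
| IAdd   (r a b : nat)
| ISub   (r a b : nat)      (* R[r] := R[a] - R[b] (truncated)   *)
| ILt    (r a b : nat)
| IEq    (r a b : nat)
| ILoad  (r a : nat)
| IStore (a r : nat)
| IJz    (r l : nat)
| IJmp   (l : nat)
| IHalt.

Record state : Type := State { pc : nat; reg : nat -> nat; mem : nat -> nat }.

Definition program := seq instr.

Definition upd (f : nat -> nat) (x v : nat) : nat -> nat :=
  fun y => if y == x then v else f y.

Definition fetch (p : program) (st : state) : instr := nth IHalt p (pc st).

Definition halted (p : program) (st : state) : bool :=
  if fetch p st is IHalt then true else false.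

Definition step (p : program) (st : state) : state :=
  let R := reg st in let M := mem st in let nx := (pc st).+1 in
  match fetch p st with
  | IConst r c => State nx (upd R r c) M
  | IAdd r a b => State nx (upd R r (R a + R b)) M
  | ISub r a b => State nx (upd R r (R a - R b)) M
  | ILt r a b  => State nx (upd R r (R a < R b)) M
  | IEq r a b  => State nx (upd R r (R a == R b)) M
  | ILoad r a  => State nx (upd R r (M (R a))) M
  | IStore a r => State nx R (upd M (R a) (R r))
  | IJz r l    => State (if R r == 0 then l else nx) R M
  | IJmp l     => State l R M
  | IHalt      => st
  end.

Definition exec (p : program) (t : nat) (st : state) : state := iter t (step p) st.

Definition init_mem (tau pi : seq nat) : nat -> nat :=
  fun a =>
    if a == 0 then size tau
    else if a == 1 then size pi
    else if a < (size tau).+2 then nth 0 tau (a - 2)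
    else if a < size tau + size pi + 2 then nth 0 pi (a - size tau - 2)
    else 0.

Definition init_state (tau pi : seq nat) : state :=
  State 0 (fun _ => 0) (init_mem tau pi).

(* Main.v *)
Require Import Defs.
From mathcomp Require Import all_boot.
From mathcomp Require Import zify.
Set Implicit Arguments. Unset Strict Implicit. Unset Printing Implicit Defensive.

(* A skew-merged permutation has the shape of an X: an increasing and a
   decreasing sequence cross, which leaves four arms.  A point that plays, up to
   reflection, the role of 1 in a pattern 132 is forced into one of the arms,
   and an embedding sends it to a point forced into the same arm; the remaining
   (white) points form a monotone sequence lying inside all the arms.

   Color tau increasing/decreasing by dynamic programming.  Every non-white
   point x of pi gets a pointer into the list of the points of tau of the color
   of its arm, starting at the outermost one.  The two points of pi following x
   on its horizontal and on its vertical side must be mapped strictly further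
   inside; whenever this fails, the pointer of the follower moves one step
   inwards.  Each pointer moves at most n times and each move creates a constant
   amount of work, hence O(kn).  Since both orders increase along an arm, no
   pointer ever overtakes an embedding, so the final positions leave the largest
   possible rectangle for the white points: pi is contained in tau iff no
   pointer runs off its list, opposite sides stay apart, and the rectangle
   contains a monotone sequence of the required length and direction, which is
   decided by the textbook O(kn) dynamic program. *)

(** * A structured language and its compilation *)

Local Arguments exec : simpl never.

(** Certificates, unlike colorings, survive embeddings: the three points of a pattern 132 are sent
    to three points in the same relative position. Hence the program never colors pi; its points are
    classified by certificates, and a coloring of pi enters only the correctness proof. For tau any
    coloring will do: the image of a certified point is certified for the same arm, and every
    coloring gives it the color of that arm. So the candidates for the points of one arm form a
    single list along which both depths increase, and one index controls both coordinates. The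
    constraints between a point and its followers are inequalities whose solutions are closed under
    pointwise minimum; the pointers compute the least one. Horizontal and vertical constraints meet
    only in the shared index, so each coordinate can be verified on its own. Classifying pi and
    finding the followers takes quadratic time in k, which is affordable because k > n is rejected
    at the start. *)

Inductive exp : Type :=
| Var (x : nat)
| Cst (c : nat)
| Inp (e : exp)
| Arr (A : nat) (e : exp)
| Add (e1 e2 : exp)
| Sub (e1 e2 : exp)
| Lt  (e1 e2 : exp)
| Eq  (e1 e2 : exp).

Inductive com : Type :=
| Skip
| Asgn (x : nat) (e : exp)
| Store (A : nat) (e1 e2 : exp)
| Seq (c1 c2 : com)
| If (e : exp) (c1 c2 : com)
| While (e : exp) (c : com).

Record store : Type := St { vr : nat -> nat; ar : nat -> nat -> nat }.

Definition setv (s : store) x a := St (fun y => if y == x then a else vr s y) (ar s).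
Definition seta (s : store) A i a :=
  St (vr s) (fun B => if B == A then upd (ar s A) i a else ar s B).

Section Semantics.
Variable inp : nat -> nat.

Fixpoint eval (s : store) (e : exp) : nat :=
  match e with
  | Var x => vr s x
  | Cst c => c
  | Inp e => inp (eval s e)
  | Arr A e => ar s A (eval s e)
  | Add e1 e2 => eval s e1 + eval s e2
  | Sub e1 e2 => eval s e1 - eval s e2
  | Lt e1 e2 => eval s e1 < eval s e2
  | Eq e1 e2 => eval s e1 == eval s e2
  end.

(* [run c s s' i]: [c] leads from [s] to [s'] in [i] loop iterations; the RAM
   time is at most [i.+1] times the length of the compiled code. *)
Inductive run : com -> store -> store -> nat -> Prop :=
| RSkip s : run Skip s s 0
| RAsgn s x e : run (Asgn x e) s (setv s x (eval s e)) 0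
| RStore s A e1 e2 : run (Store A e1 e2) s (seta s A (eval s e1) (eval s e2)) 0
| RSeq s1 s2 s3 c1 c2 i1 i2 :
    run c1 s1 s2 i1 -> run c2 s2 s3 i2 -> run (Seq c1 c2) s1 s3 (i1 + i2)
| RIfT s s' e c1 c2 i : eval s e <> 0 -> run c1 s s' i -> run (If e c1 c2) s s' i
| RIfF s s' e c1 c2 i : eval s e = 0 -> run c2 s s' i -> run (If e c1 c2) s s' i
| RWhileT s1 s2 s3 e c i1 i2 : eval s1 e <> 0 ->
    run c s1 s2 i1 -> run (While e c) s2 s3 i2 -> run (While e c) s1 s3 (i1 + i2).+1
| RWhileF s e c : eval s e = 0 -> run (While e c) s s 0.
End Semantics.

(* Registers below [rOff] hold variables and registers above it temporaries;
   [rOff] holds the length [off] of the input.  Cell [i] of array [A] lives at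
   address [off + 32 * i + A.+1], so that arrays are unbounded and disjoint. *)
Notation rOff := 40 (only parsing).
Notation rTmp := 41 (only parsing).

(** Five doublings stand for the multiplication by 32, which is no instruction. The summand [A.+1]
    instead of [A] keeps address [off] itself free, where the clamped reads of [Inp] must find a
    0. *)
Definition scale (A d : nat) : seq instr :=
  [:: IAdd d d d; IAdd d d d; IAdd d d d; IAdd d d d; IAdd d d d;
      IAdd d d rOff; IConst d.+1 A.+1; IAdd d d d.+1].

(* The two truncated subtractions of [Inp] compute [minn d off]: the input is
   [0] from [off] on, and array cells start above [off]. *)
Fixpoint cexp (e : exp) (d : nat) : seq instr :=
  match e with
  | Var x => [:: IConst d 0; IAdd d x d]
  | Cst c => [:: IConst d c]
  | Inp e => cexp e d ++ [:: ISub d.+1 d rOff; ISub d d d.+1; ILoad d d]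
  | Arr A e => (cexp e d ++ scale A d) ++ [:: ILoad d d]
  | Add e1 e2 => cexp e1 d ++ cexp e2 d.+1 ++ [:: IAdd d d d.+1]
  | Sub e1 e2 => cexp e1 d ++ cexp e2 d.+1 ++ [:: ISub d d d.+1]
  | Lt e1 e2 => cexp e1 d ++ cexp e2 d.+1 ++ [:: ILt d d d.+1]
  | Eq e1 e2 => cexp e1 d ++ cexp e2 d.+1 ++ [:: IEq d d d.+1]
  end.

Fixpoint ccom (c : com) (q : nat) : seq instr :=
  match c with
  | Skip => [::]
  | Asgn x e => cexp e rTmp ++ [:: IConst x 0; IAdd x x rTmp]
  | Store A e1 e2 =>
      (cexp e1 rTmp ++ scale A rTmp) ++ cexp e2 rTmp.+1 ++ [:: IStore rTmp rTmp.+1]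
  | Seq c1 c2 => let p1 := ccom c1 q in p1 ++ ccom c2 (q + size p1)
  | If e c1 c2 =>
      let pe := cexp e rTmp in
      let p1 := ccom c1 (q + size pe).+1 in
      let q2 := ((q + size pe).+1 + size p1).+1 in
      let p2 := ccom c2 q2 in
      pe ++ IJz rTmp q2 :: p1 ++ IJmp (q2 + size p2) :: p2
  | While e c =>
      let pe := cexp e rTmp in
      let p1 := ccom c (q + size pe).+1 in
      pe ++ IJz rTmp ((q + size pe).+1 + size p1).+1 :: p1 ++ [:: IJmp q]
  end.

Fixpoint wfe (e : exp) : bool :=
  match e with
  | Var x => x < rOff
  | Cst c => true
  | Inp e => wfe e
  | Arr A e => (A < 32) && wfe e
  | Add e1 e2 | Sub e1 e2 | Lt e1 e2 | Eq e1 e2 => wfe e1 && wfe e2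
  end.

Fixpoint wfc (c : com) : bool :=
  match c with
  | Skip => true
  | Asgn x e => (x < rOff) && wfe e
  | Store A e1 e2 => [&& A < 32, wfe e1 & wfe e2]
  | Seq c1 c2 => wfc c1 && wfc c2
  | If e c1 c2 => [&& wfe e, wfc c1 & wfc c2]
  | While e c => wfe e && wfc c
  end.

Definition code_at (p : program) q (l : seq instr) :=
  forall i, i < size l -> nth IHalt p (q + i) = nth IHalt l i.

Lemma code_at_cat p q l1 l2 :
  code_at p q (l1 ++ l2) -> code_at p q l1 /\ code_at p (q + size l1) l2.
Proof.
move=> H; split=> i Hi.
  by rewrite H ?size_cat ?nth_cat ?Hi // ltn_addr.
rewrite -addnA H ?size_cat ?ltn_add2l // nth_cat.
by rewrite ltnNge leq_addr /= addKn.
Qed.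

Lemma code_at_cons p q a l :
  code_at p q (a :: l) -> nth IHalt p q = a /\ code_at p q.+1 l.
Proof.
move=> H; split; first by have := H 0 isT; rewrite addn0.
by move=> i Hi; have := H i.+1 Hi; rewrite addnS addSn.
Qed.

Lemma exec_add p t1 t2 st : exec p (t1 + t2) st = exec p t2 (exec p t1 st).
Proof. by rewrite /exec addnC iterD. Qed.

Definition stepi (a : instr) (RM : (nat -> nat) * (nat -> nat)) :=
  let: (R, M) := RM in
  match a with
  | IConst r c => (upd R r c, M)
  | IAdd r a b => (upd R r (R a + R b), M)
  | ISub r a b => (upd R r (R a - R b), M)
  | ILt r a b  => (upd R r (R a < R b), M)
  | IEq r a b  => (upd R r (R a == R b), M)
  | ILoad r a  => (upd R r (M (R a)), M)
  | IStore a r => (R, upd M (R a) (R r))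
  | _ => (R, M)
  end.

Definition linear (a : instr) :=
  match a with IJz _ _ | IJmp _ | IHalt => false | _ => true end.

Definition runl l RM := foldl (fun RM a => stepi a RM) RM l.

Lemma runl_cat l1 l2 RM : runl (l1 ++ l2) RM = runl l2 (runl l1 RM).
Proof. exact: foldl_cat. Qed.

Lemma exec_linear p q l R M : all linear l -> code_at p q l ->
  exec p (size l) (State q R M) =
  State (q + size l) (runl l (R, M)).1 (runl l (R, M)).2.
Proof.
elim: l q R M => [|a l IH] q R M /=; first by rewrite addn0.
move=> /andP [la ll] /code_at_cons [Ha Hl].
rewrite -[(size l).+1]add1n exec_add [exec p 1 _]/exec /= /step /fetch /= Ha.
by rewrite addnA addn1; case: a la {Ha} => //= *; rewrite IH.
Qed.

Section Compile.
Variable inp : nat -> nat.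
Variable off : nat.
Hypothesis inp0 : forall a, off <= a -> inp a = 0.

Definition repr (s : store) (R M : nat -> nat) :=
  [/\ forall x, x < rOff -> R x = vr s x, R rOff = off,
      forall a, a <= off -> M a = inp a
    & forall A i, A < 32 -> M (off + 32 * i + A.+1) = ar s A i].

Lemma linear_cexp e d : all linear (cexp e d).
Proof. by elim: e d => //= *; rewrite !all_cat /=; do ?[apply/andP; split]. Qed.

Lemma runl_scale A d R M : rOff < d ->
  let RM := runl (scale A d) (R, M) in
  [/\ RM.2 = M, forall r, r < d -> RM.1 r = R r
    & RM.1 d = R rOff + 32 * R d + A.+1].
Proof.
move=> Hd RM; rewrite /RM /scale /runl /=; split=> //.
  move=> r Hr; rewrite /upd.
  by do ?[case: eqP => [?|_]; first by lia].
rewrite /upd !eqxx.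
have -> : (rOff == d) = false by apply/eqP; lia.
have -> : (d == d.+1) = false by apply/eqP; lia.
lia.
Qed.

Lemma runl_cexp e d s R M : wfe e -> rOff < d -> repr s R M ->
  let RM := runl (cexp e d) (R, M) in
  [/\ RM.2 = M, forall r, r < d -> RM.1 r = R r & RM.1 d = eval inp s e].
Proof.
move=> + + Hs; have [Hv Ho Hi Ha] := Hs.
(* One argument for all four binary operations: the left value waits in [d0] while the right operand
   is computed in registers from [d0.+1] on, which cannot disturb it. *)
have bin (op : nat -> nat -> nat) i e1 e2 R0 d0 :
    (forall R1, stepi i (R1, M) = (upd R1 d0 (op (R1 d0) (R1 d0.+1)), M)) ->
    repr s R0 M -> rOff < d0 ->
    (forall d R, rOff < d -> repr s R M ->
      [/\ (runl (cexp e1 d) (R, M)).2 = M,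
       forall r, r < d -> (runl (cexp e1 d) (R, M)).1 r = R r
     & (runl (cexp e1 d) (R, M)).1 d = eval inp s e1]) ->
    (forall d R, rOff < d -> repr s R M ->
      [/\ (runl (cexp e2 d) (R, M)).2 = M,
       forall r, r < d -> (runl (cexp e2 d) (R, M)).1 r = R r
     & (runl (cexp e2 d) (R, M)).1 d = eval inp s e2]) ->
    let RM := runl (cexp e1 d0 ++ cexp e2 d0.+1 ++ [:: i]) (R0, M) in
    [/\ RM.2 = M, forall r, r < d0 -> RM.1 r = R0 r
      & RM.1 d0 = op (eval inp s e1) (eval inp s e2)].
  move=> Hst HR0 Hd0 IH1 IH2 /=; rewrite !runl_cat.
  have [] := IH1 d0 R0 Hd0 HR0; case: (runl _ (R0, M)) => [R1 M1]; cbn [fst snd] => -> F1 E1.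
  have HR1 : repr s R1 M.
    by case: HR0 => a b c e'; split=> // [x Hx|]; rewrite F1 //; [apply: a|]; lia.
  have [] := IH2 d0.+1 R1 (leqW Hd0) HR1.
  case: (runl _ (R1, M)) => [R2 M2]; cbn [fst snd] => -> F2 E2.
  rewrite [runl [:: i] _]Hst /=; split=> //=.
    by move=> r Hr; rewrite /upd ifN ?F2 ?F1 //; [lia | apply/eqP; lia].
  by rewrite /upd eqxx E2 F2 // E1.
rewrite /=; elim: e d R Hs {Hv Ho} => /=.
- move=> x d R [Hv _ _ _] Hx Hd; rewrite /runl /=; split=> //.
    by move=> r Hr; rewrite /upd !ifN //; apply/eqP; lia.
  rewrite /upd !eqxx addn0 ifN ?Hv //; apply/eqP; lia.
- move=> c d R Hs _ Hd; rewrite /runl /=; split=> //; last by rewrite /upd eqxx.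
  by move=> r Hr; rewrite /upd !ifN //; apply/eqP; lia.
- move=> e IH d R Hs We Hd; rewrite runl_cat.
  have [] := IH d R Hs We Hd; case: (runl _ (R, M)) => [R1 M1]; cbn [fst snd] => -> F E.
  have Ho : R1 rOff = off by rewrite F //; case: Hs.
  rewrite /runl /=; split=> //.
    by move=> r Hr; rewrite /upd !ifN ?F //; apply/eqP; lia.
  have hd1 : (d == d.+1) = false by apply/eqP; lia.
  rewrite /upd !eqxx hd1 E Ho Hi; last by lia.
  case: (leqP off (eval inp s e)) => Hle; last by congr inp; lia.
  by rewrite !inp0 //; lia.
- move=> A e IH d R Hs /andP [HA We] Hd; rewrite !runl_cat.
  have [] := IH d R Hs We Hd; case: (runl _ (R, M)) => [R1 M1]; cbn [fst snd] => -> F E.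
  have [] := runl_scale A R1 M Hd; case: (runl _ (R1, M)) => [R2 M2]; cbn [fst snd] => -> F2 E2.
  have Ho : R1 rOff = off by rewrite F //; case: Hs.
  rewrite /runl /=; split=> //; first by move=> r Hr; rewrite /upd !ifN ?F2 ?F //; apply/eqP; lia.
  by rewrite /upd !eqxx E2 Ho E Ha.
- move=> e1 IH1 e2 IH2 d R Hs /andP [W1 W2] Hd.
  by apply: (bin addn) => // *; [apply: IH1 | apply: IH2].
- move=> e1 IH1 e2 IH2 d R Hs /andP [W1 W2] Hd.
  by apply: (bin subn) => // *; [apply: IH1 | apply: IH2].
- move=> e1 IH1 e2 IH2 d R Hs /andP [W1 W2] Hd.
  by apply: (bin (fun a b => nat_of_bool (a < b))) => // *; [apply: IH1 | apply: IH2].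
- move=> e1 IH1 e2 IH2 d R Hs /andP [W1 W2] Hd.
  by apply: (bin (fun a b => nat_of_bool (a == b))) => // *; [apply: IH1 | apply: IH2].
Qed.

Lemma exec_cexp p q e s R M : wfe e -> repr s R M -> code_at p q (cexp e rTmp) ->
  exists R', [/\ exec p (size (cexp e rTmp)) (State q R M)
                 = State (q + size (cexp e rTmp)) R' M,
                 repr s R' M & R' rTmp = eval inp s e].
Proof.
move=> We Hs Hc; rewrite exec_linear ?linear_cexp //.
have [] := runl_cexp We (isT : rOff < rTmp) Hs.
case: (runl _ _) => [R1 M1]; cbn [fst snd] => -> F E; exists R1; split=> //.
by case: Hs => a b c d; split=> // [x Hx|]; rewrite F //; [apply: a|]; lia.
Qed.

Lemma exec_jz p q r l R M : nth IHalt p q = IJz r l ->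
  exec p 1 (State q R M) = State (if R r == 0 then l else q.+1) R M.
Proof. by move=> H; rewrite /exec /= /step /fetch /= H. Qed.

Lemma exec_jmp p q l R M : nth IHalt p q = IJmp l ->
  exec p 1 (State q R M) = State l R M.
Proof. by move=> H; rewrite /exec /= /step /fetch /= H. Qed.

(** Apart from the jump back at the end of a loop body, control only moves forward, so without
    iterations each instruction is executed at most once. An iteration pays for one more pass:
    [i1.+1] passes for the body and [i2.+1] for the rest of the loop add up to the claimed
    [(i1 + i2).+2]. *)
Lemma exec_ccom c s s' i : run inp c s s' i ->
  forall p q R M, wfc c -> repr s R M -> code_at p q (ccom c q) ->
  exists t R' M', [/\ t <= i.+1 * size (ccom c q),
    exec p t (State q R M) = State (q + size (ccom c q)) R' M' & repr s' R' M'].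
Proof.
elim=> {c s s' i}.
- by move=> s p q R M _ Hs _; exists 0, R, M; rewrite addn0.
- move=> s x e p q R M /= /andP [Wx We] Hs Hc.
  exists (size (cexp e rTmp ++ [:: IConst x 0; IAdd x x rTmp])).
  rewrite exec_linear //; last by rewrite all_cat linear_cexp.
  rewrite runl_cat; have [] := runl_cexp We (isT : rOff < rTmp) Hs.
  case: (runl _ _) => [R1 M1]; cbn [fst snd] => -> F E.
  eexists; exists M; split; [by rewrite mul1n | reflexivity |].
  rewrite /runl /=.
  case: Hs => Hv Ho Hi Ha; split=> //=.
    move=> y Hy; rewrite /upd eqxx.
    case: (y == x); last by rewrite F ?Hv //; lia.
    by rewrite ifN ?E //; apply/eqP; lia.
  by rewrite /upd !ifN ?F //; apply/eqP; lia.
- move=> s A e1 e2 p q R M /= /and3P [WA W1 W2] Hs Hc.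
  set l := _ ++ _ in Hc *; exists (size l).
  rewrite exec_linear //; last by rewrite !all_cat !linear_cexp.
  rewrite /l !runl_cat; have [] := runl_cexp W1 (isT : rOff < rTmp) Hs.
  case: (runl _ _) => [R1 M1]; cbn [fst snd] => -> F1 E1.
  have [] := runl_scale A R1 M (isT : rOff < rTmp).
  case: (runl _ _) => [R2 M2]; cbn [fst snd] => -> F2 E2.
  have HR2 : repr s R2 M.
    by case: Hs => a b c d; split=> // [x Hx|]; rewrite F2 ?F1 //; [apply: a|..]; lia.
  have [] := runl_cexp W2 (isT : rOff < rTmp.+1) HR2.
  case: (runl _ _) => [R3 M3]; cbn [fst snd] => -> F3 E3.
  eexists; eexists; split; [by rewrite mul1n | reflexivity |].
  rewrite /runl /=.
  have HO : R1 rOff = off by rewrite F1 //; case: Hs.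
  rewrite E3 F3 // E2 E1 HO.
  case: HR2 => Hv Ho Hi Ha; split=> //=.
  + by move=> y Hy; rewrite F3 ?Hv //; apply: ltn_trans Hy _.
  + by rewrite F3.
  + by move=> a Hle; rewrite /upd ifN ?Hi //; apply/eqP; lia.
  + move=> B j HB; rewrite /upd; case: eqP => H1.
      have [-> ->] : B = A /\ j = eval inp s e1 by lia.
      by rewrite !eqxx.
    case: eqP => [E|_]; last exact: Ha.
    by rewrite ifN -?E ?Ha //; apply/eqP => ?; apply: H1; subst.
- move=> s1 s2 s3 c1 c2 i1 i2 _ IH1 _ IH2 p q R M /= /andP [W1 W2] Hs.
  move=> /code_at_cat [H1 H2].
  have [t1 [R1 [M1 [T1 E1 S1]]]] := IH1 p q R M W1 Hs H1.
  have [t2 [R2 [M2 [T2 E2 S2]]]] := IH2 p _ R1 M1 W2 S1 H2.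
  exists (t1 + t2), R2, M2; split=> //; last by rewrite exec_add E1 E2 size_cat addnA.
  by rewrite size_cat; nia.
- move=> s s' e c1 c2 i E0 _ IH p q R M /= /and3P [We W1 _] Hs.
  move=> /code_at_cat [He /code_at_cons [Hj /code_at_cat [H1 /code_at_cons [Hm _]]]].
  have [R0 [X0 S0 V0]] := exec_cexp We Hs He.
  have [t1 [R1 [M1 [T1 E1 S1]]]] := IH p _ R0 M W1 S0 H1.
  exists (size (cexp e rTmp) + 1 + t1 + 1), R1, M1; split=> //.
    by rewrite !size_cat /= size_cat /=; nia.
  rewrite !exec_add X0 (exec_jz _ _ Hj) V0; move/eqP/negbTE: E0 => ->.
  rewrite E1 (exec_jmp _ _ Hm) !size_cat /= size_cat /=; congr State; lia.
- move=> s s' e c1 c2 i E0 _ IH p q R M /= /and3P [We _ W2] Hs.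
  move=> /code_at_cat [He /code_at_cons [Hj /code_at_cat [H1 /code_at_cons [Hm H2]]]].
  have [R0 [X0 S0 V0]] := exec_cexp We Hs He.
  have [t1 [R1 [M1 [T1 E1 S1]]]] := IH p _ R0 M W2 S0 H2.
  exists (size (cexp e rTmp) + 1 + t1), R1, M1; split=> //.
    by rewrite !size_cat /= size_cat /=; nia.
  rewrite !exec_add X0 (exec_jz _ _ Hj) V0 E0 eqxx.
  rewrite E1 !size_cat /= size_cat /=; congr State; lia.
- move=> s1 s2 s3 e c i1 i2 E0 _ IH1 _ IH2 p q R M /= W Hs Hc.
  have /andP [We W1] := W.
  move: (Hc) => /code_at_cat [He /code_at_cons [Hj /code_at_cat [H1 /code_at_cons [Hm _]]]].
  have [R0 [X0 S0 V0]] := exec_cexp We Hs He.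
  have [t1 [R1 [M1 [T1 E1 S1]]]] := IH1 p _ R0 M W1 S0 H1.
  have [t2 [R2 [M2 [T2 E2 S2]]]] := IH2 p q R1 M1 W S1 Hc.
  exists (size (cexp e rTmp) + 1 + t1 + 1 + t2), R2, M2; split=> //.
    by move: T1 T2; rewrite /= !size_cat /= size_cat /=; nia.
  rewrite !exec_add X0 (exec_jz _ _ Hj) V0; move/eqP/negbTE: E0 => ->.
  by rewrite E1 (exec_jmp _ _ Hm) E2.
- move=> s e c E0 p q R M /= /andP [We W1] Hs.
  move=> /code_at_cat [He /code_at_cons [Hj _]].
  have [R0 [X0 S0 V0]] := exec_cexp We Hs He.
  exists (size (cexp e rTmp) + 1), R0, M; split=> //.
    by rewrite !size_cat /= size_cat /=; nia.
  rewrite !exec_add X0 (exec_jz _ _ Hj) V0 E0 eqxx.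
  rewrite !size_cat /= size_cat /=; congr State; lia.
Qed.
End Compile.

(** * Program logic *)

Fixpoint modv (c : com) : seq nat :=
  match c with
  | Asgn x _ => [:: x]
  | Seq c1 c2 | If _ c1 c2 => modv c1 ++ modv c2
  | While _ c => modv c
  | _ => [::]
  end.

Fixpoint moda (c : com) : seq nat :=
  match c with
  | Store A _ _ => [:: A]
  | Seq c1 c2 | If _ c1 c2 => moda c1 ++ moda c2
  | While _ c => moda c
  | _ => [::]
  end.

Definition agree (mv ma : seq nat) (s s' : store) :=
  (forall x, x \notin mv -> vr s' x = vr s x) /\
  (forall A, A \notin ma -> ar s' A = ar s A).

Lemma agree_refl mv ma s : agree mv ma s s.
Proof. by split. Qed.

Lemma agree_trans mv ma s1 s2 s3 :
  agree mv ma s1 s2 -> agree mv ma s2 s3 -> agree mv ma s1 s3.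
Proof.
by move=> [a1 b1] [a2 b2]; split=> *; rewrite ?a2 ?a1 ?b2 ?b1.
Qed.

Lemma agree_sub mv ma mv' ma' s s' : {subset mv <= mv'} -> {subset ma <= ma'} ->
  agree mv ma s s' -> agree mv' ma' s s'.
Proof.
by move=> h1 h2 [a b]; split=> x Hx; [apply: a | apply: b];
  apply: contra Hx => ?; [apply: h1 | apply: h2].
Qed.

Section Spec.
Variable inp : nat -> nat.

Lemma run_agree c s s' i : run inp c s s' i -> agree (modv c) (moda c) s s'.
Proof.
elim=> {c s s' i} //=.
- by move=> s x e; split=> //= y; rewrite inE => /negbTE ->.
- by move=> s A e1 e2; split=> //= B; rewrite inE => /negbTE ->.
- move=> s1 s2 s3 c1 c2 i1 i2 _ H1 _ H2; apply: (@agree_trans _ _ _ s2);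
    by [apply: agree_sub H1 => x; rewrite mem_cat => ->
       |apply: agree_sub H2 => x; rewrite mem_cat => ->; rewrite orbT].
- move=> s s' e c1 c2 i _ _ H.
  by apply: agree_sub H => x; rewrite mem_cat => ->.
- move=> s s' e c1 c2 i _ _ H.
  by apply: agree_sub H => x; rewrite mem_cat => ->; rewrite orbT.
- by move=> s1 s2 s3 e c i1 i2 _ _ H1 _ H2; apply: agree_trans H1 H2.
Qed.

(** Total correctness from one given store, [T] bounding the loop iterations. What a command leaves
    unchanged is not part of [Q]: the rules supply it as [agree], read off the syntax. *)
Definition spec (s : store) (c : com) (Q : store -> Prop) (T : nat) :=
  exists s' i, [/\ run inp c s s' i, Q s' & i <= T].

Lemma spec_weaken s c (Q Q' : store -> Prop) T T' : spec s c Q T ->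
  (forall s', agree (modv c) (moda c) s s' -> Q s' -> Q' s') -> T <= T' ->
  spec s c Q' T'.
Proof.
move=> [s' [i [r q t]]] HQ HT; exists s', i; split=> //; last by lia.
by apply: HQ => //; apply: run_agree r.
Qed.

Lemma spec_skip s (Q : store -> Prop) T : Q s -> spec s Skip Q T.
Proof. by move=> H; exists s, 0; split=> //; constructor. Qed.

Lemma spec_asgn s x e (Q : store -> Prop) :
  Q (setv s x (eval inp s e)) -> spec s (Asgn x e) Q 0.
Proof. by move=> H; eexists; exists 0; split; [constructor | |]. Qed.

Lemma spec_store s A e1 e2 (Q : store -> Prop) :
  Q (seta s A (eval inp s e1) (eval inp s e2)) -> spec s (Store A e1 e2) Q 0.
Proof. by move=> H; eexists; exists 0; split; [constructor | |]. Qed.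

Lemma spec_seq s c1 c2 (Q1 Q : store -> Prop) T1 T2 :
  spec s c1 Q1 T1 ->
  (forall s', agree (modv c1) (moda c1) s s' -> Q1 s' -> spec s' c2 Q T2) ->
  spec s (Seq c1 c2) Q (T1 + T2).
Proof.
move=> [s1 [i1 [r1 q1 t1]]] H2.
have [s2 [i2 [r2 q2 t2]]] := H2 s1 (run_agree r1) q1.
by exists s2, (i1 + i2); split=> //; [econstructor; eassumption | lia].
Qed.

Lemma spec_asgn_seq s x e c (Q : store -> Prop) T :
  spec (setv s x (eval inp s e)) c Q T -> spec s (Seq (Asgn x e) c) Q T.
Proof.
move=> H; rewrite -[T]add0n; apply: spec_seq (spec_asgn (Q := eq^~ _) erefl) _.
by move=> s' _ ->.
Qed.

Lemma spec_store_seq s A e1 e2 c (Q : store -> Prop) T :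
  spec (seta s A (eval inp s e1) (eval inp s e2)) c Q T ->
  spec s (Seq (Store A e1 e2) c) Q T.
Proof.
move=> H; rewrite -[T]add0n; apply: spec_seq (spec_store (Q := eq^~ _) erefl) _.
by move=> s' _ ->.
Qed.

Lemma spec_if s e c1 c2 (Q : store -> Prop) T :
  (eval inp s e <> 0 -> spec s c1 Q T) ->
  (eval inp s e = 0 -> spec s c2 Q T) ->
  spec s (If e c1 c2) Q T.
Proof.
move=> H1 H2; case: (eqVneq (eval inp s e) 0) => [E|/eqP E].
  have [s' [i [r q t]]] := H2 E.
  by exists s', i; split=> //; apply: RIfF.
have [s' [i [r q t]]] := H1 E.
by exists s', i; split=> //; apply: RIfT.
Qed.

Lemma spec_while s e c (I : store -> Prop) (mu : store -> nat) B :
  I s ->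
  (forall s', agree (modv c) (moda c) s s' -> I s' -> eval inp s' e <> 0 ->
     spec s' c (fun s2 => I s2 /\ mu s2 < mu s') B) ->
  spec s (While e c) (fun s' => I s' /\ eval inp s' e = 0) (mu s * B.+1).
Proof.
move=> Is H; have := agree_refl (modv c) (moda c) s; move: Is.
move: {-2}s => s1; have [m] := ubnP (mu s1).
elim: m s1 => // m IH s1 Hm I1 A1.
case: (eqVneq (eval inp s1 e) 0) => [E|/eqP E].
  by exists s1, 0; split=> //; apply: RWhileF.
have [s2 [i2 [r2 [I2 m2] t2]]] := H s1 A1 I1 E.
have A2 := agree_trans A1 (run_agree r2).
have [|s3 [i3 [r3 q3 t3]]] := IH s2 _ I2 A2; first by lia.
exists s3, (i2 + i3).+1; split=> //; first by econstructor; eassumption.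
have : (mu s2).+1 * B.+1 <= mu s1 * B.+1 by rewrite leq_mul2r m2 orbT.
by rewrite mulSn; lia.
Qed.

Definition For (x xn : nat) (c : com) : com :=
  Seq (Asgn x (Cst 0))
      (While (Lt (Var x) (Var xn)) (Seq c (Asgn x (Add (Var x) (Cst 1))))).

Lemma spec_for s x xn c (I : nat -> store -> Prop) N B :
  vr s xn = N -> (x != xn) && (x \notin modv c) && (xn \notin modv c) ->
  I 0 (setv s x 0) ->
  (forall j s', j < N -> agree (x :: modv c) (moda c) s s' ->
     vr s' x = j -> I j s' ->
     spec s' c (fun s2 => I j.+1 (setv s2 x j.+1)) B) ->
  spec s (For x xn c) (I N) (N * B.+1).
Proof.
move=> HN /andP[/andP [xxn xc] xnc] I0 Hc.
apply: spec_asgn_seq => /=.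
pose J s' := [/\ vr s' xn = N, vr s' x <= N & I (vr s' x) s'].
pose mu s' := N - vr s' x.
set s0 := setv s x 0.
have Emu : mu s0 = N by rewrite /mu /= eqxx subn0.
have J0 : J s0.
  by split; rewrite /= ?eqxx // ifN ?HN // eq_sym.
have -> : N * B.+1 = mu s0 * B.+1 by rewrite Emu.
have := @spec_while s0 (Lt (Var x) (Var xn))
  (Seq c (Asgn x (Add (Var x) (Cst 1)))) J mu B J0.
case=> [|s' [i [r [[J1 J2 J3] E] t]]].
  move=> s' A [Jn Jx JI] /= Hlt; rewrite Jn in Hlt.
  have {}Hlt : vr s' x < N by case: (_ < N) Hlt.
  have A' : agree (x :: modv c) (moda c) s s'.
    apply: (@agree_trans _ _ _ s0).
      by split=> // y; rewrite inE negb_or => /andP [/negbTE yx _]; rewrite /= yx.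
    apply: agree_sub A => y /=; last by rewrite cats0.
    by rewrite mem_cat mem_seq1 in_cons orbC.
  rewrite -[B]addn0.
  apply: spec_seq (Hc _ _ Hlt A' erefl JI) _ => s2 A2 H2.
  have E1 : vr s2 x = vr s' x by case: A2 => -> //.
  have E2 : vr s2 xn = N by case: A2 => -> //.
  apply: spec_asgn; rewrite /= E1 addn1; split; last first.
    by rewrite /mu /= eqxx; lia.
  by split; rewrite /= ?eqxx // ifN ?E2 // eq_sym.
exists s', i; split=> //.
suff -> : N = vr s' x by [].
by move: E => /=; rewrite J1; case: ltnP => // h _; apply/eqP; rewrite eqn_leq h J2.
Qed.
End Spec.

Lemma agreev mv ma s s' x : agree mv ma s s' -> x \notin mv -> vr s' x = vr s x.
Proof. by case=> H _; apply: H. Qed.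

Lemma agreea mv ma s s' A : agree mv ma s s' -> A \notin ma -> ar s' A = ar s A.
Proof. by case=> _; apply. Qed.
Arguments spec : simpl never.

(** * Arms, white points and colorings *)

(* Depth of a point below the left ([h = false]) or right border, and below the
   bottom ([v = false]) or top border, of an [N] by [N] square: the reflection
   carrying the arm [(h, v)] to the lower left one. *)
Definition hd (N : nat) (h : bool) (p : nat) := if h then N - p else p.+1.
Definition vd (N : nat) (v : bool) (y : nat) := if v then N.+1 - y else y.

Definition permf (N : nat) (f : nat -> nat) :=
  (forall p, p < N -> 0 < f p <= N) /\
  (forall p q, p < N -> q < N -> f p = f q -> p = q).

Definition coloring (N : nat) (f : nat -> nat) (P : nat -> bool) :=
  forall p q, p < q < N ->
    (P p -> P q -> f p < f q) /\ (~~ P p -> ~~ P q -> f p > f q).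

(* Up to reflection, [x] plays the role of 1 in a pattern 132: this forces [x]
   into the arm [(h, v)] of every skew-merged drawing. *)
Definition cert (N : nat) (f : nat -> nat) (h v : bool) (x : nat) :=
  exists y z, [/\ y < N, z < N, hd N h x < hd N h y < hd N h z
    & vd N v (f x) < vd N v (f z) < vd N v (f y)].

Definition white (N : nat) (f : nat -> nat) (x : nat) :=
  forall h v, ~ cert N f h v x.

Section Frames.
Variables (N : nat) (f : nat -> nat) (P : nat -> bool).
Hypothesis (Hf : permf N f) (HP : coloring N f P).

(** The reflection that carries the arm [(h, v)] to the lower left preserves the direction of
    monotone sequences iff [h == v]; so in reflected coordinates the color [h == v] is always the
    increasing one. *)
Lemma coloring_same h v p q : p < N -> q < N ->
  P p = (h == v) -> P q = (h == v) -> hd N h p < hd N h q ->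
  vd N v (f p) < vd N v (f q).
Proof.
move=> Hp Hq Pp Pq; have := Hf.1 p Hp; have := Hf.1 q Hq.
have := HP (p := p) (q := q); have := HP (p := q) (q := p).
rewrite {}Pp {}Pq; case: h; case: v; rewrite /hd /vd /=; lia.
Qed.

Lemma coloring_opp h v p q : p < N -> q < N ->
  P p = (h != v) -> P q = (h != v) -> hd N h p < hd N h q ->
  vd N v (f q) < vd N v (f p).
Proof.
move=> Hp Hq Pp Pq; have := Hf.1 p Hp; have := Hf.1 q Hq.
have := HP (p := p) (q := q); have := HP (p := q) (q := p).
rewrite {}Pp {}Pq; case: h; case: v; rewrite /hd /vd /=; lia.
Qed.

(** In reflected coordinates [y] and [z] form a descent, so one of them is decreasing. Both form an
    ascent with [x], so [x] cannot be decreasing too. The decreasing one is the witness [z] of the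
    conclusion. *)
Lemma cert_color h v x : x < N -> cert N f h v x ->
  P x = (h == v) /\ exists z, [/\ z < N, P z = (h != v),
    hd N h x < hd N h z & vd N v (f x) < vd N v (f z)].
Proof.
move=> Hx [y [z [Hy Hz Hh Hv]]].
have E : forall b : bool, b = (h == v) \/ b = (h != v) by case; case: (h == v); auto.
have S := @coloring_same h v; have O := @coloring_opp h v.
have [Py|Py] := E (P y); have [Pz|Pz] := E (P z).
- by have := S y z Hy Hz Py Pz; lia.
- have [Px|Px] := E (P x); last by have := O x z Hx Hz Px Pz; lia.
  by split=> //; exists z; split=> //; lia.
- have [Px|Px] := E (P x); last by have := O x y Hx Hy Px Py; lia.
  by split=> //; exists y; split=> //; lia.
- have [Px|Px] := E (P x); last by have := O x y Hx Hy Px Py; lia.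
  by split=> //; exists y; split=> //; lia.
Qed.

(** Depths from opposite borders adding up to at most [N] mean that the two points do not pass each
    other. Each of them has a deeper point of the other color behind it, and monotonicity of both
    colors on these four points excludes a crossing. *)
Lemma cert_cross_h h v v' x y : x < N -> y < N ->
  cert N f h v x -> cert N f (~~ h) v' y -> hd N h x + hd N (~~ h) y <= N.
Proof.
move=> Hx Hy /(cert_color Hx) [Px [z [Hz Pz zh zv]]].
move=> /(cert_color Hy) [Py [w [Hw Pw wh wv]]].
have xx := Hf.1 x Hx; have yy := Hf.1 y Hy.
have zz := Hf.1 z Hz; have ww := Hf.1 w Hw.
have nxy : x = y -> f x = f y /\ (h == v) = (~~ h == v').
  by move=> exy; rewrite -Px -Py exy.
have := HP (p := x) (q := y); have := HP (p := y) (q := x).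
have := HP (p := z) (q := w); have := HP (p := w) (q := z).
have := HP (p := x) (q := w); have := HP (p := w) (q := x).
have := HP (p := y) (q := z); have := HP (p := z) (q := y).
rewrite {}Px {}Py {}Pz {}Pw; move: nxy zh zv wh wv.
case: h; case: v; case: v'; rewrite /hd /vd /=; lia.
Qed.

Lemma cert_cross_v v h h' x y : x < N -> y < N ->
  cert N f h v x -> cert N f h' (~~ v) y ->
  vd N v (f x) + vd N (~~ v) (f y) <= N.
Proof.
move=> Hx Hy /(cert_color Hx) [Px [z [Hz Pz zh zv]]].
move=> /(cert_color Hy) [Py [w [Hw Pw wh wv]]].
have xx := Hf.1 x Hx; have yy := Hf.1 y Hy.
have zz := Hf.1 z Hz; have ww := Hf.1 w Hw.
have nxy : f x = f y -> x = y /\ (h == v) = (h' == ~~ v).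
  by move/(Hf.2 _ _ Hx Hy) => exy; rewrite -Px -Py exy.
have := HP (p := x) (q := y); have := HP (p := y) (q := x).
have := HP (p := z) (q := w); have := HP (p := w) (q := z).
have := HP (p := x) (q := w); have := HP (p := w) (q := x).
have := HP (p := y) (q := z); have := HP (p := z) (q := y).
rewrite {}Px {}Py {}Pz {}Pw; move: nxy zh zv wh wv.
case: h; case: v; case: h'; rewrite /hd /vd /=; lia.
Qed.
End Frames.

Section White.
Variables (N : nat) (f : nat -> nat).
Hypothesis (Hf : permf N f).

(** If [w] were not inside, it would form a certificate with two of the three points [x], [y], [z],
    for the arm [(h, v)], [(h, ~~ v)] or [(~~ h, v)]. *)
Lemma white_inside w h v x : w < N -> x < N -> white N f w -> cert N f h v x ->
  hd N h x < hd N h w /\ vd N v (f x) < vd N v (f w).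
Proof.
move=> Hw Hx Ww Cx; have xw : x <> w by move=> E; case: (Ww h v); rewrite -E.
have fxw : f x <> f w by move/(Hf.2 _ _ Hx Hw).
case: Cx => y [z [Hy Hz Hh Hv]].
have xx := Hf.1 x Hx; have yy := Hf.1 y Hy.
have zz := Hf.1 z Hz; have ww := Hf.1 w Hw.
have fzw : f z = f w -> z = w by apply: Hf.2.
have n1 : ~ (hd N h w < hd N h y /\ vd N v (f w) < vd N v (f z)).
  by move=> [a b]; apply: (Ww h v); exists y, z; split=> //; lia.
have n2 : ~ (hd N h w < hd N h x /\ vd N v (f z) < vd N v (f w)).
  move=> [a b]; apply: (Ww h (~~ v)); exists x, z; split=> //; first by lia.
  by move: Hv b; rewrite /vd; case: (v) => /=; lia.
have n3 : ~ (hd N h y < hd N h w /\ vd N v (f w) < vd N v (f x)).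
  move=> [a b]; apply: (Ww (~~ h) v); exists y, x; split=> //; last by lia.
  by move: Hh a; rewrite /hd; case: (h) => /=; lia.
have fyw : y = w -> f y = f w by move=> ->.
have fzw' : z = w -> f z = f w by move=> ->.
move: Hh Hv n1 n2 n3; rewrite /hd /vd; case: (h); case: (v); lia.
Qed.

(** Each of the four patterns 132, 213, 231, 312 certifies its first or its last point. *)
Lemma white_monotone a b c : a < b -> b < c -> c < N ->
  white N f a -> white N f b -> white N f c ->
  f a < f b < f c \/ f c < f b < f a.
Proof.
move=> ab bc cN Wa Wb Wc.
have bN : b < N by lia.
have aN : a < N by lia.
have xx := Hf.1 a aN; have yy := Hf.1 b bN; have zz := Hf.1 c cN.
have n1 : f a <> f b by move/(Hf.2 _ _ aN bN); lia.
have n2 : f b <> f c by move/(Hf.2 _ _ bN cN); lia.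
have n3 : f a <> f c by move/(Hf.2 _ _ aN cN); lia.
have c1 : ~ (f a < f c < f b).
  by move=> ?; apply: (Wa false false); exists b, c; rewrite /hd /vd; split; lia.
have c2 : ~ (f b < f a < f c).
  by move=> ?; apply: (Wc true true); exists b, a; rewrite /hd /vd; split; lia.
have c3 : ~ (f c < f a < f b).
  by move=> ?; apply: (Wc true false); exists b, a; rewrite /hd /vd; split; lia.
have c4 : ~ (f b < f c < f a).
  by move=> ?; apply: (Wa false true); exists b, c; rewrite /hd /vd; split; lia.
lia.
Qed.
End White.

(* If position [i] is increasing, [(last_values i).1] is the largest possible
   last decreasing value of a coloring of the first [i.+1] positions ([0] if
   there is none, [N.+1] if no position is decreasing); if position [i] is
   decreasing, [(last_values i).2] is the least possible last increasing value
   ([N.+1] if there is none, [0] if no position is increasing). *)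
Section Dynamic.
Variables (N : nat) (f : nat -> nat).

Fixpoint last_values (i : nat) : nat * nat :=
  if i is j.+1 then
    let: (D, U) := last_values j in
    (maxn (if f j < f j.+1 then D else 0) (if U < f j.+1 then f j else 0),
     minn (if f j.+1 < f j then U else N.+1) (if f j.+1 < D then f j else N.+1))
  else (N.+1, 0).

(** The bound [u] replaces the last value of the other color, so that a color that has not occurred
    yet needs no separate case. *)
Lemma last_values_optimal P i : permf N f -> coloring N f P -> i < N ->
  (P i -> forall u, u <= N -> (forall j, j <= i -> ~~ P j -> u < f j) ->
     u < (last_values i).1) /\
  (~~ P i -> forall u, 0 < u -> (forall j, j <= i -> P j -> f j < u) ->
     (last_values i).2 < u).
Proof.
move=> Hf HP; elim: i => [|i IH] Hi; first by split=> // _ u.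
have iN : i < N by lia.
have [{}IH1 IH2] := IH iN.
have [HPi HPi'] := HP i i.+1 ltac:(lia).
have fi := Hf.1 i iN; have fi1 := Hf.1 i.+1 Hi.
move=> /=; case E: (last_values i) IH1 IH2 => [D U] /= IH1 IH2; split.
  move=> Pi u Hu H.
  case Pp: (P i).
    have -> : f i < f i.+1 by apply: HPi.
    by rewrite leq_max IH1 // => j Hj; apply: H; lia.
  have lt : U < f i.+1.
    apply: IH2; [by rewrite Pp | by lia |] => j Hj Pj.
    by have [] := HP j i.+1 ltac:(lia); auto.
  by rewrite lt leq_max (H i) ?Pp // orbT.
move=> Pi u Hu H.
case Pp: (P i).
  have lt : f i.+1 < D.
    apply: IH1 => //; first by lia.
    by move=> j Hj Pj; have [_] := HP j i.+1 ltac:(lia); auto.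
  by rewrite lt gtn_min (H i) // orbT.
have -> : f i.+1 < f i by apply: HPi' => //; rewrite Pp.
rewrite gtn_min; apply/orP; left.
by apply: IH2 => //; [rewrite Pp | move=> j Hj; apply: H; lia].
Qed.

(** The choices are recovered without having been stored: equal entries at [i] and [i.+1] show that
    the extremum was attained with both positions in the same color. At the last position the entry
    0 means that increasing is impossible. *)
Definition choice_ok (c : nat -> bool) i :=
  c i = if i.+1 == N then 0 < (last_values i).1 else
        if c i.+1 then (f i < f i.+1) && ((last_values i).1 == (last_values i.+1).1)
        else ~~ ((f i.+1 < f i) && ((last_values i).2 == (last_values i.+1).2)).

Lemma backtrace_coloring P c : permf N f -> coloring N f P ->
  (forall i, i < N -> choice_ok c i) -> coloring N f c.
Proof.
move=> Hf HP Hc.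
(* From right to left: besides a colored suffix, the induction keeps that the later values of the
   color other than that of [i] are compatible with the last value that [last_values i] promises for
   the prefix. *)
suff H : forall m i, i + m.+1 = N ->
    [/\ forall p q, i <= p -> p < q < N ->
          (c p -> c q -> f p < f q) /\ (~~ c p -> ~~ c q -> f p > f q),
        c i -> 0 < (last_values i).1 /\
          (forall q, i < q < N -> ~~ c q -> f q < (last_values i).1)
      & ~~ c i -> (last_values i).2 <= N /\
          (forall q, i < q < N -> c q -> (last_values i).2 < f q)].
  move=> p q pq; have [|H1 _ _] := H N.-1 0; first by lia.
  exact: H1.
elim=> [|m IH] i Hi.
  have iN : i < N by lia.
  have := Hc i iN; rewrite /choice_ok.
  have -> : i.+1 == N by lia.
  move=> Ec; split.
  - by move=> p q; lia.
  - by move=> ci; split; [rewrite -Ec | move=> q; lia].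
  move=> ci; split; last by move=> q; lia.
  (* If [P] were increasing here, optimality with [u = 0] would make the first entry positive. So
     [P] is decreasing here, and [u = N.+1] shows that the second entry is finite. *)
  have [O1 O2] := last_values_optimal Hf HP iN.
  case Pi: (P i).
    have := O1 Pi 0 isT; rewrite -Ec (negbTE ci) => H; exfalso.
    suff : false by []; apply: H => j Hj _.
    by have := Hf.1 j ltac:(lia); lia.
  apply: (O2 _ N.+1); [by rewrite Pi | by [] |] => j Hj _.
  by have := Hf.1 j ltac:(lia); lia.
have [H1 H2 H3] := IH i.+1 ltac:(lia).
have iN : i < N by lia.
have fi := Hf.1 i iN; have fi1 := Hf.1 i.+1 ltac:(lia).
have := Hc i iN; rewrite /choice_ok.
have -> : (i.+1 == N) = false by lia.
have split_q q : i < q < N -> q = i.+1 \/ i.+1 < q < N by lia.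
have extend : (c i -> forall q, i < q < N -> c q -> f i < f q) ->
    (~~ c i -> forall q, i < q < N -> ~~ c q -> f q < f i) ->
    forall p q, i <= p -> p < q < N ->
      (c p -> c q -> f p < f q) /\ (~~ c p -> ~~ c q -> f p > f q).
  move=> e1 e2 p q; rewrite leq_eqVlt => /orP [/eqP <-|ip] pq; last exact: H1.
  by split=> ? ?; [apply: e1 | apply: e2].
case Ci1: (c i.+1).
  have [D0 DD] := H2 Ci1.
  case E: ((f i < f i.+1) && _) => Ci.
    move/andP: E => [lt /eqP ED].
    split.
    - apply: extend; last by rewrite Ci.
      move=> _ q /split_q [->//|hq] cq.
      by have [h _] := H1 i.+1 q (leqnn _) hq; have := h Ci1 cq; lia.
    - move=> _; rewrite ED; split=> // q /split_q [->|hq]; last exact: DD.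
      by rewrite Ci1.
    - by rewrite Ci.
  move: D0 DD E => /=; case EL: (last_values i) => [D U] /= D0 DD E.
  (* The maximum is positive and not attained by its first candidate, hence it is the second:
     position [i] is the last decreasing one. *)
  have [Ilt ED] : U < f i.+1 /\ maxn (if f i < f i.+1 then D else 0)
      (if U < f i.+1 then f i else 0) = f i.
    by move: D0 E; case: (f i < f i.+1); case: (U < f i.+1) => //=; lia.
  rewrite ED in DD.
  split.
  - apply: extend; first by rewrite Ci.
    move=> _ q /split_q [->|hq]; last exact: DD.
    by rewrite Ci1.
  - by rewrite Ci.
  - move=> _; split; first by lia.
    move=> q /split_q [->//|hq] cq.
    by have [h _] := H1 i.+1 q (leqnn _) hq; have := h Ci1 cq; lia.
have {}Ci1 : ~~ c i.+1 by rewrite Ci1.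
have [D0 DD] := H3 Ci1.
case E: ((f i.+1 < f i) && _) => /= Ci.
  move/andP: E => [lt /eqP ED].
  split.
  - apply: extend; first by rewrite Ci.
    move=> _ q /split_q [->//|hq] cq.
    by have [_ h] := H1 i.+1 q (leqnn _) hq; have := h Ci1 cq; lia.
  - by rewrite Ci.
  - move=> _; rewrite ED; split=> // q /split_q [->|hq]; last exact: DD.
    by rewrite (negbTE Ci1).
move: D0 DD E => /=; case EL: (last_values i) => [D U] /= D0 DD E.
have [Ilt ED] : f i.+1 < D /\ minn (if f i.+1 < f i then U else N.+1)
    (if f i.+1 < D then f i else N.+1) = f i.
  by move: D0 E; case: (f i.+1 < f i); case: (f i.+1 < D) => //=; lia.
rewrite ED in DD.
split.
- apply: extend; last by rewrite Ci.
  move=> _ q /split_q [->|hq]; last exact: DD.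
  by rewrite (negbTE Ci1).
- move=> _; split; first by lia.
  move=> q /split_q [->//|hq] cq.
  by have [_ h] := H1 i.+1 q (leqnn _) hq; have := h Ci1 cq; lia.
- by rewrite Ci.
Qed.
End Dynamic.

(** * Coloring of the text *)

Definition Cond x e e1 e2 := If e (Asgn x e1) (Asgn x e2).

Lemma spec_cond inp s x e e1 e2 (Q : store -> Prop) :
  Q (setv s x (if eval inp s e != 0 then eval inp s e1 else eval inp s e2)) ->
  spec inp s (Cond x e e1 e2) Q 0.
Proof.
move=> H; apply: spec_if => E; apply: spec_asgn; first by move/eqP: E H => ->.
by rewrite E eqxx in H.
Qed.

Lemma spec_cond_seq inp s x e e1 e2 c (Q : store -> Prop) T :
  spec inp (setv s x (if eval inp s e != 0 then eval inp s e1 else eval inp s e2))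
    c Q T ->
  spec inp s (Seq (Cond x e e1 e2) c) Q T.
Proof.
move=> H; rewrite -[T]add0n.
by apply: spec_seq (spec_cond (Q := eq^~ _) erefl) _ => s' _ ->.
Qed.

Lemma nat_of_bool_neq0 (b : bool) : (nat_of_bool b != 0) = b.
Proof. by case: b. Qed.

Lemma nat_of_bool_true (b : bool) : nat_of_bool b <> 0 -> b.
Proof. by case: b. Qed.

Lemma nat_of_bool_false (b : bool) : nat_of_bool b = 0 -> ~~ b.
Proof. by case: b. Qed.

Lemma spec_asgn_eq inp s x e (Q : store -> Prop) :
  (forall a, a = eval inp s e -> Q (setv s x a)) -> spec inp s (Asgn x e) Q 0.
Proof. by move=> H; apply: spec_asgn; apply: H. Qed.

Lemma spec_asgn_seq_eq inp s x e c (Q : store -> Prop) T :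
  (forall a, a = eval inp s e -> spec inp (setv s x a) c Q T) ->
  spec inp s (Seq (Asgn x e) c) Q T.
Proof. by move=> H; apply: spec_asgn_seq; apply: H. Qed.

Lemma spec_store_eq inp s A e1 e2 (Q : store -> Prop) :
  (forall i a, i = eval inp s e1 -> a = eval inp s e2 -> Q (seta s A i a)) ->
  spec inp s (Store A e1 e2) Q 0.
Proof. by move=> H; apply: spec_store; apply: H. Qed.

Lemma spec_store_seq_eq inp s A e1 e2 c (Q : store -> Prop) T :
  (forall i a, i = eval inp s e1 -> a = eval inp s e2 ->
     spec inp (seta s A i a) c Q T) ->
  spec inp s (Seq (Store A e1 e2) c) Q T.
Proof. by move=> H; apply: spec_store_seq; apply: H. Qed.

Lemma spec_cond_eq inp s x e e1 e2 (Q : store -> Prop) :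
  (forall a, a = (if eval inp s e != 0 then eval inp s e1 else eval inp s e2) ->
     Q (setv s x a)) ->
  spec inp s (Cond x e e1 e2) Q 0.
Proof. by move=> H; apply: spec_cond; apply: H. Qed.

Lemma spec_cond_seq_eq inp s x e e1 e2 c (Q : store -> Prop) T :
  (forall a, a = (if eval inp s e != 0 then eval inp s e1 else eval inp s e2) ->
     spec inp (setv s x a) c Q T) ->
  spec inp s (Seq (Cond x e e1 e2) c) Q T.
Proof. by move=> H; apply: spec_cond_seq; apply: H. Qed.

Ltac name_value :=
  let a := fresh "a" in let E := fresh "E" in
  intros a E; simpl in E; rewrite ?nat_of_bool_neq0 in E.
Ltac name_store :=
  let i := fresh "i" in let a := fresh "a" in
  let Ei := fresh "Ei" in let E := fresh "E" in
  intros i a Ei E; simpl in Ei, E; rewrite ?nat_of_bool_neq0 in Ei, E.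

(* Naming the assigned values keeps the symbolic states of linear size. *)
Ltac exec_step :=
  lazymatch goal with
  | |- spec _ _ (Seq (Asgn _ _) _) _ _ => apply: spec_asgn_seq_eq; name_value
  | |- spec _ _ (Seq (Store _ _ _) _) _ _ => apply: spec_store_seq_eq; name_store
  | |- spec _ _ (Seq (Cond _ _ _ _) _) _ _ => apply: spec_cond_seq_eq; name_value
  | |- spec _ _ (Asgn _ _) _ _ => apply: spec_asgn_eq; name_value
  | |- spec _ _ (Store _ _ _) _ _ => apply: spec_store_eq; name_store
  | |- spec _ _ (Cond _ _ _ _) _ _ => apply: spec_cond_eq; name_value
  | |- spec _ _ Skip _ _ => apply: spec_skip
  end.
Ltac exec_block := repeat exec_step.

Declare Scope com_scope.
Delimit Scope com_scope with com.
Bind Scope com_scope with com.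
Notation "c1 ;; c2" := (Seq c1 c2) (at level 70, right associativity) : com_scope.

Notation xR := 0 (only parsing).
Notation xN := 1 (only parsing).
Notation xK := 2 (only parsing).
Notation xI := 3 (only parsing).
Notation xJ := 4 (only parsing).

Notation aD := 0 (only parsing).
Notation aU := 1 (only parsing).
Notation aC := 2 (only parsing).

(** Truncated subtraction yields the maximum [a + (b - a)] and the minimum [a - (a - b)]. The last
    round reads the cell after the text as [tau n]; the entries below [n] do not depend on it. *)
Definition com_last_values : com :=
  (Store aD (Cst 0) (Add (Var xN) (Cst 1)) ;;
   Store aU (Cst 0) (Cst 0) ;;
   For xI xN
    (Asgn 5 (Inp (Add (Var xI) (Cst 2))) ;;
     Asgn 6 (Inp (Add (Var xI) (Cst 3))) ;;
     Asgn 7 (Arr aD (Var xI)) ;;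
     Asgn 8 (Arr aU (Var xI)) ;;
     Cond 9 (Lt (Var 5) (Var 6)) (Var 7) (Cst 0) ;;
     Cond 10 (Lt (Var 8) (Var 6)) (Var 5) (Cst 0) ;;
     Store aD (Add (Var xI) (Cst 1)) (Add (Var 9) (Sub (Var 10) (Var 9))) ;;
     Cond 9 (Lt (Var 6) (Var 5)) (Var 8) (Add (Var xN) (Cst 1)) ;;
     Cond 10 (Lt (Var 6) (Var 7)) (Var 5) (Add (Var xN) (Cst 1)) ;;
     Store aU (Add (Var xI) (Cst 1)) (Sub (Var 9) (Sub (Var 9) (Var 10)))))%com.

Section Coloring.
Variables (inp : nat -> nat) (n : nat).
Let tau i := inp (i + 2).

Lemma spec_last_values s : vr s xN = n ->
  spec inp s com_last_values
    (fun s' => forall j, j <= n ->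
      ar s' aD j = (last_values n tau j).1 /\ ar s' aU j = (last_values n tau j).2) n.
Proof.
move=> En; rewrite /com_last_values; exec_block.
rewrite -[X in spec _ _ _ _ X]muln1.
pose I i s' := forall j, j <= i ->
  ar s' aD j = (last_values n tau j).1 /\ ar s' aU j = (last_values n tau j).2.
apply: (@spec_for _ _ _ _ _ I) => //=.
  by case=> //= _; rewrite Ei E Ei0 E0 En addn1.
move=> j s' Hj A Ej IH; exec_block.
rewrite Ej in Ei1 Ei2 E1 E2 E3 E4.
move=> l Hl /=; rewrite Ei1 Ei2 addn1 /upd; case: (ltngtP l j.+1) Hl => // [Hl _|-> _].
  exact: IH.
have [h1 h2] := IH j (leqnn _).
have vn : vr s' 1 = n by rewrite (agreev A).
rewrite {}vn addn1 in E8 E9; rewrite E7 E10 E5 E6 E8 E9 E1 E2 E3 E4 h1 h2.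
have -> : inp (j + 3) = tau j.+1 by congr inp; lia.
rewrite -/(tau j) /=.
by case: (last_values n tau j) => [D U]; split=> //=; lia.
Qed.

(** Here and below a conjunction of tests is computed by adding them and comparing the sum with
    their number. *)
Definition com_backtrace : com :=
  For xI xN
   (Asgn 5 (Sub (Sub (Var xN) (Cst 1)) (Var xI)) ;;
    Asgn 6 (Inp (Add (Var 5) (Cst 2))) ;;
    Asgn 7 (Inp (Add (Var 5) (Cst 3))) ;;
    Asgn 8 (Eq (Add (Lt (Var 6) (Var 7))
                    (Eq (Arr aD (Var 5)) (Arr aD (Add (Var 5) (Cst 1))))) (Cst 2)) ;;
    Asgn 9 (Sub (Cst 1) (Eq (Add (Lt (Var 7) (Var 6))
                    (Eq (Arr aU (Var 5)) (Arr aU (Add (Var 5) (Cst 1))))) (Cst 2))) ;;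
    Cond 8 (Arr aC (Add (Var 5) (Cst 1))) (Var 8) (Var 9) ;;
    Cond 8 (Eq (Var xI) (Cst 0)) (Lt (Cst 0) (Arr aD (Var 5))) (Var 8) ;;
    Store aC (Var 5) (Var 8))%com.

Lemma spec_backtrace s P : vr s xN = n -> permf n tau -> coloring n tau P ->
  (forall j, j <= n -> ar s aD j = (last_values n tau j).1 /\
                       ar s aU j = (last_values n tau j).2) ->
  spec inp s com_backtrace
    (fun s' => (forall j, j < n -> ar s' aC j <= 1) /\
               coloring n tau (fun j => ar s' aC j != 0)) n.
Proof.
move=> En Hf HP HDU; rewrite -[X in spec _ _ _ _ X]muln1.
pose I i s' := forall j, n <= j + i -> j < n ->
  ar s' aC j <= 1 /\ choice_ok n tau (fun j => ar s' aC j != 0) j.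
apply: (@spec_weaken _ _ _ (I n) _ (n * 1)) => [|s' _ H|//]; last first.
  split=> [j Hj|]; first by have [] := H j (leq_addl _ _) Hj.
  apply: (backtrace_coloring Hf HP) => j Hj.
  by have [] := H j (leq_addl _ _) Hj.
rewrite /com_backtrace; apply: (@spec_for _ _ _ _ _ I) => //=; first by move=> j; lia.
move=> i s' Hi A Ei IH; exec_block.
have vn : vr s' 1 = n by rewrite (agreev A).
have eD : ar s' 0 = ar s 0 by rewrite (agreea A).
have eU : ar s' 1 = ar s 1 by rewrite (agreea A).
rewrite Ei vn in E; set j0 := n - 1 - i in E.
have Ej0 : j0 + i.+1 = n by rewrite /j0; lia.
rewrite eD in E2 E5; rewrite eU in E3; rewrite Ei in E5.
have [d1 u1] := HDU j0 ltac:(lia).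
have [d2 u2] := HDU j0.+1 ltac:(lia).
rewrite {}E ?addn1 in Ei0 E0 E1 E2 E3 E4 E5 *.
have t1 : inp (j0 + 3) = tau j0.+1 by congr inp; lia.
rewrite t1 in E1; rewrite -/(tau j0) in E0.
rewrite d1 d2 in E2; rewrite u1 u2 in E3; rewrite d1 in E5.
subst a0 a1 a6 i0.
have b2 : a2 = nat_of_bool ((tau j0 < tau j0.+1)
             && ((last_values n tau j0).1 == (last_values n tau j0.+1).1)).
  by rewrite E2; case: (tau j0 < _); case: (_.1 == _.1).
have b3 : a3 = nat_of_bool (~~ ((tau j0.+1 < tau j0)
             && ((last_values n tau j0).2 == (last_values n tau j0.+1).2))).
  by rewrite E3; case: (tau j0.+1 < _); case: (_.2 == _.2).
move=> j Hj jn /=; rewrite /upd /choice_ok.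
case: (ltngtP j j0) => [|jj0|jj0]; first by clear -Ej0 Hj; lia.
  have [h1 h2] := IH j ltac:(clear -Ej0 jj0; lia) jn; split=> //.
  by rewrite h2 /choice_ok; case: (j.+1 =P j0) => // ?; clear E2 E3 E4 E5 b2 b3; lia.
rewrite {j}jj0 in Hj jn *.
have -> : (j0.+1 == j0) = false by clear; lia.
have -> : (j0.+1 == n) = (i == 0) by clear -Ej0; lia.
rewrite E5 E4 b2 b3; case: (i == 0); first by case: (0 < _).
by case: ifP => _; case: (_ && _).
Qed.
End Coloring.

(** * Tables of the arms *)

Fixpoint mulc (m : nat) (e : exp) : exp :=
  if m is m'.+1 then Add e (mulc m' e) else Cst 0.

Lemma eval_mulc inp s m e : eval inp s (mulc m e) = m * eval inp s e.
Proof. by elim: m => //= m ->; rewrite mulSn. Qed.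

Notation aTH := 3 (only parsing).
Notation aTV := 4 (only parsing).

Definition base (n : nat) (h v : bool) := (h + h + v) * n.+1.

(* Cells [base n h v .. base n h v + len - 1] list the depths of the points of
   the color of the arm [(h, v)], from the border inwards; a cell [0] follows. *)
Definition table n (tau : nat -> nat) (c : nat -> bool) (TH TV : nat -> nat)
    h v len :=
  [/\ len <= n, TH (base n h v + len) = 0,
      forall j, j < len -> exists p, [/\ p < n, c p = (h == v),
        TH (base n h v + j) = hd n h p & TV (base n h v + j) = vd n v (tau p)],
      forall p, p < n -> c p = (h == v) -> exists j, [/\ j < len,
        TH (base n h v + j) = hd n h p & TV (base n h v + j) = vd n v (tau p)]
    & forall i j, i < j < len -> TH (base n h v + i) < TH (base n h v + j) /\
        TV (base n h v + i) < TV (base n h v + j)].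

Lemma table_ext n tau c TH TV TH' TV' h v len :
  (forall a, base n h v <= a <= base n h v + n -> TH' a = TH a /\ TV' a = TV a) ->
  table n tau c TH TV h v len -> table n tau c TH' TV' h v len.
Proof.
move=> X [T1 T2 T3 T4 T5].
have XH j : j <= len -> TH' (base n h v + j) = TH (base n h v + j).
  by move=> Hj; have [] := X (base n h v + j) ltac:(lia).
have XV j : j <= len -> TV' (base n h v + j) = TV (base n h v + j).
  by move=> Hj; have [] := X (base n h v + j) ltac:(lia).
split=> //; first by rewrite XH.
- move=> j Hj; have [p [a1 a2 a3 a4]] := T3 j Hj.
  by exists p; rewrite XH ?XV //; lia.
- move=> p Hp Cp; have [j [a1 a2 a3]] := T4 p Hp Cp.
  by exists j; rewrite XH ?XV //; lia.
- move=> i j ij; rewrite !XH ?XV; try lia.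
  exact: T5.
Qed.

(** Scanning inwards from the border makes the loop counter plus one the horizontal depth. The list
    also contains the points of the opposite arm, which has the same color; that images from
    opposite sides do not cross is tested at the end, on the maximal depths. *)
Definition com_table (h v : bool) : com :=
  (Asgn 5 (mulc (h + h + v) (Add (Var xN) (Cst 1))) ;;
   For xI xN
    (Asgn 6 (if h then Sub (Sub (Var xN) (Cst 1)) (Var xI) else Var xI) ;;
     Asgn 7 (Inp (Add (Var 6) (Cst 2))) ;;
     Asgn 7 (if v then Sub (Add (Var xN) (Cst 1)) (Var 7) else Var 7) ;;
     If (Eq (Arr aC (Var 6)) (Cst (h == v)))
       (Store aTH (Var 5) (Add (Var xI) (Cst 1)) ;;
        Store aTV (Var 5) (Var 7) ;;
        Asgn 5 (Add (Var 5) (Cst 1)))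
       Skip))%com.

Section Table.
Variables (inp : nat -> nat) (n : nat).
Let tau i := inp (i + 2).

(** The terminating 0 is never written: it is a cell of the block that keeps its initial value.
    Hence the assumption that the block is 0 and the claim that other cells do not change. *)
Lemma spec_table s h v :
  let c := fun p => ar s aC p != 0 in
  let b := base n h v in
  vr s xN = n -> permf n tau -> coloring n tau c ->
  (forall p, p < n -> ar s aC p <= 1) ->
  (forall l, l <= n -> ar s aTH (b + l) = 0) ->
  spec inp s (com_table h v)
    (fun s' => (exists len, table n tau c (ar s' aTH) (ar s' aTV) h v len) /\
       forall a, a < b \/ b + n < a -> ar s' aTH a = ar s aTH a /\
                                       ar s' aTV a = ar s aTV a) n.
Proof.
move=> c b En Hf Hc Hc1 H0; rewrite /com_table; exec_step.
rewrite eval_mulc /= En addn1 -/(base n h v) -/b in E.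
pose I j s' := (exists len, [/\ len <= j, vr s' 5 = b + len,
    forall l, len <= l <= n -> ar s' aTH (b + l) = 0,
    forall l, l < len -> exists p, [/\ p < n, c p = (h == v), hd n h p <= j,
        ar s' aTH (b + l) = hd n h p & ar s' aTV (b + l) = vd n v (tau p)]
  & (forall p, p < n -> c p = (h == v) -> hd n h p <= j -> exists l, [/\ l < len,
        ar s' aTH (b + l) = hd n h p & ar s' aTV (b + l) = vd n v (tau p)]) /\
    (forall i l, i < l < len -> ar s' aTH (b + i) < ar s' aTH (b + l) /\
        ar s' aTV (b + i) < ar s' aTV (b + l))]) /\
  (forall a, a < b \/ b + n < a -> ar s' aTH a = ar s aTH a /\
                                   ar s' aTV a = ar s aTV a).
apply: (@spec_weaken _ _ _ (I n) _ (n * 1)) => [|s' _ [[len]]|]; last 2 first.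
- move=> [a1 a2 a3 a4 [a5 a6]] a7; split=> //; exists len; split=> //.
  + by apply: a3; lia.
  + by move=> j /a4 [p [? ? ? ? ?]]; exists p.
  + by move=> p Hp Cp; apply: a5 => //; rewrite /hd; case: (h); lia.
- by rewrite muln1.
apply: (@spec_for _ _ _ _ _ I) => //=.
  split=> //=; exists 0; rewrite addn0; split=> //.
  split; last by lia.
  by move=> p Hp _; rewrite /hd; case: (h); lia.
move=> j s' Hj A Ej [[len [L1 L2 L3 L4 [L5 L6]]] L7]; exec_block.
have vn : vr s' 1 = n by rewrite (agreev A).
have eC : ar s' aC = ar s aC by rewrite (agreea A).
have E0' : a0 = (if h then n - 1 - j else j).
  by rewrite {}E0; case: (h) => /=; rewrite ?vn ?Ej.
have a0n : a0 < n by rewrite E0'; case: (h); lia.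
have ha0 : hd n h a0 = j.+1 by rewrite E0' /hd; case: (h); lia.
have E2' : a2 = vd n v (tau a0).
  by rewrite {}E2 E1 /vd /tau; case: (v) => /=; rewrite ?vn ?addn1.
have hdj p : p < n -> hd n h p <= j.+1 -> hd n h p <= j \/ p = a0.
  by clear -E0' Hj; rewrite /hd E0'; case: (h); lia.
apply: spec_if => /=; rewrite eC.
  move/nat_of_bool_true/eqP => Ca0.
  have {}Ca0 : c a0 = (h == v) by rewrite /c Ca0; case: (h == v).
  exec_block; rewrite {}L2 in Ei Ei0 E5; rewrite {}Ej addn1 in E3.
  rewrite {}Ei {}Ei0 {}E3 {}E4 {}E5 {E E0 E1 E2}.
  split=> /=; last first.
    by move=> x Hx; rewrite /upd !ifN; [exact: L7 | lia..].
  have same l : l < len -> (b + l == b + len) = false by lia.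
  exists len.+1; split=> //.
  + by rewrite addn1 addnS.
  + by move=> l Hl; rewrite /upd ifN; [apply: L3 | ]; lia.
  + move=> l; rewrite ltnS leq_eqVlt => /orP [/eqP ->|Hl].
      by exists a0; rewrite /upd !eqxx; split=> //; rewrite ?ha0.
    have [p [? ? ? ? ?]] := L4 l Hl.
    by exists p; rewrite /upd same //; split=> //; lia.
  + split.
      move=> p Hp Cp /(hdj p Hp) [Hpj|->]; last first.
        by exists len; rewrite /upd !eqxx.
      have [l [? ? ?]] := L5 p Hp Cp Hpj.
      by exists l; rewrite /upd same //; split=> //; lia.
    move=> q l /andP [il]; rewrite ltnS leq_eqVlt => /orP [/eqP el|Hl]; last first.
      by rewrite /upd !same; [apply: L6 | | ]; lia.
    rewrite {l}el in il *; rewrite /upd !eqxx same //.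
    have [p [Hp Cp hp -> ->]] := L4 q il; rewrite E2'; split; first by lia.
    apply: (coloring_same Hf Hc Hp a0n Cp Ca0).
    by rewrite ha0; lia.
move/nat_of_bool_false/eqP => Ca0; exec_block.
split=> /=; last exact: L7.
exists len; split=> //=; first by lia.
  by move=> l /L4 [p [? ? ? ? ?]]; exists p; split=> //; lia.
split=> // p Hp Cp /(hdj p Hp) [Hpj|Ep]; first exact: L5.
case: Ca0; rewrite -Ep; have := Hc1 p Hp; move: Cp; rewrite /c.
by case: (ar s 2 p) => [|[|]] //=; case: (h == v).
Qed.

Definition com_tables : com :=
  (com_table false false ;; com_table false true ;;
   com_table true false ;; com_table true true)%com.

Lemma spec_tables s :
  let c := fun p => ar s aC p != 0 in
  vr s xN = n -> permf n tau -> coloring n tau c ->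
  (forall p, p < n -> ar s aC p <= 1) ->
  (forall l, ar s aTH l = 0) ->
  spec inp s com_tables
    (fun s' => forall h v,
       exists len, table n tau c (ar s' aTH) (ar s' aTV) h v len) (4 * n).
Proof.
move=> c En Hf Hc Hc1 H0; rewrite /com_tables.
have -> : 4 * n = n + (n + (n + n)) by lia.
apply: spec_seq (spec_table (v := false) (h := false) En Hf Hc Hc1 _) _ => //.
move=> s1 A1 [[l1 T1] X1].
have V1 : vr s1 xN = n by rewrite (agreev A1).
have C1 : ar s1 aC = ar s aC by rewrite (agreea A1).
apply: spec_seq (spec_table (v := true) (h := false) (s := s1) _ Hf _ _ _) _.
all: rewrite ?C1 //.
  by move=> l Hl; have [->] := X1 (base n false true + l) ltac:(rewrite /base; lia).
move=> s2 A2 [[l2 T2] X2].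
have V2 : vr s2 xN = n by rewrite (agreev A2).
have C2 : ar s2 aC = ar s aC by rewrite (agreea A2).
apply: spec_seq (spec_table (v := false) (h := true) (s := s2) _ Hf _ _ _) _.
all: rewrite ?C2 //.
  move=> l Hl; have [->] := X2 (base n true false + l) ltac:(rewrite /base; lia).
  by have [->] := X1 (base n true false + l) ltac:(rewrite /base; lia).
move=> s3 A3 [[l3 T3] X3].
have V3 : vr s3 xN = n by rewrite (agreev A3).
have C3 : ar s3 aC = ar s aC by rewrite (agreea A3).
apply: spec_weaken (spec_table (v := true) (h := true) (s := s3) _ Hf _ _ _) _ _.
all: rewrite ?C3 //.
  move=> l Hl; have [->] := X3 (base n true true + l) ltac:(rewrite /base; lia).
  have [->] := X2 (base n true true + l) ltac:(rewrite /base; lia).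
  by have [->] := X1 (base n true true + l) ltac:(rewrite /base; lia).
move=> s4 A4 [[l4 T4] X4] [] [].
- by exists l4.
- exists l3; apply: table_ext T3 => a Ha.
  by apply: X4; move: Ha; rewrite /base; lia.
- exists l2; apply: table_ext T2 => a Ha.
  have [] := X4 a ltac:(move: Ha; rewrite /base; lia).
  by have [] := X3 a ltac:(move: Ha; rewrite /base; lia) => -> -> -> ->.
- exists l1; apply: table_ext T1 => a Ha.
  have [] := X4 a ltac:(move: Ha; rewrite /base; lia).
  have [] := X3 a ltac:(move: Ha; rewrite /base; lia) => -> ->.
  by have [] := X2 a ltac:(move: Ha; rewrite /base; lia) => -> -> -> ->.
Qed.
End Table.

(** * Classification of the pattern *)

(* Sides of the points of pi (2 for white points) and depths below them. *)
Notation aHS := 5 (only parsing).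
Notation aVS := 6 (only parsing).
Notation aPH := 7 (only parsing).
Notation aPV := 8 (only parsing).

Definition pat (e : exp) : exp := Inp (Add (Add (Var xN) (Cst 2)) e).
Definition refl (xn : nat) (v : bool) (e : exp) : exp :=
  if v then Sub (Add (Var xn) (Cst 1)) e else e.

Lemma eval_refl inp s xn v e N : vr s xn = N ->
  eval inp s (refl xn v e) = vd N v (eval inp s e).
Proof. by move=> <-; rewrite /refl /vd; case: v => //=; rewrite addn1. Qed.

(** Among the points deeper than [x] in both directions, read inwards, an inversion exists iff two
    consecutive ones form a descent. Remembering the last value therefore suffices, and one test
    takes linear time. *)
Definition com_cert (h v : bool) : com :=
  (Asgn 10 (Cst 0) ;; Asgn 11 (Cst 0) ;; Asgn 12 (pat (Var xI)) ;;
   Asgn 12 (refl xK v (Var 12)) ;;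
   For xJ xK
    (Asgn 5 (if h then Sub (Sub (Var xK) (Cst 1)) (Var xJ) else Var xJ) ;;
     Asgn 6 (pat (Var 5)) ;;
     Asgn 6 (refl xK v (Var 6)) ;;
     Asgn 7 (if h then Lt (Var 5) (Var xI) else Lt (Var xI) (Var 5)) ;;
     Asgn 7 (Eq (Add (Var 7) (Lt (Var 12) (Var 6))) (Cst 2)) ;;
     If (Var 7)
       (Cond 10 (Lt (Var 6) (Var 11)) (Cst 1) (Var 10) ;; Asgn 11 (Var 6))
       Skip))%com.

Definition com_try (h v : bool) : com :=
  (com_cert h v ;;
   If (Var 10) (Store aHS (Var xI) (Cst h) ;; Store aVS (Var xI) (Cst v)) Skip)%com.

(** If several tests succeed, the last one wins; the correctness argument works with any certified
    arm. *)
Definition com_classify : com :=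
  (For xI xK
    (Store aHS (Var xI) (Cst 2) ;; Store aVS (Var xI) (Cst 2) ;;
     com_try false false ;; com_try false true ;;
     com_try true false ;; com_try true true ;;
     Cond 5 (Arr aHS (Var xI)) (Sub (Var xK) (Var xI)) (Add (Var xI) (Cst 1)) ;;
     Store aPH (Var xI) (Var 5) ;;
     Asgn 5 (pat (Var xI)) ;;
     Cond 5 (Arr aVS (Var xI)) (Sub (Add (Var xK) (Cst 1)) (Var 5)) (Var 5) ;;
     Store aPV (Var xI) (Var 5)))%com.

Definition in_arm k (pi HS VS PH PV : nat -> nat) h v x :=
  [/\ HS x = nat_of_bool h, VS x = nat_of_bool v, cert k pi h v x,
      PH x = hd k h x & PV x = vd k v (pi x)].

Definition classified k (pi HS VS PH PV : nat -> nat) x :=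
  [/\ HS x = 2, VS x = 2 & white k pi x] \/
  exists h v, in_arm k pi HS VS PH PV h v x.

Section Classify.
Variables (inp : nat -> nat) (n k : nat).
Let pi i := inp (n + 2 + i).

Lemma spec_cert s h v x : vr s xN = n -> vr s xK = k -> vr s xI = x -> x < k ->
  spec inp s (com_cert h v)
    (fun s' => vr s' 10 <> 0 <-> cert k pi h v x) k.
Proof.
move=> En Ek Ex Hx; rewrite /com_cert; exec_block.
rewrite (eval_refl _ _ _ (N := k)) /= ?{}E1 ?Ex ?En -?/(pi x) // in E2. rename a1 into w1.
set s1 := setv _ 12 a2.
pose qual p j := [/\ p < k, hd k h x < hd k h p <= j & a2 < vd k v (pi p)].
(* While no descent has been found, the values read so far increase, so the remembered last value is
   also the greatest; this is the third clause. *)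
pose I j s' := [/\
  vr s' 10 <> 0 <-> exists y z, [/\ y < k, z < k, hd k h x < hd k h y < hd k h z,
    hd k h z <= j & a2 < vd k v (pi z) < vd k v (pi y)],
  (vr s' 11 = 0 /\ forall p, ~ qual p j) \/
    (exists p, qual p j /\ vr s' 11 = vd k v (pi p))
  & vr s' 10 = 0 -> forall p, qual p j -> vd k v (pi p) <= vr s' 11].
apply: (@spec_weaken _ _ _ (I k) _ (k * 1)) => [|s' _ [H _ _]|]; last 2 first.
- rewrite H E2; split=> [[y [z [? ? ? ? ?]]]|[y [z [? ? ? ?]]]];
    exists y, z; split=> //.
  by rewrite /hd; case: (h); lia.
- by rewrite muln1.
apply: (@spec_for _ _ _ _ _ I) => //=.
  split=> /=; rewrite ?E ?E0.
  - by split=> // [[y [z [_ _ ? ? _]]]]; lia.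
  - by left; split=> // p [_ ? _]; lia.
  - by move=> _ p [_ ? _]; lia.
move=> j s' Hj A Ej [I1 I2 I3]; exec_block.
have vn : vr s' 1 = n by rewrite (agreev A).
have vk : vr s' 2 = k by rewrite (agreev A).
have vx : vr s' 3 = x by rewrite (agreev A).
have va : vr s' 12 = a2 by rewrite (agreev A).
have E3' : a1 = (if h then k - 1 - j else j).
  by rewrite {}E1; case: (h) => /=; rewrite ?vk ?Ej.
have pn : a1 < k by rewrite E3'; case: (h); lia.
have hp : hd k h a1 = j.+1 by rewrite E3' /hd; case: (h); lia.
have a5E : a4 = vd k v (pi a1).
  by rewrite E4 (eval_refl _ _ _ (N := k)) //= E3 vn.
have a6E : a5 = (hd k h x < hd k h a1).
  rewrite {}E5; case: (h) => /=; rewrite vx /hd; last by case: ltnP; lia.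
  by case: ltnP; lia.
have a7E : a6 = nat_of_bool ((hd k h x < hd k h a1) && (a2 < vd k v (pi a1))).
  by rewrite E6 a6E va a5E; case: (_ < hd _ _ _); case: (a2 < _).
have hdj p : p < k -> hd k h p <= j.+1 -> hd k h p <= j \/ p = a1.
  by clear -E3' Hj; rewrite /hd E3'; case: (h); lia.
have qualS p : qual p j.+1 <-> qual p j \/
    [/\ p = a1, hd k h x < hd k h a1 & a2 < vd k v (pi a1)].
  split.
    move=> [q1 q2 q3]; case: (hdj p q1 ltac:(lia)) => q4.
      by left; split=> //; lia.
    by right; rewrite -q4; split=> //; lia.
  case=> [[q1 q2 q3]|[-> q2 q3]]; split=> //; lia.
clear E1 E3 E4 E5 E6 a6E E3' E2 E E0 A.
apply: spec_if => /=.
  rewrite a7E => /nat_of_bool_true /andP [hx vx1].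
  have qa : qual a1 j.+1 by apply/qualS; right.
  exec_block; rewrite -a5E in vx1.
  split=> /=.
  - rewrite {}E; split.
      case: ltnP => [lt _|ge /I1 [y [z [? ? ? ? ?]]]]; last first.
        by exists y, z; split=> //; lia.
      case: I2 => [[e0 _]|[p [[q1 q2 q3] e0]]]; first by lia.
      by exists p, a1; rewrite e0 a5E in lt; split=> //; lia.
    move=> [y [z [Hy Hz yz /(hdj z Hz) [zj|ez] vyz]]].
      by case: ltnP => // _; apply/I1; exists y, z; split=> //; lia.
    case: ltnP => // ge f0.
    have := I3 f0 y; rewrite ez -a5E in vyz yz.
    by move/(_ ltac:(split=> //; lia)); lia.
  - by right; exists a1; rewrite E0 a5E.
  - rewrite {}E {}E0; case: ltnP => // ge f0 p /qualS [q|[-> _ _]].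
      by have := I3 f0 p q; lia.
    by rewrite a5E.
rewrite a7E => /nat_of_bool_false nq.
have {}nq p : qual p j.+1 -> qual p j.
  by move=> /qualS [//|[_ q1 q2]]; rewrite q1 q2 in nq.
exec_block; split=> /=.
- rewrite I1; split=> [[y [z [? ? ? ? ?]]]|[y [z [Hy Hz yz /(hdj z Hz) [zj|ez] vyz]]]].
  + by exists y, z; split=> //; lia.
  + by exists y, z; split=> //; lia.
  + have [] : qual z j by apply: nq; split=> //; move: yz vyz; rewrite ez ?hp; lia.
    by rewrite ez hp; lia.
- case: I2 => [[? H]|[p [[q1 q2 q3] e0]]]; first by left; split=> // p /nq; apply: H.
  by right; exists p; split=> //; split=> //; lia.
- by move=> f0 p /nq; apply: I3.
Qed.

Lemma spec_try s h v x : vr s xN = n -> vr s xK = k -> vr s xI = x -> x < k ->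
  spec inp s (com_try h v)
    (fun s' =>
       [/\ cert k pi h v x, ar s' aHS = upd (ar s aHS) x h
         & ar s' aVS = upd (ar s aVS) x v] \/
       [/\ ~ cert k pi h v x, ar s' aHS = ar s aHS & ar s' aVS = ar s aVS]) k.
Proof.
move=> En Ek Ex Hx; rewrite /com_try -[X in spec _ _ _ _ X]addn0.
apply: spec_seq (spec_cert h v En Ek Ex Hx) _ => s1 A H.
have eH : ar s1 aHS = ar s aHS by rewrite (agreea A).
have eV : ar s1 aVS = ar s aVS by rewrite (agreea A).
have ex : vr s1 xI = x by rewrite (agreev A).
apply: spec_if => /= H0; exec_block.
  by left; split=> /=; rewrite ?Ei ?Ei0 ?E ?E0 ?ex ?eH ?eV //; apply/H.
by right; split=> // /H; rewrite H0.
Qed.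

Lemma spec_classify s : vr s xN = n -> vr s xK = k ->
  spec inp s com_classify
    (fun s' => forall x, x < k ->
       classified k pi (ar s' aHS) (ar s' aVS) (ar s' aPH) (ar s' aPV) x)
    (k * (4 * k).+1).
Proof.
move=> En Ek; rewrite /com_classify.
pose I j s' := forall x, x < j ->
  classified k pi (ar s' aHS) (ar s' aVS) (ar s' aPH) (ar s' aPV) x.
apply: (@spec_for _ _ _ _ _ I) => //=.
move=> x s0 Hx A Ex IH; exec_step; exec_step.
set s1 := seta _ _ _ _.
have n1 : vr s1 xN = n by rewrite /= (agreev A).
have k1 : vr s1 xK = k by rewrite /= (agreev A).
have x1 : vr s1 xI = x by [].
have -> : 4 * k = k + (k + (k + (k + 0))) by lia.
apply: spec_seq (spec_try false false n1 k1 x1 Hx) _ => s2 A2 H2.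
have n2 : vr s2 xN = n by rewrite (agreev A2).
have k2 : vr s2 xK = k by rewrite (agreev A2).
have x2 : vr s2 xI = x by rewrite (agreev A2).
apply: spec_seq (spec_try false true n2 k2 x2 Hx) _ => s3 A3 H3.
have n3 : vr s3 xN = n by rewrite (agreev A3).
have k3 : vr s3 xK = k by rewrite (agreev A3).
have x3 : vr s3 xI = x by rewrite (agreev A3).
apply: spec_seq (spec_try true false n3 k3 x3 Hx) _ => s4 A4 H4.
have n4 : vr s4 xN = n by rewrite (agreev A4).
have k4 : vr s4 xK = k by rewrite (agreev A4).
have x4 : vr s4 xI = x by rewrite (agreev A4).
apply: spec_seq (spec_try true true n4 k4 x4 Hx) _ => s5 A5 H5.
have n5 : vr s5 xN = n by rewrite (agreev A5).
have k5 : vr s5 xK = k by rewrite (agreev A5).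
have x5 : vr s5 xI = x by rewrite (agreev A5).
have pH : ar s5 aPH = ar s0 aPH.
  by rewrite (agreea A5) ?(agreea A4) ?(agreea A3) ?(agreea A2).
have pV : ar s5 aPV = ar s0 aPV.
  by rewrite (agreea A5) ?(agreea A4) ?(agreea A3) ?(agreea A2).
have [old new] : (forall y, y <> x ->
    ar s5 aHS y = ar s0 aHS y /\ ar s5 aVS y = ar s0 aVS y) /\
  ([/\ ar s5 aHS x = 2, ar s5 aVS x = 2 & white k pi x] \/
   exists h v, [/\ ar s5 aHS x = nat_of_bool h, ar s5 aVS x = nat_of_bool v
     & cert k pi h v x]).
  split.
    move=> y /eqP/negbTE xy.
    have e0 : ar s1 aHS y = ar s0 aHS y /\ ar s1 aVS y = ar s0 aVS y.
      by rewrite /= /upd Ei Ei0 Ex xy.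
    move: e0; case: H2 => [[_ e e']|[_ e e']];
    move: {e}(congr1 (@^~ y) e) {e'}(congr1 (@^~ y) e'); rewrite /= /upd ?xy => <- <-;
    (case: H3 => [[_ e e']|[_ e e']];
    move: {e}(congr1 (@^~ y) e) {e'}(congr1 (@^~ y) e'); rewrite /= /upd ?xy => <- <-);
    (case: H4 => [[_ e e']|[_ e e']];
    move: {e}(congr1 (@^~ y) e) {e'}(congr1 (@^~ y) e'); rewrite /= /upd ?xy => <- <-);
    (case: H5 => [[_ e e']|[_ e e']];
    move: {e}(congr1 (@^~ y) e) {e'}(congr1 (@^~ y) e'); rewrite /= /upd ?xy => <- <-);
    by [].
  case: H5 => [[c -> ->]|[c5 -> ->]].
    by right; exists true, true; rewrite /upd eqxx.
  case: H4 => [[c -> ->]|[c4 -> ->]].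
    by right; exists true, false; rewrite /upd eqxx.
  case: H3 => [[c -> ->]|[c3 -> ->]].
    by right; exists false, true; rewrite /upd eqxx.
  case: H2 => [[c -> ->]|[c2 -> ->]].
    by right; exists false, false; rewrite /upd eqxx.
  by left; split; rewrite /= /upd ?Ei ?Ei0 ?E ?E0 ?Ex ?eqxx //; do 2!case.
exec_block.
rewrite {}x5 {}k5 {}n5 -/(pi x) in Ei1 Ei2 E1 E3 E4.
move=> y Hy /=; rewrite Ei1 Ei2.
case: (y =P x) => [->|yx]; last first.
  have [o1 o2] := old y yx.
  have := IH y ltac:(lia); rewrite /classified /in_arm o1 o2.
  have old_upd f b : upd f x b y = f y by rewrite /upd; case: eqP.
  by rewrite !old_upd pH pV.
case: new => [new|[h [v [h1 h2 h3]]]]; [by left | right; exists h, v].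
split=> //; rewrite /upd eqxx.
  by rewrite E2 E1 h1 /hd; case: (h) => //=; rewrite addn1.
by rewrite E5 E4 E3 h2 /vd; case: (v) => //=; rewrite addn1.
Qed.
End Classify.

(* For a point of pi, the next deeper point on the same side ([k] if none). *)
Notation aSH := 9 (only parsing).
Notation aSV := 10 (only parsing).

(** The initial best depth [k.+1] exceeds every depth, so the first candidate is accepted. *)
Definition com_succ (aS aP aO : nat) : com :=
  (For xI xK
    (Asgn 5 (Var xK) ;; Asgn 6 (Add (Var xK) (Cst 1)) ;;
     Asgn 7 (Arr aS (Var xI)) ;; Asgn 8 (Arr aP (Var xI)) ;;
     For xJ xK
      (Asgn 9 (Arr aP (Var xJ)) ;;
       Asgn 10 (Eq (Add (Add (Eq (Arr aS (Var xJ)) (Var 7)) (Lt (Var 8) (Var 9)))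
                        (Lt (Var 9) (Var 6))) (Cst 3)) ;;
       If (Var 10) (Asgn 5 (Var xJ) ;; Asgn 6 (Var 9)) Skip) ;;
     Store aO (Var xI) (Var 5)))%com.

(** The follower is taken among all points on the same side, so it may lie in the other arm of that
    side; this is what ties the arms together. *)
Definition is_succ k (S P : nat -> nat) x o :=
  (o = k /\ forall y, y < k -> S y = S x -> ~ P x < P y) \/
  [/\ o < k, S o = S x, P x < P o
    & forall y, y < k -> S y = S x -> P x < P y -> P o <= P y].

Lemma spec_succ inp k s aS aP aO : (aS != aO) && (aP != aO) ->
  vr s xK = k ->
  (forall y, y < k -> ar s aS y < 2 -> ar s aP y <= k) ->
  spec inp s (com_succ aS aP aO)
    (fun s' => forall x, x < k -> ar s aS x < 2 ->
       is_succ k (ar s aS) (ar s aP) x (ar s' aO x)) (k * k.+1).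
Proof.
move=> /andP [SO PO] Ek HP; rewrite /com_succ.
set S := ar s aS in HP *; set P := ar s aP in HP *.
pose I j s' := forall x, x < j -> S x < 2 -> is_succ k S P x (ar s' aO x).
apply: (@spec_for _ _ _ _ _ I) => //=.
move=> x s0 Hx A Ex IH.
have eS : ar s0 aS = S by rewrite (agreea A) // inE.
have eP : ar s0 aP = P by rewrite (agreea A) // inE.
have ek : vr s0 xK = k by rewrite (agreev A).
do 4!exec_step; rewrite -[X in spec _ _ _ _ X]addn0.
rewrite eS Ex in E1; rewrite eP Ex in E2; rewrite ek in E E0.
set s1 := setv _ 8 _.
pose J j s' := S x < 2 ->
  (vr s' 5 = k /\ vr s' 6 = k.+1 /\
     forall y, y < j -> S y = S x -> ~ P x < P y) \/
  [/\ vr s' 5 < k, S (vr s' 5) = S x, P x < P (vr s' 5), vr s' 6 = P (vr s' 5)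
    & forall y, y < j -> S y = S x -> P x < P y -> P (vr s' 5) <= P y].
apply: (@spec_seq _ _ _ _ (J k)).
  rewrite -[X in spec _ _ _ _ X]muln1.
  apply: (@spec_for _ _ _ _ _ J) => //=.
    by move=> Sx /=; left; rewrite E E0 addn1.
  move=> y s' Hy A' Ey JH; exec_block.
  have e7 : vr s' 7 = S x by rewrite (agreev A').
  have e8 : vr s' 8 = P x by rewrite (agreev A').
  rewrite (agreea A') //= eP Ey in E3.
  rewrite (agreea A') //= eS Ey e7 e8 E3 in E4.
  have {}E4 : a4 = nat_of_bool [&& S y == S x, P x < P y & P y < vr s' 6].
    by rewrite E4; case: (S y == _); case: (P x < _); case: (P y < _).
  apply: spec_if => /=; rewrite {}E4.
    move/nat_of_bool_true/and3P => [/eqP q1 q2 q3]; exec_block => Sx; right => /=.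
    rewrite E4 E5 Ey; split=> //.
    move=> z; rewrite ltnS leq_eqVlt => /orP [/eqP -> //|Hz] z1 z2.
    case: (JH Sx) => [[_ [_ /(_ z Hz z1)]] //|[_ _ _ e6 /(_ z Hz z1 z2)]].
    by move: q3; rewrite e6; clear; lia.
  move/nat_of_bool_false => nq; exec_block => Sx.
  case: (JH Sx) => [[q1 [q2 q3]]|[q1 q2 q3 q4 q5]]; [left|right].
    split=> //; split=> // z; rewrite ltnS leq_eqVlt => /orP [/eqP -> z1 z2|]; last exact: q3.
    move: nq; rewrite z1 eqxx z2 q2 /= ltnS HP //.
    by rewrite z1.
  split=> //= z; rewrite ltnS leq_eqVlt => /orP [/eqP -> z1 z2|]; last exact: q5.
  by move: nq; rewrite z1 eqxx z2 q4 /= -leqNgt.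
move=> s2 A2 HJ; exec_block.
rewrite (agreev A2) //= Ex in Ei.
move=> z Hz Sz /=; rewrite eqxx Ei /upd.
case: (z =P x) => [ezx|zx].
  rewrite ezx E3; case: HJ => [|[? [_ ?]]|[? ? ? _ ?]]; first by rewrite -ezx.
    by left.
  by right.
by rewrite (agreea A2) //; apply: IH => //; clear -Hz zx; lia.
Qed.

(** * Pushing the pointers *)

(* [aPtr] holds the pointers, as indices into [aTH] and [aTV]; [aQ] is the queue
   of the points whose followers have to be checked. *)
Notation aPtr := 11 (only parsing).
Notation aQ := 12 (only parsing).
Notation xOk := 20 (only parsing).
Notation xTail := 21 (only parsing).
Notation xHead := 22 (only parsing).

(** A point with a violated constraint stays at the head and is examined again, so every round
    either advances the head or moves a pointer. Reading the entry 0 means that a pointer has left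
    its list. *)
Definition com_main_body : com :=
  (Asgn 5 (Arr aQ (Var xHead)) ;;
   Asgn 6 (Arr aPtr (Var 5)) ;;
   Asgn 7 (Arr aSH (Var 5)) ;;
   Asgn 8 (Arr aSV (Var 5)) ;;
   Asgn 9 (Lt (Arr aTH (Var 6)) (Arr aTH (Arr aPtr (Var 7)))) ;;
   Asgn 10 (Lt (Arr aTV (Var 6)) (Arr aTV (Arr aPtr (Var 8)))) ;;
   If (Eq (Add (Var 9) (Var 10)) (Cst 2))
     (Asgn xHead (Add (Var xHead) (Cst 1)))
     (Cond 7 (Var 9) (Var 8) (Var 7) ;;
      Asgn 8 (Add (Arr aPtr (Var 7)) (Cst 1)) ;;
      Store aPtr (Var 7) (Var 8) ;;
      Cond xOk (Arr aTH (Var 8)) (Var xOk) (Cst 0) ;;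
      Store aQ (Var xTail) (Var 7) ;;
      Asgn xTail (Add (Var xTail) (Cst 1))))%com.

Definition com_main : com :=
  (Asgn xHead (Cst 0) ;;
   While (Eq (Add (Var xOk) (Lt (Var xHead) (Var xTail))) (Cst 2)) com_main_body)%com.

Lemma sum_lt k (act : pred nat) (g g' : nat -> nat) y : y < k -> act y ->
  g' y < g y -> (forall z, z < k -> act z -> g' z <= g z) ->
  \sum_(z < k | act z) g' z < \sum_(z < k | act z) g z.
Proof.
move=> Hy ay lt le; rewrite (bigD1 (Ordinal Hy)) //= [X in _ < X](bigD1 (Ordinal Hy)) //=.
rewrite -addSn; apply: leq_add => //.
by apply: leq_sum => z /andP [az _]; apply: le.
Qed.

Section Main.
Variables (inp : nat -> nat) (n k : nat).
Variables (act : pred nat) (bs lim : nat -> nat) (TH TV SH SV : nat -> nat) (dmy : nat).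

Definition solution (J : nat -> nat) := forall x, x < k -> act x ->
  [/\ J x < lim x,
      SH x < k -> TH (bs x + J x) < TH (bs (SH x) + J (SH x))
    & SV x < k -> TV (bs x + J x) < TV (bs (SV x) + J (SV x))].

Definition good (Ptr : nat -> nat) x :=
  (SH x < k -> TH (Ptr x) < TH (Ptr (SH x))) /\
  (SV x < k -> TV (Ptr x) < TV (Ptr (SV x))).

Definition main_inv (Ptr Q : nat -> nat) ok head tail :=
  [/\ forall x, x < k -> act x -> bs x <= Ptr x <= bs x + lim x /\
        (ok = 1 -> Ptr x < bs x + lim x),
      forall J, solution J -> forall x, x < k -> act x -> Ptr x <= bs x + J x,
      ok = 1 \/ ok = 0 /\ exists x, [/\ x < k, act x & Ptr x = bs x + lim x],
      Ptr k = dmy /\ (forall q, q < tail -> Q q < k /\ act (Q q))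
    & head <= tail /\ (ok = 1 -> forall x, x < k -> act x ->
        (exists q, head <= q < tail /\ Q q = x) \/ good Ptr x)].

Hypothesis lim_le : forall x, x < k -> act x -> lim x <= n.
Hypothesis TH0 : forall x, x < k -> act x -> TH (bs x + lim x) = 0.
Hypothesis TH_pos : forall x j, x < k -> act x -> j < lim x ->
  0 < TH (bs x + j) <= n /\ TV (bs x + j) <= n.
Hypothesis TH_mono : forall x i j, x < k -> act x -> i < j < lim x ->
  TH (bs x + i) < TH (bs x + j) /\ TV (bs x + i) < TV (bs x + j).
Hypothesis SH_act : forall x, x < k -> act x -> SH x = k \/ SH x < k /\ act (SH x).
Hypothesis SV_act : forall x, x < k -> act x -> SV x = k \/ SV x < k /\ act (SV x).
Hypothesis dmyH : TH dmy = n.+1.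
Hypothesis dmyV : TV dmy = n.+1.

(* A pointer only moves when every solution lies strictly beyond it, so the
   pointers never overtake a solution. *)
Lemma main_inv_move (Ptr Q : nat -> nat) head tail x y :
  main_inv Ptr Q 1 head tail -> x < k -> act x -> y < k -> act y ->
  (y = SH x /\ ~~ (TH (Ptr x) < TH (Ptr y))) \/
  (y = SV x /\ ~~ (TV (Ptr x) < TV (Ptr y))) ->
  main_inv (upd Ptr y (Ptr y).+1) (upd Q tail y)
    (if TH (Ptr y).+1 != 0 then 1 else 0) head tail.+1.
Proof.
move=> [i1 i2 _ [i4 i5] [i6 i7]] Hx ax Hy ay viol.
have [y1 y2] := i1 y Hy ay; have {}y2 := y2 erefl.
have [x1 x2] := i1 x Hx ax; have {}x2 := x2 erefl.
have [d Ed] : exists d, Ptr y = bs y + d by exists (Ptr y - bs y); lia.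
have [e Ee] : exists e, Ptr x = bs x + e by exists (Ptr x - bs x); lia.
have ok1 : TH (Ptr y).+1 != 0 -> d.+1 < lim y.
  move=> nz; have : d.+1 <> lim y.
    by move=> E; move: nz; rewrite Ed -addnS E TH0.
  by clear -y2 Ed; lia.
have ok0 : ~~ (TH (Ptr y).+1 != 0) -> d.+1 = lim y.
  move=> nz; case: (ltnP d.+1 (lim y)) => [lt|]; last by clear -y2 Ed; lia.
  have [] := TH_pos Hy ay lt.
  by rewrite addnS -Ed; move/negPn/eqP: nz => ->.
split.
- move=> z Hz az; rewrite /upd; case: eqP => [->|_]; last first.
    by have [z1 z2] := i1 z Hz az; split=> // _; apply: z2.
  split; first by clear -y2 y1; lia.
  by case: ifP => // /ok1; clear -Ed; lia.
- move=> J HJ z Hz az; rewrite /upd; case: eqP => [Ez|_]; last exact: i2.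
  rewrite {z Hz az}Ez.
  have jy := i2 J HJ y Hy ay; have jx := i2 J HJ x Hx ax.
  have [lx hx vx] := HJ x Hx ax.
  suff : Ptr y <> bs y + J y by clear -jy; lia.
  move=> E.
  (* Depths increase along the list of [x], and [J x] is not before the pointer of [x]. So a
     constraint violated at the pointers would be violated by [J] as well if [J y] were at the
     pointer of [y]. *)
  have le : TH (Ptr x) <= TH (bs x + J x) /\ TV (Ptr x) <= TV (bs x + J x).
    rewrite Ee in jx *; case: (ltngtP e (J x)) => [lt||->//]; last by clear -jx; lia.
    by have [] := @TH_mono x e (J x) Hx ax ltac:(clear -lt lx; lia); clear; lia.
  case: viol => [[Ey]|[Ey]].
    have := hx; rewrite -Ey E => /(_ Hy); clear -le; lia.
  have := vx; rewrite -Ey E => /(_ Hy); clear -le; lia.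
- case: ifP => [_|/negbT /ok0 lt]; [by left | right; split=> //].
  by exists y; rewrite /upd eqxx; split=> //; rewrite Ed -lt addnS.
- split; first by rewrite /upd ifN //; apply/eqP; clear -Hy; lia.
  by move=> q Hq; rewrite /upd; case: eqP => // ?; apply: i5; lia.
- split; first by lia.
  case: ifP => // /ok1 lt _ z Hz az.
  case: (z =P y) => [->|zy].
    by left; exists tail; rewrite /upd eqxx; split=> //; lia.
  case: (i7 erefl z Hz az) => [[q [q1 q2]]|[g1 g2]].
    left; exists q; rewrite /upd ifN; [split=> // | ]; clear -q1; lia.
  right; rewrite /good /upd; have -> : (z == y) = false by apply/eqP.
  (* Moving [y] inwards cannot spoil the constraint of a point followed by [y]; only the constraints
     of [y] itself have to be rechecked. *)
  have [m1 m2] := @TH_mono y d d.+1 Hy ay ltac:(clear -lt; lia).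
  rewrite addnS -Ed in m1 m2; split=> /[dup] h.
    by move/g1; case: eqP => // ->; clear -m1; lia.
  by move/g2; case: eqP => // ->; clear -m2; lia.
Qed.

Lemma main_inv_pop (Ptr Q : nat -> nat) head tail :
  main_inv Ptr Q 1 head tail -> head < tail -> good Ptr (Q head) ->
  main_inv Ptr Q 1 head.+1 tail.
Proof.
move=> [i1 i2 i3 i4 [i6 i7]] lt g; split=> //; split=> // _ z Hz az.
case: (i7 erefl z Hz az) => [[q [q1 q2]]|]; last by right.
case: (q =P head) => [eq|nq]; first by right; rewrite -q2 eq.
by left; exists q; split=> //; lia.
Qed.

Lemma spec_main s :
  ar s aTH = TH -> ar s aTV = TV -> ar s aSH = SH -> ar s aSV = SV ->
  vr s xTail <= k -> main_inv (ar s aPtr) (ar s aQ) (vr s xOk) 0 (vr s xTail) ->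
  spec inp s com_main
    (fun s' =>
      (vr s' xOk = 0 /\ forall J, ~ solution J) \/
      [/\ vr s' xOk = 1,
          forall x, x < k -> act x -> exists c,
            [/\ ar s' aPtr x = bs x + c, c < lim x
              & forall J, solution J -> c <= J x]
        & forall x, x < k -> act x -> good (ar s' aPtr) x])
    (2 * (k * n) + k).
Proof.
move=> eTH eTV eSH eSV Ht HI; rewrite /com_main; exec_step.
set s0 := setv _ _ _.
pose I s' := main_inv (ar s' aPtr) (ar s' aQ) (vr s' xOk) (vr s' xHead) (vr s' xTail).
(* A move shortens the way left to one pointer by one but lengthens the queue by one; the factor 2
   makes the potential decrease nevertheless. *)
pose mu s' := 2 * \sum_(x < k | act x) (bs x + lim x - ar s' aPtr x)
              + (vr s' xTail - vr s' xHead).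
have Hmu : mu s0 <= 2 * (k * n) + k.
  rewrite /mu /=; apply: leq_add; last by lia.
  rewrite leq_mul2l /=.
  apply: (@leq_trans (\sum_(x < k) n)); last by rewrite sum_nat_const card_ord.
  rewrite big_mkcond; apply: leq_sum => x _; case: ifP => // ax.
  case: HI => /(_ x (ltn_ord x) ax) [h _] _ _ _ _.
  have := lim_le (ltn_ord x) ax; lia.
have I0 : I s0 by rewrite /I /= E.
have body s' : agree (modv com_main_body) (moda com_main_body) s0 s' -> I s' ->
    eval inp s' (Eq (Add (Var xOk) (Lt (Var xHead) (Var xTail))) (Cst 2)) <> 0 ->
    spec inp s' com_main_body
      (fun s2 => I s2 /\ mu s2 < mu s') 0.
  move=> A Is /= /nat_of_bool_true Hc; rewrite /com_main_body.
  have fTH : ar s' aTH = TH by rewrite (agreea A).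
  have fTV : ar s' aTV = TV by rewrite (agreea A).
  have fSH : ar s' aSH = SH by rewrite (agreea A).
  have fSV : ar s' aSV = SV by rewrite (agreea A).
  have [i1 _ i3 [i4 i5] [i6 _]] := Is.
  have [ok1 lt] : vr s' xOk = 1 /\ vr s' xHead < vr s' xTail.
    case: i3 Hc => [->|[-> _]]; case: ltnP => //; by [].
  clear Hc i3.
  have [Hx ax] := i5 _ lt.
  set Ptr := ar s' aPtr in i1 i4; set Q := ar s' aQ in i5 Hx ax.
  set hq := vr s' xHead in lt i6 Hx ax; set tq := vr s' xTail in lt i5 i6.
  exec_block.
  rewrite -/hq -/Q in E0; rewrite -E0 in Hx ax; rewrite -/Ptr in E1.
  rewrite fSH in E2; rewrite fSV in E3.
  rewrite fTH -/Ptr E1 E2 in E4; rewrite fTV -/Ptr E1 E3 in E5.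
  (* A missing follower is represented by index [k], whose pointer is the dummy cell of depth
     [n.+1], so its constraint always holds and a violated one concerns a real point. *)
  have dH : SH a0 = k -> TH (Ptr a0) < TH (Ptr (SH a0)).
    move=> ->; rewrite i4 dmyH ltnS; have [x1 x2] := i1 a0 Hx ax.
    have [] := @TH_pos a0 (Ptr a0 - bs a0) Hx ax ltac:(have := x2 ok1; clear -x1; lia).
    by rewrite subnKC; clear -x1; lia.
  have dV : SV a0 = k -> TV (Ptr a0) < TV (Ptr (SV a0)).
    move=> ->; rewrite i4 dmyV ltnS; have [x1 x2] := i1 a0 Hx ax.
    have [] := @TH_pos a0 (Ptr a0 - bs a0) Hx ax ltac:(have := x2 ok1; clear -x1; lia).
    by rewrite subnKC; clear -x1; lia.
  rewrite /I ok1 -/Ptr -/Q -/hq -/tq in Is.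
  apply: spec_if => /=; rewrite E4 E5.
    move/nat_of_bool_true => good2.
    have {}good2 : good Ptr (Q hq).
      move: good2; rewrite -E0 /good.
      by case: (_ < TH _); case: (_ < TV _).
    exec_block; split.
      rewrite /I /= E6 ok1 -/Ptr -/Q -/hq -/tq addn1.
      exact: main_inv_pop.
    by rewrite /mu /= -/hq -/tq E6 -/hq; clear -lt; lia.
  move/nat_of_bool_false => bad.
  exec_block.
  have [Hy ay viol] : [/\ a6 < k, act a6 &
    (a6 = SH a0 /\ ~~ (TH (Ptr a0) < TH (Ptr a6))) \/
    (a6 = SV a0 /\ ~~ (TV (Ptr a0) < TV (Ptr a6)))].
    move: bad E6; case: (ltnP (TH (Ptr a0)) _) => hH bad; rewrite ?E2 ?E3 => E6.
      have hV : ~~ (TV (Ptr a0) < TV (Ptr (SV a0))).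
        by move: bad; case: (_ < TV _).
      case: (SV_act Hx ax) => [/dV dv|]; first by rewrite dv in hV.
      by rewrite -E6 => -[? ?]; split=> //; right; rewrite E6 hV.
    case: (SH_act Hx ax) => [/dH dh|]; first by move: hH dh; clear; lia.
    by rewrite -E6 => -[? ?]; split=> //; left; rewrite E6 -leqNgt.
  rewrite -/Ptr addn1 in E7.
  have HI' := main_inv_move Is Hx ax Hy ay viol.
  rewrite fTH ok1 E7 in E9.
  split.
    rewrite /I /= Ei Ei0 E11 E8 E10 E7 E9 -/Ptr -/Q -/hq -/tq addn1.
    exact: HI'.
  rewrite /mu /= -/hq -/tq E11 Ei E8 E7 -/Ptr -/tq.
  have aux u w : u < w -> 2 * u + (tq + 1 - hq) < 2 * w + (tq - hq).
    by clear -lt; lia.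
  apply: aux.
  apply: (@sum_lt k act (fun x => bs x + lim x - Ptr x)
                  (fun x => bs x + lim x - upd Ptr a6 (Ptr a6).+1 x) a6) => //.
    rewrite /upd eqxx; have [_ h] := i1 _ Hy ay; have := h ok1; clear; lia.
  by move=> z _ _; rewrite /upd; case: eqP => [->|]; clear; lia.
apply: (@spec_weaken _ _ _ (fun s' => I s' /\ eval inp s'
  (Eq (Add (Var xOk) (Lt (Var xHead) (Var xTail))) (Cst 2)) = 0) _ (mu s0 * 1)).
- exact: spec_while.
- move=> s' _ [[i1 i2 i3 _ [_ i7]] /nat_of_bool_false Hc].
  case: i3 Hc => [ok1 Hc|[ok0 [x [Hx ax Px]] _]]; last first.
    left; split=> // J HJ; have := i2 J HJ x Hx ax.
    by have [] := HJ x Hx ax; rewrite Px; clear; lia.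
  right; split=> // x Hx ax.
    have [p1 p2] := i1 x Hx ax; have {}p2 := p2 ok1.
    exists (ar s' aPtr x - bs x); split; [by clear -p1; lia | by clear -p1 p2; lia |].
    by move=> J HJ; have := i2 J HJ x Hx ax; clear; lia.
  case: (i7 ok1 x Hx ax) => // [[q [q1 _]]].
  by move: Hc; rewrite /= ok1; case: ltnP => //; clear -q1; lia.
- by rewrite muln1.
Qed.
End Main.

(** The dummy cell comes directly after the four blocks of [n.+1] cells. Empty lists must be
    detected here, since the main loop tests only the pointers that it moves. *)
Definition com_init : com :=
  (Asgn 5 (mulc 4 (Add (Var xN) (Cst 1))) ;;
   Store aTH (Var 5) (Add (Var xN) (Cst 1)) ;;
   Store aTV (Var 5) (Add (Var xN) (Cst 1)) ;;
   Store aPtr (Var xK) (Var 5) ;;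
   Asgn xOk (Cst 1) ;; Asgn xTail (Cst 0) ;;
   For xI xK
    (If (Lt (Arr aHS (Var xI)) (Cst 2))
      (Cond 6 (Arr aHS (Var xI)) (mulc 2 (Add (Var xN) (Cst 1))) (Cst 0) ;;
       Cond 7 (Arr aVS (Var xI)) (mulc 1 (Add (Var xN) (Cst 1))) (Cst 0) ;;
       Asgn 6 (Add (Var 6) (Var 7)) ;;
       Store aPtr (Var xI) (Var 6) ;;
       Cond xOk (Arr aTH (Var 6)) (Var xOk) (Cst 0) ;;
       Store aQ (Var xTail) (Var xI) ;;
       Asgn xTail (Add (Var xTail) (Cst 1)))
      Skip))%com.

Section Init.
Variables (inp : nat -> nat) (n k : nat).

Lemma spec_init s (HS VS : nat -> nat) :
  let dmy := 4 * n.+1 in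
  let TH := upd (ar s aTH) dmy n.+1 in
  let bs x := base n (HS x != 0) (VS x != 0) in
  vr s xN = n -> vr s xK = k -> ar s aHS = HS -> ar s aVS = VS ->
  spec inp s com_init
    (fun s' =>
      [/\ ar s' aTH = TH, ar s' aTV = upd (ar s aTV) dmy n.+1, vr s' xTail <= k,
          ar s' aPtr k = dmy /\ (forall x, x < k -> HS x < 2 -> ar s' aPtr x = bs x)
        & [/\ forall q, q < vr s' xTail -> ar s' aQ q < k /\ HS (ar s' aQ q) < 2,
              forall x, x < k -> HS x < 2 ->
                exists q, q < vr s' xTail /\ ar s' aQ q = x
            & (vr s' xOk = 1 /\ forall x, x < k -> HS x < 2 -> TH (bs x) <> 0) \/
              (vr s' xOk = 0 /\ exists x, [/\ x < k, HS x < 2 & TH (bs x) = 0])]]) k.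
Proof.
move=> dmy TH bs En Ek EH EV; rewrite /com_init; exec_block.
have {}E : a = dmy by rewrite E En /dmy; clear; lia.
rewrite En addn1 in E0 E1.
rewrite {}E in Ei Ei0 E2; rewrite Ek in Ei1.
rewrite {}Ei {}E0 {}Ei0 {}E1 {}Ei1 {}E2 {}E3 {}E4.
pose I j s' :=
  [/\ vr s' xTail <= j,
      ar s' aPtr k = dmy /\ (forall x, x < j -> HS x < 2 -> ar s' aPtr x = bs x),
      forall q, q < vr s' xTail -> ar s' aQ q < j /\ HS (ar s' aQ q) < 2,
      forall x, x < j -> HS x < 2 -> exists q, q < vr s' xTail /\ ar s' aQ q = x
    & (vr s' xOk = 1 /\ forall x, x < j -> HS x < 2 -> TH (bs x) <> 0) \/
      (vr s' xOk = 0 /\ exists x, [/\ x < j, HS x < 2 & TH (bs x) = 0])].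
apply: (@spec_weaken _ _ _ (I k) _ (k * 1)) => [|s' A [b1 b2 b3 b4 b5]|]; last 2 first.
- by split=> //; rewrite ?(agreea A).
- by rewrite muln1.
apply: (@spec_for _ _ _ _ _ I) => //=.
  by split=> //=; [rewrite /upd eqxx | left].
move=> x s' Hx A Ex [a1' [a2' a2''] a3' a4' a5'].
have eH : ar s' aHS = HS by rewrite (agreea A).
have eV : ar s' aVS = VS by rewrite (agreea A).
have eT : ar s' aTH = TH by rewrite (agreea A).
have en : vr s' xN = n by rewrite (agreev A).
have old y : y < x.+1 -> y <> x -> y < x by clear; lia.
apply: spec_if => /=; rewrite eH Ex.
  move/nat_of_bool_true => Hx2; exec_block.
  rewrite eH Ex en in E; rewrite eV Ex en in E0.
  have {}E1 : a7 = bs x.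
    by rewrite E1 E E0 /bs /base; case: (HS x != 0); case: (VS x != 0); clear; lia.
  rewrite Ex in Ei Ei0 E4; rewrite eT E1 in E3.
  rewrite {}Ei {}E2 {}E3 {}E1 {}Ei0 {}E4 {}E5 {E E0}.
  split=> /=.
  - by rewrite addn1 ltnS.
  - split; first by rewrite /upd ifN //; apply/eqP; clear -Hx; lia.
    by move=> y Hy Hy2; rewrite /upd; case: eqP => [->|] // ?; apply: a2'' => //; apply: old.
  - move=> q Hq; rewrite /upd; case: eqP => [_|nq]; first by split.
    have [] := a3' q ltac:(clear -Hq nq; lia).
    by split=> //; apply: ltnW.
  - move=> y Hy Hy2; case: (y =P x) => [->|yx].
      by exists (vr s' xTail); rewrite /upd eqxx addn1.
    have [q [q1 q2]] := a4' y (old y Hy yx) Hy2.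
    exists q; rewrite /upd ifN; first by split=> //; clear -q1; lia.
    by apply/eqP; clear -q1; lia.
  - case: (TH (bs x) =P 0) => [T0|Tx] /=.
      by right; split=> //; exists x.
    case: a5' => [[-> h]|[-> [y [y1 y2 y3]]]].
      by left; split=> // y Hy Hy2; case: (y =P x) => [->|yx] //; apply: h => //; apply: old.
    by right; split=> //; exists y; split=> //; apply: ltnW.
move/nat_of_bool_false => Hx2; exec_block.
have noty y : HS y < 2 -> y <> x by move=> + e; rewrite e (negbTE Hx2).
split=> /=.
- by apply: leq_trans a1' _.
- by split=> // y Hy Hy2; apply: a2'' => //; apply: old => //; apply: noty.
- by move=> q /a3' [? ?]; split=> //; apply: ltnW.
- by move=> y Hy Hy2; apply: a4' => //; apply: old => //; apply: noty.
- case: a5' => [[-> h]|[-> [y [y1 y2 y3]]]].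
    by left; split=> // y Hy Hy2; apply: h => //; apply: old => //; apply: noty.
  by right; split=> //; exists y; split=> //; apply: ltnW.
Qed.
End Init.

(* Deepest image on each of the two sides. *)
Notation aMH := 13 (only parsing).
Notation aMV := 14 (only parsing).

Definition com_max (aS aT aM : nat) : com :=
  (Store aM (Cst 0) (Cst 0) ;; Store aM (Cst 1) (Cst 0) ;;
   For xI xK
    (If (Lt (Arr aS (Var xI)) (Cst 2))
      (Asgn 5 (Arr aS (Var xI)) ;;
       Asgn 6 (Arr aT (Arr aPtr (Var xI))) ;;
       Asgn 7 (Arr aM (Var 5)) ;;
       Cond 6 (Lt (Var 7) (Var 6)) (Var 6) (Var 7) ;;
       Store aM (Var 5) (Var 6))
      Skip))%com.

Definition is_max k (S T M : nat -> nat) :=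
  (forall x, x < k -> S x < 2 -> T x <= M (S x)) /\
  (forall h, h < 2 -> M h = 0 \/ exists x, [/\ x < k, S x = h & M h = T x]).

Lemma spec_max inp k s aS aT aM : [&& aS != aM, aT != aM & aPtr != aM] ->
  vr s xK = k ->
  spec inp s (com_max aS aT aM)
    (fun s' => is_max k (ar s aS) (fun x => ar s aT (ar s aPtr x)) (ar s' aM)) k.
Proof.
move=> /and3P [SM TM PM] Ek; rewrite /com_max; exec_block.
set S := ar s aS; pose T x := ar s aT (ar s aPtr x).
rewrite {}Ei {}E {}Ei0 {}E0.
pose I j s' := is_max j S T (ar s' aM).
rewrite -[X in spec _ _ _ _ X]muln1.
apply: (@spec_for _ _ _ _ _ I) => //=.
  split=> // h Hh; left => /=; rewrite !eqxx /upd.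
  by case: h Hh => [|[|]].
move=> x s' Hx A Ex [I1 I2].
have eS : ar s' aS = S by rewrite (agreea A) ?inE //= !(negbTE SM).
have eT : ar s' aT = ar s aT by rewrite (agreea A) ?inE //= !(negbTE TM).
have eP : ar s' aPtr = ar s aPtr.
  by rewrite (agreea A) ?inE //; move: PM => /= /negbTE ->.
have old y : y < x.+1 -> y <> x -> y < x by clear; lia.
apply: spec_if => /=; rewrite eS Ex.
  move/nat_of_bool_true => Hx2; exec_block.
  rewrite eS Ex in E; rewrite eT eP Ex -/(T x) in E0.
  rewrite {}Ei {}E3 {}E2 {}E1 {}E0 {}E; set M := ar s' aM in I1 I2 *.
  split=> /=; rewrite eqxx /upd.
    move=> y Hy Hy2; case: (y =P x) => [->|yx].
      by rewrite eqxx; case: ltnP.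
    have := I1 y (old y Hy yx) Hy2; case: (S y =P S x) => // ->.
    by case: ltnP => //; clear; lia.
  move=> h Hh; case: (h =P S x) => [->|_].
    case: ltnP => _; first by right; exists x.
    by case: (I2 _ Hx2) => [|[y [y1 y2 y3]]]; [left | right; exists y; split=> //; apply: ltnW].
  by case: (I2 _ Hh) => [|[y [y1 y2 y3]]]; [left | right; exists y; split=> //; apply: ltnW].
move/nat_of_bool_false => Hx2; exec_block; split=> /=.
  move=> y Hy Hy2; apply: I1 => //; apply: old => // e.
  by rewrite e (negbTE Hx2) in Hy2.
by move=> h /I2 [|[y [y1 y2 y3]]]; [left | right; exists y; split=> //; apply: ltnW].
Qed.

(** * Number and direction of the white points *)

Notation xM := 13 (only parsing).
Notation xDir := 14 (only parsing).

(** The white points being monotone, one descent between consecutive ones decides the direction;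
    with fewer than two of them both directions are correct and the increasing one is reported. *)
Definition com_white : com :=
  (Asgn xM (Cst 0) ;; Asgn xDir (Cst 0) ;; Asgn 15 (Cst 0) ;;
   For xI xK
    (If (Eq (Arr aHS (Var xI)) (Cst 2))
      (Asgn 5 (pat (Var xI)) ;;
       Cond xDir (Lt (Var 5) (Var 15)) (Cst 1) (Var xDir) ;;
       Asgn 15 (Var 5) ;;
       Asgn xM (Add (Var xM) (Cst 1)))
      Skip))%com.

Section WhiteScan.
Variables (inp : nat -> nat) (n k : nat).
Let pi i := inp (n + 2 + i).

Lemma spec_white s (HS : nat -> nat) : vr s xN = n -> vr s xK = k ->
  ar s aHS = HS -> (forall x, x < k -> 0 < pi x <= k) ->
  (forall a b c, a < b -> b < c -> c < k -> HS a = 2 -> HS b = 2 -> HS c = 2 ->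
     pi a < pi b < pi c \/ pi c < pi b < pi a) ->
  (forall a b, a < b -> b < k -> pi a <> pi b) ->
  spec inp s com_white
    (fun s' => [/\ vr s' xM = count (fun x => HS x == 2) (iota 0 k), vr s' xDir <= 1
      & forall x y, x < y -> y < k -> HS x = 2 -> HS y = 2 ->
          vd k (vr s' xDir != 0) (pi x) < vd k (vr s' xDir != 0) (pi y)]) k.
Proof.
move=> En Ek EH Hpi Hmono Hinj; rewrite /com_white; exec_block.
pose cnt j := count (fun x => HS x == 2) (iota 0 j).
pose I j s' := [/\ vr s' xM = cnt j,
  (vr s' xDir = 0 /\ forall x y, x < y -> y < j -> HS x = 2 -> HS y = 2 ->
     pi x < pi y) \/
  (vr s' xDir = 1 /\ (forall x y, x < y -> y < j -> HS x = 2 -> HS y = 2 ->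
     pi y < pi x) /\ exists x y, [/\ x < y, y < j, HS x = 2 & HS y = 2])
  & (vr s' 15 = 0 /\ forall x, x < j -> HS x <> 2) \/
    (exists w, [/\ w < j, HS w = 2, vr s' 15 = pi w
      & forall x, x < j -> HS x = 2 -> x <= w])].
apply: (@spec_weaken _ _ _ (I k) _ (k * 1)) => [|s' A [a1' a2' _]|]; last 2 first.
- split=> //; first by case: a2' => [[-> _]|[-> _]].
  move=> x y xy yk hx hy; have := Hpi x (ltn_trans xy yk); have := Hpi y yk.
  case: a2' => [[-> h]|[-> [h _]]]; rewrite /vd /=; have := h x y xy yk hx hy;
    clear; lia.
- by rewrite muln1.
apply: (@spec_for _ _ _ _ _ I) => //=.
  by split=> /=; rewrite ?E ?E0 ?E1 //; left.
move=> x s' Hx A Ex [I1 I2 I3].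
have eH : ar s' aHS = HS by rewrite (agreea A).
have en : vr s' xN = n by rewrite (agreev A).
have old y : y < x.+1 -> y <> x -> y < x by clear; lia.
have cS : cnt x.+1 = cnt x + (HS x == 2).
  by rewrite /cnt -[x.+1]addn1 iotaD count_cat /= addn0.
apply: spec_if => /=; rewrite eH Ex.
  move/nat_of_bool_true/eqP => Hx2; exec_block.
  rewrite en Ex -/(pi x) in E2; rewrite {}E2 in E3 E4.
  split=> /=.
  - by rewrite E5 cS Hx2 I1.
  - case: I3 => [[l0 none]|[w [w1 w2 w3 w4]]].
      rewrite {}E3 l0 ltn0; left; split.
        by case: I2 => [[//]|[_ [_ [y [z [yz zx hy _]]]]]]; case: (none y (ltn_trans yz zx)).
      move=> y z yz zx hy hz; case: (z =P x) => [ez|zx'].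
        by case: (none y) => //; rewrite -ez.
      by case: (none z (old z zx zx')).
    rewrite {}E3 w3; case: ltnP => lt.
      right; split=> //; split; last by exists w, x.
      case: I2 => [[d0 inc]|[d1 [dec _]]] y z yz zx hy hz.
        (* An ascent followed by this descent would contradict [Hmono], so [w] is the only earlier
           white point. *)
        have only u : u < x -> HS u = 2 -> u = w.
          move=> ux hu; have := w4 u ux hu; rewrite leq_eqVlt => /orP [/eqP //|uw].
          have := Hmono u w x uw w1 Hx hu w2 Hx2; have := inc u w uw w1 hu w2.
          by clear -lt; lia.
        case: (z =P x) => [ez|zx'].
          by rewrite ez (only y) // -ez.
        have zx2 := old z zx zx'.
        by have := yz; rewrite (only y (ltn_trans yz zx2) hy) (only z zx2 hz) ltnn.
      case: (z =P x) => [ez|zx']; last by apply: dec => //; apply: old.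
      rewrite ez; have yx : y < x by rewrite -ez.
      have := w4 y yx hy; rewrite leq_eqVlt => /orP [/eqP -> //|yw].
      by have := dec y w yw w1 hy w2; clear -lt; lia.
    have {}lt : pi w < pi x by have := Hinj w x w1 Hx; clear -lt; lia.
    case: I2 => [[d0 inc]|[d1 [dec [a1' [b1' [ab bx ha hb]]]]]].
      left; split=> // y z yz zx hy hz.
      case: (z =P x) => [ez|zx']; last by apply: inc => //; apply: old.
      rewrite ez; have yx : y < x by rewrite -ez.
      have := w4 y yx hy; rewrite leq_eqVlt => /orP [/eqP -> //|yw].
      by have := inc y w yw w1 hy w2; clear -lt; lia.
    have aw : a1' < w by have := w4 b1' bx hb; clear -ab; lia.
    have := Hmono a1' w x aw w1 Hx ha w2 Hx2; have := dec a1' w aw w1 ha w2.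
    by clear -lt; lia.
  - by right; exists x; split.
move/nat_of_bool_false/eqP => Hx2; exec_block.
have noty y : HS y = 2 -> y < x.+1 -> y < x.
  by move=> h Hy; apply: old => // e; rewrite e in h.
split=> /=.
- by rewrite cS I1; move/eqP/negbTE: Hx2 => ->; rewrite addn0.
- case: I2 => [[d0 inc]|[d1 [dec [y [z [yz zx hy hz]]]]]]; [left|right]; split=> //.
    by move=> y z yz zx hy hz; apply: inc => //; apply: noty.
  split; last by exists y, z; split=> //; apply: ltnW.
  by move=> y' z' yz' zx' hy' hz'; apply: dec => //; apply: noty.
- case: I3 => [[l0 none]|[w [w1 w2 w3 w4]]]; [left|right].
    by split=> // y Hy hy; apply: (none y) => //; apply: noty.
  by exists w; split=> //; [apply: ltnW | move=> y Hy hy; apply: w4 => //; apply: noty].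
Qed.
End WhiteScan.

(** * Longest chain in a rectangle *)

Notation aL := 15 (only parsing).

Definition chain (R : pred nat) (w : nat -> nat) j t (c : nat -> nat) :=
  (forall a, a < t -> R (c a) /\ c a < j) /\
  (forall a b, a < b -> b < t -> c a < c b /\ w (c a) < w (c b)).

Definition last_value (w c : nat -> nat) t := if t is t'.+1 then w (c t') else 0.

(* [L t] is the least last value of a chain of length [t]. *)
Definition is_tails (R : pred nat) (w : nat -> nat) n m j (L : nat -> nat) :=
  forall t, t <= m ->
    (L t <= n -> exists c, chain R w j t c /\ last_value w c t = L t) /\
    (forall c, chain R w j t c -> L t <= last_value w c t).

Lemma chain_sub R w j j' t t' c : j <= j' -> t' <= t -> chain R w j t c ->
  chain R w j' t' c.
Proof.
move=> jj tt [c1 c2]; split=> [a Ha|a b ab Hb]; last by apply: c2 => //; lia.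
by have [] := c1 a ltac:(lia); split=> //; lia.
Qed.

Lemma is_tails_skip (R : pred nat) w n m j L : ~~ R j -> is_tails R w n m j L ->
  is_tails R w n m j.+1 L.
Proof.
move=> nR H t Ht; have [H1 H2] := H t Ht; split.
  by move=> /H1 [c [c1 c2]]; exists c; split=> //; apply: chain_sub c1.
move=> c [c1 c2]; apply: H2; split=> // a Ha; have [Ra aj] := c1 a Ha; split=> //.
have : c a <> j by move=> E; rewrite E (negbTE nR) in Ra.
lia.
Qed.

(** A new chain of length [t.+1] must end in [j], and what precedes [j] is an old chain of length
    [t] with a smaller last value. *)
Lemma is_tails_step (R : pred nat) w n m j L L' : R j -> 0 < w j <= n ->
  is_tails R w n m j L -> L' 0 = L 0 ->
  (forall t, t < m ->
     L' t.+1 = if (L t < w j) && (w j < L t.+1) then w j else L t.+1) ->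
  is_tails R w n m j.+1 L'.
Proof.
move=> Rj wj H L0 LS [|t] Ht.
  have [H1 H2] := H 0 Ht; rewrite L0; split.
    by move=> /H1 [c [c1 c2]]; exists c; split=> //; apply: chain_sub c1.
  by move=> c _; apply: (H2 c); split.
have [H1 H2] := H t.+1 Ht; have [G1 G2] := H t (ltnW Ht); rewrite LS //; split.
  case: ifP => [/andP [lt _] _|_ /H1 [c [c1 c2]]]; last first.
    by exists c; split=> //; apply: chain_sub c1.
  have [c [[c1 c2] c3]] := G1 ltac:(lia).
  exists (fun a => if a == t then j else c a); split; last by rewrite /= eqxx.
  split=> [a Ha|a b ab Hb].
    case: eqP => [_|at']; first by split.
    by have [] := c1 a ltac:(lia); split=> //; lia.
  have -> : (a == t) = false by lia.
  case: eqP => [bt|bt]; last by apply: c2; lia.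
  rewrite bt in ab; have [_ aj] := c1 a ab; split=> //.
  case: t {Ht H1 H2 G1 G2 LS Hb} bt ab c1 c2 c3 lt => // t bt ab c1 c2 c3 lt.
  rewrite /= in c3; case: (a =P t) => [->|at']; first by lia.
  by have [_] := c2 a t ltac:(lia) ltac:(lia); lia.
move=> c [c1 c2]; have [Rt ct] := c1 t (leqnn _).
case: (c t =P j) => [cj|cj].
  have G : L t < w j.
    have : chain R w j t c.
      split=> [a Ha|a b ab Hb]; last by apply: c2 => //; lia.
      have [Ra _] := c1 a ltac:(lia); split=> //.
      by have [] := c2 a t Ha (leqnn _); rewrite cj.
    move/G2; case: t {Ht H1 H2 G1 G2 LS Rt ct} cj c1 c2 => [|t] cj c1 c2 /=; first by lia.
    by have [_] := c2 t t.+1 (leqnn _) (leqnn _); rewrite cj; lia.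
  by rewrite G /= cj; case: ifP; lia.
have C : chain R w j t.+1 c.
  split=> // a Ha; have [Ra aj] := c1 a Ha; split=> //.
  case: (a =P t) => [->|at']; first by lia.
  by have [] := c2 a t ltac:(lia) (leqnn _); lia.
by have := H2 c C; case: ifP => /=; lia.
Qed.

(** The inner loop treats the lengths from [m] down to 1, so that the entry for the next shorter
    length is still the one of the previous round. A decreasing direction is reduced to an
    increasing one by reflecting the values. *)
Definition com_lis : com :=
  (Store aL (Cst 0) (Cst 0) ;;
   For xI xK (Store aL (Add (Var xI) (Cst 1)) (Add (Var xN) (Cst 1))) ;;
   For xI xN
    (Asgn 5 (Inp (Add (Var xI) (Cst 2))) ;;
     Asgn 6 (Lt (Arr aMH (Cst 0)) (Add (Var xI) (Cst 1))) ;;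
     Asgn 7 (Lt (Add (Add (Var xI) (Cst 1)) (Arr aMH (Cst 1))) (Add (Var xN) (Cst 1))) ;;
     Asgn 8 (Lt (Arr aMV (Cst 0)) (Var 5)) ;;
     Asgn 9 (Lt (Add (Var 5) (Arr aMV (Cst 1))) (Add (Var xN) (Cst 1))) ;;
     Asgn 6 (Eq (Add (Add (Var 6) (Var 7)) (Add (Var 8) (Var 9))) (Cst 4)) ;;
     Cond 5 (Var xDir) (Sub (Add (Var xN) (Cst 1)) (Var 5)) (Var 5) ;;
     If (Var 6)
      (For xJ xM
        (Asgn 7 (Sub (Var xM) (Var xJ)) ;;
         Asgn 8 (Eq (Add (Lt (Arr aL (Sub (Var 7) (Cst 1))) (Var 5))
                         (Lt (Var 5) (Arr aL (Var 7)))) (Cst 2)) ;;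
         If (Var 8) (Store aL (Var 7) (Var 5)) Skip))
      Skip))%com.

Section Lis.
Variables (inp : nat -> nat) (n k : nat).
Let tau i := inp (i + 2).

Definition rect (MH MV : nat -> nat) (p : nat) :=
  [&& MH 0 < p.+1, p.+1 + MH 1 < n.+1, MV 0 < tau p & tau p + MV 1 < n.+1].

Lemma spec_lis s (MH MV : nat -> nat) m dir :
  vr s xN = n -> vr s xK = k -> vr s xM = m -> m <= k -> vr s xDir = dir ->
  ar s aMH = MH -> ar s aMV = MV -> (forall p, p < n -> 0 < tau p <= n) ->
  spec inp s com_lis
    (fun s' => ar s' aL m <= n <->
      exists c, chain (rect MH MV) (fun p => vd n (dir != 0) (tau p)) n m c)
    (k + n * k.+1).
Proof.
move=> En Ek Em mk Ed EH EV Ht; rewrite /com_lis; exec_step.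
set w := fun p => vd n (dir != 0) (tau p).
pose I1 j s' := forall t, t <= j -> ar s' aL t = if t == 0 then 0 else n.+1.
apply: (@spec_seq _ _ _ _ (I1 k)).
  rewrite -[X in spec _ _ _ _ X]muln1.
  apply: (@spec_for _ _ _ _ _ I1) => //=.
    by move=> t; rewrite leqn0 /= Ei E /upd => ->.
  move=> x s' Hx A Ex H; exec_block.
  rewrite (agreev A) //= En addn1 in E0; rewrite Ex addn1 in Ei0.
  move=> t tx /=; rewrite Ei0 E0 /upd; case: eqP => [->//|tn].
  by apply: H; clear -tx tn; lia.
move=> s1 A1 H1.
pose I j s' := is_tails (rect MH MV) w n m j (ar s' aL).
apply: (@spec_weaken _ _ _ (I n) _ (n * k.+1)) => [|s' A H|//]; last first.
  have [F1 F2] := H m (leqnn _); split; first by move=> /F1 [c []]; exists c.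
  move=> [c C]; have := F2 c C; case: C => C1 _.
  have : last_value w c m <= n.
    case: (m) C1 => //= m' C1; have [_ h] := C1 m' (leqnn _).
    by have := Ht _ h; rewrite /w /vd; case: (dir != 0); lia.
  by lia.
have n1 : vr s1 xN = n by rewrite (agreev A1).
apply: (@spec_for _ _ _ _ _ I) => //=.
  move=> t tm; rewrite /= (H1 t (leq_trans tm mk)); split.
    case: eqP => [->|_]; last by rewrite ltnn.
    by move=> _; exists id; split=> //; split.
  by move=> c [c1 _]; case: t tm c1 => // t _ c1; have [] := c1 0 isT.
move=> j s0 Hj A Ej IH; do 7!exec_step.
have n0 : vr s0 xN = n by rewrite (agreev A).
have m0 : vr s0 xM = m by rewrite (agreev A) ?(agreev A1).
have d0 : vr s0 xDir = dir by rewrite (agreev A) ?(agreev A1).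
have eH : ar s0 aMH = MH by rewrite (agreea A) ?(agreea A1).
have eV : ar s0 aMV = MV by rewrite (agreea A) ?(agreea A1).
rewrite Ej -/(tau j) in E0; rewrite E0 in E3 E4 E6.
rewrite Ej addn1 eH in E1; rewrite Ej n0 !addn1 eH in E2.
rewrite eV in E3; rewrite eV n0 addn1 in E4.
have {}E5 : a5 = nat_of_bool (rect MH MV j).
  rewrite E5 E1 E2 E3 E4 /rect.
  by case: (MH 0 < _); case: (_ + MH 1 < _); case: (MV 0 < _); case: (_ + MV 1 < _).
have {}E6 : a6 = w j by rewrite E6 d0 n0 addn1.
clear E1 E2 E3 E4.
set s2 := setv _ 5 a6.
apply: spec_if => /=; rewrite E5.
  move/nat_of_bool_true => Rj.
  set L := ar s0 aL in IH *.
  (* After [i] inner rounds exactly the lengths above [m - i] have been treated. *)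
  pose J i s' := forall t, t <= m -> ar s' aL t =
    if (m < t + i) && (0 < t) && ((L t.-1 < w j) && (w j < L t)) then w j else L t.
  apply: (@spec_weaken _ _ _ (J m) _ (m * 1)) => [|s' A' HJ|]; last 2 first.
  - apply: (is_tails_step Rj _ IH).
    + by have := Ht j Hj; rewrite /w /vd; case: (dir != 0); lia.
    + by rewrite /= HJ //= ltn0 /= andbF.
    + move=> t tm; rewrite /= (HJ t.+1) //=.
      by have -> : m < t.+1 + m by clear; lia.
  - by rewrite muln1.
  apply: (@spec_for _ _ _ _ _ J) => //=.
    by move=> t tm; rewrite addn0 ltnNge tm.
  move=> l s' Hi A' Ei' HJ; exec_block.
  have m' : vr s' xM = m by rewrite (agreev A').
  have v' : vr s' 5 = w j by rewrite (agreev A') //= E6.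
  rewrite m' Ei' in E1; rewrite v' E1 subn1 in E2.
  have t1 : 0 < m - l <= m by clear -Hi; lia.
  have Lt : ar s' aL (m - l) = L (m - l).
    by rewrite HJ; [rewrite ifN // | ]; clear -t1; lia.
  have Lp : ar s' aL (m - l).-1 = L (m - l).-1.
    by rewrite HJ; [rewrite ifN // | ]; clear -t1; lia.
  rewrite Lt Lp in E2.
  have {}E2 : a8 = nat_of_bool ((L (m - l).-1 < w j) && (w j < L (m - l))).
    by rewrite E2; case: (_ < w j); case: (w j < _).
  have cmp t : t <= m -> t <> m - l -> (m < t + l.+1) && (0 < t) = (m < t + l) && (0 < t).
    by clear; lia.
  have cmp1 : (m < m - l + l.+1) && (0 < m - l) by clear -Hi; lia.
  apply: spec_if => /=; rewrite E2.
    move/nat_of_bool_true => up; exec_block.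
    rewrite v' in E3; rewrite E1 in Ei0.
    move=> t tm /=; rewrite Ei0 E3 /upd; case: eqP => [->|tn].
      by rewrite cmp1 up.
    by rewrite cmp //; apply: HJ.
  move/nat_of_bool_false => noup; exec_block => t tm /=.
  case: (t =P m - l) => [->|tn]; last by rewrite cmp //; apply: HJ.
  by rewrite cmp1 (negbTE noup).
move/nat_of_bool_false => Rj; exec_block.
by rewrite /I /=; apply: is_tails_skip.
Qed.
End Lis.

(** * Embeddings versus pointers *)

Lemma finite_choice k (R : nat -> nat -> Prop) :
  (forall x, x < k -> exists j, R x j) -> exists J, forall x, x < k -> R x (J x).
Proof.
elim: k => [|k IH] H; first by exists id.
have [J HJ] := IH (fun x Hx => H x (ltnW Hx)).
have [j Hj] := H k (leqnn _).
exists (fun x => if x == k then j else J x) => x Hx.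
by case: eqP => [->//|ne]; apply: HJ; lia.
Qed.

(** Iterating [O] from [x] climbs through the points of the side until it meets [y]: by [o4] no
    follower overshoots [y], and injectivity of the depth identifies the last one with [y]. *)
Lemma succ_mono k (S P O D : nat -> nat) :
  (forall x, x < k -> S x < 2 -> is_succ k S P x (O x)) ->
  (forall x, x < k -> S x < 2 -> O x < k -> D x < D (O x)) ->
  forall x y, x < k -> y < k -> S x < 2 -> S y = S x -> P x < P y ->
    (forall a b, a < k -> b < k -> S a = S b -> S a < 2 -> P a = P b -> a = b) ->
    D x < D y.
Proof.
move=> HO HD x y Hx Hy Sx Sy Pxy inj.
have [m] := ubnP (P y - P x); elim: m x Hx Sx Sy Pxy => // m IH x Hx Sx Sy Pxy Hm.
case: (HO x Hx Sx) => [[_ /(_ y Hy Sy)] //|[o1 o2 o3 o4]].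
have lt := HD x Hx Sx o1; have le := o4 y Hy Sy Pxy.
case: (ltngtP (P (O x)) (P y)) le => // [lt2 _|eq _]; last first.
  by rewrite -(inj (O x) y) // ?o2.
by apply: leq_trans lt _; apply: ltnW; apply: IH; rewrite ?o2 ?Sy //; lia.
Qed.

(** Positions shifted by one behave like values, so one lemma serves both coordinates. *)
Lemma hdE N h p : hd N h p = vd N h p.+1.
Proof. by rewrite /hd /vd; case: h; lia. Qed.

(* One coordinate at a time: [u] and [w] are the coordinate of the points of the
   pattern and of their images, [s] the side, and inactive points are inner. *)
Lemma coordinate_mono n k (act : pred nat) (s : nat -> bool) (u w : nat -> nat) :
  (forall x, x < k -> 0 < u x <= k /\ 0 < w x <= n) ->
  (forall x y, x < k -> y < k -> act x -> act y -> s x = s y ->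
     vd k (s x) (u x) < vd k (s x) (u y) -> vd n (s x) (w x) < vd n (s x) (w y)) ->
  (forall x y, x < k -> y < k -> act x -> act y -> s x <> s y ->
     vd k (s x) (u x) + vd k (s y) (u y) <= k /\
     vd n (s x) (w x) + vd n (s y) (w y) <= n) ->
  (forall x y, x < k -> y < k -> act x -> ~~ act y ->
     vd k (s x) (u x) < vd k (s x) (u y) /\ vd n (s x) (w x) < vd n (s x) (w y)) ->
  (forall x y, x < k -> y < k -> ~~ act x -> ~~ act y -> u x < u y -> w x < w y) ->
  forall x y, x < k -> y < k -> u x < u y -> w x < w y.
Proof.
move=> R H1 H2 H3 H4 x y Hx Hy uxy.
have [r1 r2] := R x Hx; have [r3 r4] := R y Hy.
case ax: (act x); case ay: (act y).
- case: (s x =P s y) => [sxy|sxy].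
    move: (H1 x y Hx Hy ax ay sxy) (H1 y x Hy Hx ay ax (esym sxy)).
    by rewrite /vd -sxy; case: (s x); lia.
  have := H2 x y Hx Hy ax ay sxy; move: sxy; rewrite /vd.
  by case: (s x); case: (s y) => //; lia.
- by have := H3 x y Hx Hy ax (negbT ay); rewrite /vd; case: (s x); lia.
- by have := H3 y x Hy Hx ay (negbT ax); rewrite /vd; case: (s y); lia.
- by apply: H4 => //; rewrite ?ax ?ay.
Qed.

Definition embeds n k (tau pi : nat -> nat) (F : nat -> nat) :=
  [/\ forall x, x < k -> F x < n, forall x y, x < y -> y < k -> F x < F y
    & forall x y, x < k -> y < k -> pi x < pi y -> tau (F x) < tau (F y)].

Section Correct.
Variables (n k : nat) (tau pi : nat -> nat) (P c : nat -> bool).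
Hypotheses (Htau : permf n tau) (Hpi : permf k pi).
Hypotheses (HP : coloring k pi P) (Hc : coloring n tau c).
Variables (TH TV : nat -> nat) (len : bool -> bool -> nat).
Hypothesis Htab : forall h v, table n tau c TH TV h v (len h v).
Variables HS VS PH PV SH SV : nat -> nat.
Hypothesis Hcls : forall x, x < k -> classified k pi HS VS PH PV x.
Hypothesis HSH : forall x, x < k -> HS x < 2 -> is_succ k HS PH x (SH x).
Hypothesis HSV : forall x, x < k -> VS x < 2 -> is_succ k VS PV x (SV x).

Let act x := HS x < 2.
Let hs x := HS x != 0.
Let vs x := VS x != 0.
Let bs x := base n (hs x) (vs x).
Let lim x := len (hs x) (vs x).

Lemma active_arm x : x < k -> act x ->
  [/\ HS x = hs x, VS x = vs x, cert k pi (hs x) (vs x) x,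
      PH x = hd k (hs x) x & PV x = vd k (vs x) (pi x)].
Proof.
rewrite /act /hs /vs => Hx ax; case: (Hcls Hx) => [[h _ _]|]; first by rewrite h in ax.
by move=> [h [v [-> -> H3 -> ->]]]; rewrite !nat_of_bool_neq0.
Qed.

Lemma inactive_white x : x < k -> ~~ act x ->
  [/\ HS x = 2, VS x = 2 & white k pi x].
Proof.
rewrite /act => Hx ax; case: (Hcls Hx) => // [[h [v [h1 _ _ _ _]]]].
by move: ax; rewrite h1; case: (h).
Qed.

Lemma active_VS x : x < k -> (VS x < 2) = act x.
Proof.
move=> Hx; case ax: (act x); last by have [_ -> _] := inactive_white Hx (negbT ax).
by have [_ -> _ _ _] := active_arm Hx ax; case: (vs x).
Qed.

Section Complete.
Variable F : nat -> nat.
Hypothesis HF : embeds n k tau pi F.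

Let Fn x (Hx : x < k) : F x < n. Proof. by case: HF => H _ _; apply: H. Qed.

Lemma embeds_hd h x y : x < k -> y < k -> hd k h x < hd k h y ->
  hd n h (F x) < hd n h (F y).
Proof.
move=> Hx Hy; have := Fn Hx; have := Fn Hy; case: HF => _ H _.
move: (H x y) (H y x) Hx Hy; rewrite /hd; case: h; lia.
Qed.

Lemma embeds_vd v x y : x < k -> y < k -> vd k v (pi x) < vd k v (pi y) ->
  vd n v (tau (F x)) < vd n v (tau (F y)).
Proof.
move=> Hx Hy; have := Htau.1 _ (Fn Hx); have := Htau.1 _ (Fn Hy).
have := Hpi.1 _ Hx; have := Hpi.1 _ Hy; case: HF => _ _ H.
move: (H x y Hx Hy) (H y x Hy Hx); rewrite /vd; case: v; lia.
Qed.

Lemma embeds_cert h v x : x < k -> cert k pi h v x -> cert n tau h v (F x).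
Proof.
move=> Hx [y [z [Hy Hz /andP [h1 h2] /andP [v1 v2]]]].
exists (F y), (F z); split; [exact: Fn | exact: Fn | |].
  by rewrite !embeds_hd.
by rewrite !embeds_vd.
Qed.

Lemma embeds_solution : exists J,
  solution k act bs lim TH TV SH SV J /\
  forall x, x < k -> act x -> TH (bs x + J x) = hd n (hs x) (F x) /\
                              TV (bs x + J x) = vd n (vs x) (tau (F x)).
Proof.
have [J HJ] : exists J, forall x, x < k -> act x -> [/\ J x < lim x,
    TH (bs x + J x) = hd n (hs x) (F x) &
    TV (bs x + J x) = vd n (vs x) (tau (F x))].
  apply: (@finite_choice k (fun x j => act x -> [/\ j < lim x,
    TH (bs x + j) = hd n (hs x) (F x) &
    TV (bs x + j) = vd n (vs x) (tau (F x))])) => x Hx.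
  case ax: (act x); last by exists 0.
  have [_ _ cx _ _] := active_arm Hx ax.
  have [cF _] := cert_color Htau Hc (Fn Hx) (embeds_cert Hx cx).
  have [_ _ _ /(_ _ (Fn Hx) cF) [j Hj] _] := Htab (hs x) (vs x).
  by exists j.
exists J; split=> [x Hx ax|x Hx ax]; last by have [] := HJ x Hx ax.
have [j1 j2 j3] := HJ x Hx ax; have [h1 h2 _ h4 h5] := active_arm Hx ax.
split=> // Hs.
  case: (HSH Hx ax) => [[E _]|[_ o2 o3 _]]; first by rewrite E ltnn in Hs.
  have ay : act (SH x) by rewrite /act o2.
  have [_ j2' _] := HJ _ Hs ay; have [_ _ _ h4' _] := active_arm Hs ay.
  have es : hs (SH x) = hs x by rewrite /hs o2.
  by rewrite j2 j2' es embeds_hd // -h4 -es -h4'.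
have ax' : VS x < 2 by rewrite active_VS.
case: (HSV Hx ax') => [[E _]|[_ o2 o3 _]]; first by rewrite E ltnn in Hs.
have ay : act (SV x) by rewrite -active_VS // o2.
have [_ _ j3'] := HJ _ Hs ay; have [_ _ _ _ h5'] := active_arm Hs ay.
have es : vs (SV x) = vs x by rewrite /vs o2.
by rewrite j3 j3' es embeds_vd // -h5 -es -h5'.
Qed.

Variables (DH DV : nat -> nat) (MH MV : nat -> nat).
Hypothesis DF : forall x, x < k -> act x ->
  DH x <= hd n (hs x) (F x) /\ DV x <= vd n (vs x) (tau (F x)).
Hypothesis HMH : is_max k HS DH MH.
Hypothesis HMV : is_max k VS DV MV.

Lemma max_attained_h (h : bool) : MH h = 0 \/ exists x,
  [/\ x < k, act x, hs x = h & MH h <= hd n h (F x)].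
Proof.
case: (HMH.2 h) => [|e0|[x [Hx hx ->]]]; [by case: (h) | by left | right].
have ax : act x by rewrite /act hx; case: (h).
have ex : hs x = h by rewrite /hs hx; case: (h).
by exists x; split=> //; rewrite -ex; have [] := DF Hx ax.
Qed.

Lemma max_attained_v (v : bool) : MV v = 0 \/ exists x,
  [/\ x < k, act x, vs x = v & MV v <= vd n v (tau (F x))].
Proof.
case: (HMV.2 v) => [|e0|[x [Hx hx ->]]]; [by case: (v) | by left | right].
have ax : act x by rewrite -active_VS // hx; case: (v).
have ex : vs x = v by rewrite /vs hx; case: (v).
by exists x; split=> //; rewrite -ex; have [] := DF Hx ax.
Qed.

(** A nonzero maximum comes from a certified point, whose image under [F] is at least as deep.
    Images from opposite sides are certified in tau, where they cannot cross. *)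
Lemma max_le : MH 0 + MH 1 <= n /\ MV 0 + MV 1 <= n.
Proof.
have bh h x : x < k -> hd n h (F x) <= n.
  by move=> /Fn; rewrite /hd; case: (h); lia.
have bv v x : x < k -> vd n v (tau (F x)) <= n.
  by move=> /Fn /(Htau.1 _); rewrite /vd; case: (v); lia.
split.
  case: (max_attained_h false) => [/= -> /=|[x [Hx ax ex lx]]].
    by case: (max_attained_h true) => [/= ->//|[y [Hy _ _ ly]]]; apply: leq_trans ly (bh _ _ Hy).
  case: (max_attained_h true) => [/= ->|[y [Hy ay ey ly]]].
    by rewrite addn0; apply: leq_trans lx (bh _ _ Hx).
  have [_ _ cx _ _] := active_arm Hx ax; have [_ _ cy _ _] := active_arm Hy ay.
  rewrite ex in cx; rewrite ey in cy; rewrite /= in lx ly.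
  have := cert_cross_h Htau Hc (Fn Hx) (Fn Hy) (embeds_cert Hx cx) (embeds_cert Hy cy).
  by move=> /=; lia.
case: (max_attained_v false) => [/= -> /=|[x [Hx ax ex lx]]].
  by case: (max_attained_v true) => [/= ->//|[y [Hy _ _ ly]]]; apply: leq_trans ly (bv _ _ Hy).
case: (max_attained_v true) => [/= ->|[y [Hy ay ey ly]]].
  by rewrite addn0; apply: leq_trans lx (bv _ _ Hx).
have [_ _ cx _ _] := active_arm Hx ax; have [_ _ cy _ _] := active_arm Hy ay.
rewrite ex in cx; rewrite ey in cy; rewrite /= in lx ly.
have := cert_cross_v Htau Hc (Fn Hx) (Fn Hy) (embeds_cert Hx cx) (embeds_cert Hy cy).
by move=> /=; lia.
Qed.

(** In pi a white point lies inside every certified one. [F] preserves this, and the depths defining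
    the rectangle do not exceed those of the images under [F]. *)
Lemma white_in_rect x : x < k -> ~~ act x -> 
  [&& MH 0 < (F x).+1, (F x).+1 + MH 1 < n.+1, MV 0 < tau (F x)
    & tau (F x) + MV 1 < n.+1].
Proof.
move=> Hx ax; have [_ _ Wx] := inactive_white Hx ax.
have Fx := Fn Hx; have tFx := Htau.1 _ Fx.
have bh (h : bool) : MH h < hd n h (F x).
  case: (max_attained_h h) => [->|[y [Hy ay ey ly]]].
    by rewrite /hd; case: (h); lia.
  have [_ _ cy _ _] := active_arm Hy ay; rewrite ey in cy.
  apply: leq_ltn_trans ly _; apply: embeds_hd => //.
  by have [] := white_inside Hpi Hx Hy Wx cy.
have bv (v : bool) : MV v < vd n v (tau (F x)).
  case: (max_attained_v v) => [->|[y [Hy ay ey ly]]].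
    by rewrite /vd; case: (v); lia.
  have [_ _ cy _ _] := active_arm Hy ay; rewrite ey in cy.
  apply: leq_ltn_trans ly _; apply: embeds_vd => //.
  by have [] := white_inside Hpi Hx Hy Wx cy.
move: (bh false) (bh true) (bv false) (bv true); rewrite /hd /vd /=.
by move=> *; apply/and4P; split; lia.
Qed.

Lemma white_chain (dir : bool) :
  (forall x y, x < y -> y < k -> HS x = 2 -> HS y = 2 ->
     vd k dir (pi x) < vd k dir (pi y)) ->
  exists ch, chain (fun p => [&& MH 0 < p.+1, p.+1 + MH 1 < n.+1, MV 0 < tau p
    & tau p + MV 1 < n.+1]) (fun p => vd n dir (tau p)) n
    (count (fun x => HS x == 2) (iota 0 k)) ch.
Proof.
move=> Hdir; pose ws := [seq x <- iota 0 k | HS x == 2].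
exists (fun a => F (nth 0 ws a)); rewrite -size_filter -/ws.
have wsP a : a < size ws -> nth 0 ws a < k /\ HS (nth 0 ws a) = 2.
  by move=> /(mem_nth 0); rewrite mem_filter mem_iota => /andP [/eqP -> /andP [_ ->]].
have wsS a b : a < b -> b < size ws -> nth 0 ws a < nth 0 ws b.
  move=> ab Hb; apply: (sorted_ltn_nth ltn_trans 0) => //.
    by apply: sorted_filter; [exact: ltn_trans | exact: iota_ltn_sorted].
  by rewrite inE; apply: ltn_trans ab Hb.
split=> [a Ha|a b ab Hb].
  have [h1 h2] := wsP a Ha; split; last exact: Fn.
  by apply: white_in_rect => //; rewrite /act h2.
have [h1 h2] := wsP b Hb; have [h3 h4] := wsP a (ltn_trans ab Hb).
have lt := wsS a b ab Hb; split; first by case: HF => _ H _; apply: H.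
by apply: embeds_vd => //; apply: Hdir.
Qed.
End Complete.

Section Sound.
Variables (Ptr : nat -> nat) (MH MV : nat -> nat) (dir : bool) (ch : nat -> nat).
Hypothesis HPtr : forall x, x < k -> act x ->
  exists c, Ptr x = bs x + c /\ c < lim x.
Hypothesis Hgood : forall x, x < k -> act x -> good k TH TV SH SV Ptr x.
Hypothesis HMH : is_max k HS (fun x => TH (Ptr x)) MH.
Hypothesis HMV : is_max k VS (fun x => TV (Ptr x)) MV.
Hypothesis HMn : MH 0 + MH 1 <= n /\ MV 0 + MV 1 <= n.
Hypothesis Hdir : forall x y, x < y -> y < k -> HS x = 2 -> HS y = 2 ->
  vd k dir (pi x) < vd k dir (pi y).
Hypothesis Hch : chain (fun p => [&& MH 0 < p.+1, p.+1 + MH 1 < n.+1, MV 0 < tau p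
    & tau p + MV 1 < n.+1]) (fun p => vd n dir (tau p)) n
    (count (fun x => HS x == 2) (iota 0 k)) ch.

Let rank x := count (fun x => HS x == 2) (iota 0 x).

Lemma rank_lt x y : x < y -> HS x = 2 -> rank x < rank y.
Proof.
move=> xy hx; rewrite /rank -(subnKC xy) iotaD count_cat -[x.+1]addn1 iotaD.
by rewrite count_cat /= hx; lia.
Qed.

(** Certified points go to the points at their pointers, and the white point of rank [r] goes to the
    [r]-th point of the chain. In each coordinate, order within a side follows from the followers,
    order between opposite sides from [HMn], and order between certified and white points from the
    rectangle. *)
Lemma embeds_of_pointers : exists F, embeds n k tau pi F.
Proof.
have [F HF] : exists F, forall x, x < k ->
    (act x -> [/\ F x < n, TH (Ptr x) = hd n (hs x) (F x)
       & TV (Ptr x) = vd n (vs x) (tau (F x))]) /\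
    (~~ act x -> F x = ch (rank x)).
  apply: (@finite_choice k (fun x p =>
    (act x -> [/\ p < n, TH (Ptr x) = hd n (hs x) p & TV (Ptr x) = vd n (vs x) (tau p)])
    /\ (~~ act x -> p = ch (rank x)))) => x Hx.
  case ax: (act x); last by exists (ch (rank x)).
  have [e [Pe le]] := HPtr Hx ax.
  have [_ _ /(_ e le) [p [p1 _ p2 p3]] _ _] := Htab (hs x) (vs x).
  by exists p; split=> // _; rewrite Pe.
have HA x : x < k -> act x -> [/\ F x < n, TH (Ptr x) = hd n (hs x) (F x)
    & TV (Ptr x) = vd n (vs x) (tau (F x))].
  by move=> Hx; have [] := HF x Hx.
have HW x : x < k -> ~~ act x -> [/\ F x < n, HS x = 2 & [&& MH 0 < (F x).+1,
    (F x).+1 + MH 1 < n.+1, MV 0 < tau (F x) & tau (F x) + MV 1 < n.+1]].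
  move=> Hx ax; have [_ ->] := HF x Hx => //; have [h _ _] := inactive_white Hx ax.
  by have [] := Hch.1 _ (rank_lt Hx h); split.
have Fn x : x < k -> F x < n.
  move=> Hx; case ax: (act x); first by have [] := HA x Hx ax.
  by have [] := HW x Hx (negbT ax).
have MHx x : x < k -> act x -> hd n (hs x) (F x) <= MH (hs x).
  move=> Hx ax; have [_ <- _] := HA x Hx ax; have [<- _ _ _ _] := active_arm Hx ax.
  exact: HMH.1.
have MVx x : x < k -> act x -> vd n (vs x) (tau (F x)) <= MV (vs x).
  move=> Hx ax; have [_ _ <-] := HA x Hx ax; have [_ <- _ _ _] := active_arm Hx ax.
  by apply: HMV.1 => //; rewrite active_VS.
have WW x y : x < y -> y < k -> ~~ act x -> ~~ act y ->
    F x < F y /\ vd n dir (tau (F x)) < vd n dir (tau (F y)).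
  move=> xy Hy ax ay; have Hx := ltn_trans xy Hy.
  have [_ -> //] := HF x Hx; have [_ -> //] := HF y Hy.
  have [hx _ _] := inactive_white Hx ax; have [hy _ _] := inactive_white Hy ay.
  by apply: Hch.2; [apply: rank_lt | apply: rank_lt].
have Fmono x y : x < k -> y < k -> x.+1 < y.+1 -> (F x).+1 < (F y).+1.
  apply: (@coordinate_mono n k act hs (fun x => x.+1) (fun x => (F x).+1)).
  - by move=> z Hz; have := Fn z Hz; lia.
  - move=> a b Ha Hb aa ab sab; rewrite -!hdE => lt.
    have [_ e1 _] := HA a Ha aa; have [_ e2 _] := HA b Hb ab.
    rewrite -e1 sab -e2.
    have [s1 _ _ p1 _] := active_arm Ha aa; have [s2 _ _ p2 _] := active_arm Hb ab.
    apply: (@succ_mono k HS PH SH (fun x => TH (Ptr x))) => //.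
    + by move=> z Hz az; have [] := Hgood Hz az.
    + by rewrite s1 s2 sab.
    + by rewrite p1 p2 -sab.
    + move=> u w Hu Hw su au; have aw : act w by rewrite /act -su.
      have [_ _ _ -> _] := active_arm Hu au; have [_ _ _ -> _] := active_arm Hw aw.
      have -> : hs w = hs u by rewrite /hs su.
      by rewrite /hd; case: (hs u); lia.
  - move=> a b Ha Hb aa ab sab; rewrite -!hdE.
    have [_ _ ca _ _] := active_arm Ha aa; have [_ _ cb _ _] := active_arm Hb ab.
    have ma := MHx a Ha aa; have mb := MHx b Hb ab.
    have eb : hs b = ~~ hs a by case: (hs a) (hs b) sab => [] [].
    rewrite eb in cb mb *; split; first exact: (cert_cross_h Hpi HP Ha Hb ca cb).
    by move: ma mb HMn.1; case: (hs a) => /=; lia.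
  - move=> a b Ha Hb aa ab; rewrite -!hdE.
    have [_ _ ca _ _] := active_arm Ha aa; have [_ _ wb] := inactive_white Hb ab.
    have [i1 i2] := white_inside Hpi Hb Ha wb ca; split=> //.
    apply: leq_ltn_trans (MHx a Ha aa) _.
    have [_ _ /and4P [r1 r2 _ _]] := HW b Hb ab.
    by move: r1 r2; rewrite /hd; case: (hs a) => /=; lia.
  - by move=> a b Ha Hb aa ab lt; have [] := WW a b lt Hb aa ab.
exists F; split=> // [x y xy Hy|]; first by have := Fmono x y (ltn_trans xy Hy) Hy; lia.
apply: (@coordinate_mono n k act vs pi (fun x => tau (F x))).
- by move=> z Hz; split; [apply: Hpi.1 | apply: Htau.1; apply: Fn].
- move=> a b Ha Hb aa ab sab lt.
  have [_ _ e1] := HA a Ha aa; have [_ _ e2] := HA b Hb ab.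
  rewrite -e1 sab -e2.
  have [_ s1 _ _ p1] := active_arm Ha aa; have [_ s2 _ _ p2] := active_arm Hb ab.
  apply: (@succ_mono k VS PV SV (fun x => TV (Ptr x))) => //.
  + by move=> z Hz az; have [] := Hgood Hz (etrans (esym (active_VS Hz)) az).
  + by rewrite active_VS.
  + by rewrite s1 s2 sab.
  + by rewrite p1 p2 -sab.
  + move=> u w Hu Hw su au; have aw : act w by rewrite -active_VS // -su.
    rewrite active_VS // in au.
    have [_ _ _ _ ->] := active_arm Hu au; have [_ _ _ _ ->] := active_arm Hw aw.
    have -> : vs w = vs u by rewrite /vs su.
    have := Hpi.1 u Hu; have := Hpi.1 w Hw; have := Hpi.2 u w Hu Hw.
    by rewrite /vd; case: (vs u); lia.
- move=> a b Ha Hb aa ab sab.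
  have [_ _ ca _ _] := active_arm Ha aa; have [_ _ cb _ _] := active_arm Hb ab.
  have ma := MVx a Ha aa; have mb := MVx b Hb ab.
  have eb : vs b = ~~ vs a by case: (vs a) (vs b) sab => [] [].
  rewrite eb in cb mb *; split; first exact: (cert_cross_v Hpi HP Ha Hb ca cb).
  by move: ma mb HMn.2; case: (vs a) => /=; lia.
- move=> a b Ha Hb aa ab.
  have [_ _ ca _ _] := active_arm Ha aa; have [_ _ wb] := inactive_white Hb ab.
  have [i1 i2] := white_inside Hpi Hb Ha wb ca; split=> //.
  apply: leq_ltn_trans (MVx a Ha aa) _.
  have [_ _ /and4P [_ _ r1 r2]] := HW b Hb ab.
  by move: r1 r2; rewrite /vd; case: (vs a) => /=; lia.
- move=> a b Ha Hb aa ab lt.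
  have [ha _ _] := inactive_white Ha aa; have [hb _ _] := inactive_white Hb ab.
  have t1 := Htau.1 _ (Fn a Ha); have t2 := Htau.1 _ (Fn b Hb).
  have p1 := Hpi.1 a Ha; have p2 := Hpi.1 b Hb.
  case: (ltngtP a b) => [lab|lba|eab]; last by rewrite eab ltnn in lt.
    have [_] := WW a b lab Hb aa ab; have := Hdir lab Hb ha hb.
    by rewrite /vd; case: (dir); lia.
  have [_] := WW b a lba Ha ab aa; have := Hdir lba Ha hb ha.
  by rewrite /vd; case: (dir); lia.
Qed.
End Sound.
End Correct.

(** * The algorithm *)

Definition com_result : com :=
  Asgn xR (Eq (Add (Add (Var xOk)
                        (Lt (Add (Arr aMH (Cst 0)) (Arr aMH (Cst 1)))
                            (Add (Var xN) (Cst 1))))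
                   (Add (Lt (Add (Arr aMV (Cst 0)) (Arr aMV (Cst 1)))
                            (Add (Var xN) (Cst 1)))
                        (Lt (Arr aL (Var xM)) (Add (Var xN) (Cst 1)))))
              (Cst 4)).

Definition com_core : com :=
  (com_last_values ;; com_backtrace ;; com_tables ;; com_classify ;;
   com_succ aHS aPH aSH ;; com_succ aVS aPV aSV ;; com_init ;; com_main ;;
   com_max aHS aTH aMH ;; com_max aVS aTV aMV ;; com_white ;; com_lis ;;
   com_result)%com.

(** Both special cases protect the time bound: coloring takes time of order n even if [k = 0], and
    the work on pi is quadratic in k. Afterwards n, k and the square of k are at most [k * n]. *)
Definition com_all : com :=
  (Asgn xN (Inp (Cst 0)) ;; Asgn xK (Inp (Cst 1)) ;;
   If (Lt (Var xN) (Var xK)) (Asgn xR (Cst 0))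
     (If (Eq (Var xK) (Cst 0)) (Asgn xR (Cst 1)) com_core))%com.

Section Core.
Variables (inp : nat -> nat) (n k : nat).
Let tau i := inp (i + 2).
Let pi i := inp (n + 2 + i).

Lemma spec_core s P P' : vr s xN = n -> vr s xK = k -> 0 < k <= n ->
  (forall l, ar s aTH l = 0) ->
  permf n tau -> permf k pi -> coloring n tau P -> coloring k pi P' ->
  spec inp s com_core
    (fun s' => vr s' xR <> 0 <-> exists F, embeds n k tau pi F) (50 * (k * n)).
Proof.
move=> n0 k0 kn T0 Htau Hpi HP HP'; rewrite /com_core.
set T := 50 * _.
apply: (@spec_weaken _ _ _ (fun s' => vr s' xR <> 0 <-> exists F, embeds n k tau pi F)
  _ (n + (n + (4 * n + (k * (4 * k).+1 + (k * k.+1 + (k * k.+1 + (k +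
     ((2 * (k * n) + k) + (k + (k + (k + ((k + n * k.+1) + 0))))))))))))) => //; last first.
  (* The summands are 7 times [n], 9 times [k], 6 times [k * k] and 3 times [k * n], at most 25
     times [k * n] together; 50 leaves a margin. *)
  have h1 : k <= k * n by clear -kn; nia.
  have h2 : n <= k * n by clear -kn; nia.
  have h3 : k * k <= k * n by clear -kn; nia.
  have -> : k * (4 * k).+1 = 4 * (k * k) + k by clear; lia.
  have -> : k * k.+1 = k * k + k by clear; lia.
  have -> : n * k.+1 = k * n + n by clear; lia.
  by rewrite /T; lia.
apply: spec_seq (spec_last_values _ n0) _ => s1 A1 H1.
have n1 : vr s1 xN = n by rewrite (agreev A1).
apply: spec_seq (spec_backtrace n1 Htau HP H1) _ => s2 A2 [c2 H2].
have n2 : vr s2 xN = n by rewrite (agreev A2).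
have T2 l : ar s2 aTH l = 0 by rewrite (agreea A2) ?(agreea A1).
apply: spec_seq (spec_tables n2 Htau H2 c2 T2) _ => s3 A3 H3.
pose c p := ar s2 aC p != 0.
have {}H2 : coloring n tau c := H2.
have {}H3 : forall h v, exists len, table n tau c (ar s3 aTH) (ar s3 aTV) h v len := H3.
have n3 : vr s3 xN = n by rewrite (agreev A3).
have k3 : vr s3 xK = k by rewrite (agreev A3) ?(agreev A2) ?(agreev A1).
apply: spec_seq (spec_classify inp n3 k3) _ => s4 A4 H4.
have n4 : vr s4 xN = n by rewrite (agreev A4).
have k4 : vr s4 xK = k by rewrite (agreev A4).
set HS := ar s4 aHS in H4; set VS := ar s4 aVS in H4.
set PH := ar s4 aPH in H4; set PV := ar s4 aPV in H4.
have bPH y : y < k -> HS y < 2 -> PH y <= k.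
  move=> Hy; case: (H4 y Hy) => [[-> //]|[h [v [_ _ _ -> _]]] _].
  by rewrite /hd; case: (h); lia.
have bPV y : y < k -> VS y < 2 -> PV y <= k.
  move=> Hy; case: (H4 y Hy) => [[_ -> //]|[h [v [_ _ _ _ ->]]] _].
  by have := Hpi.1 y Hy; rewrite /pi /vd; case: (v) => /=; lia.
apply: spec_seq (spec_succ (aS := aHS) (aP := aPH) (aO := aSH) inp isT k4 bPH) _ => s5 A5 H5.
rewrite -/HS -/PH in H5.
have k5 : vr s5 xK = k by rewrite (agreev A5).
have n5 : vr s5 xN = n by rewrite (agreev A5).
have V5 : ar s5 aVS = VS by rewrite (agreea A5).
have PV5 : ar s5 aPV = PV by rewrite (agreea A5).
apply: spec_seq (spec_succ (aS := aVS) (aP := aPV) (aO := aSV) inp isT k5 _) _.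
  by rewrite V5 PV5.
move=> s6 A6; rewrite V5 PV5 => H6.
have k6 : vr s6 xK = k by rewrite (agreev A6).
have n6 : vr s6 xN = n by rewrite (agreev A6).
have HS6 : ar s6 aHS = HS by rewrite (agreea A6) ?(agreea A5).
have VS6 : ar s6 aVS = VS by rewrite (agreea A6).
have TH6 : ar s6 aTH = ar s3 aTH by rewrite (agreea A6) ?(agreea A5) ?(agreea A4).
have TV6 : ar s6 aTV = ar s3 aTV by rewrite (agreea A6) ?(agreea A5) ?(agreea A4).
apply: spec_seq (spec_init inp n6 k6 HS6 VS6) _ => s7 A7.
rewrite TH6 TV6; set TH := upd _ _ _; set TV := upd _ _ _.
move=> [TH7 TV7 t7 [Pk7 P7] [Q7 Q7' ok7]].
set SH := ar s5 aSH in H5; set SV := ar s6 aSV in H6.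
have SH7 : ar s7 aSH = SH by rewrite (agreea A7) ?(agreea A6).
have SV7 : ar s7 aSV = SV by rewrite (agreea A7).
have n7 : vr s7 xN = n by rewrite (agreev A7).
have k7 : vr s7 xK = k by rewrite (agreev A7).
have Htab h v : exists len, table n tau c TH TV h v len.
  have [len Hl] := H3 h v; exists len; apply: table_ext Hl => a Ha; rewrite /TH /TV /upd.
  have -> // : (a == 4 * n.+1) = false.
  by move: Ha; rewrite /base; clear; case: (h); case: (v); lia.
have [len {}Htab] : exists len, forall h v, table n tau c TH TV h v (len h v).
  have [l1 h1] := Htab false false; have [l2 h2] := Htab false true.
  have [l3 h3] := Htab true false; have [l4 h4] := Htab true true.
  by exists (fun h v => if h then if v then l4 else l3 else if v then l2 else l1); case; case.
pose act x := HS x < 2.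
pose bs x := base n (HS x != 0) (VS x != 0).
pose lim x := len (HS x != 0) (VS x != 0).
have tabx x := Htab (HS x != 0) (VS x != 0).
have lim_le x : x < k -> act x -> lim x <= n by move=> _ _; have [] := tabx x.
have TH0 x : x < k -> act x -> TH (bs x + lim x) = 0 by move=> _ _; have [] := tabx x.
have TH_pos x j : x < k -> act x -> j < lim x ->
    0 < TH (bs x + j) <= n /\ TV (bs x + j) <= n.
  move=> _ _ Hj; have [_ _ /(_ j Hj) [p [p1 _ -> ->]] _ _] := tabx x.
  have := Htau.1 p p1; rewrite /hd /vd; clear -p1.
  by case: (HS x != 0); case: (VS x != 0); lia.
have TH_mono x i j : x < k -> act x -> i < j < lim x ->
    TH (bs x + i) < TH (bs x + j) /\ TV (bs x + i) < TV (bs x + j).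
  by move=> _ _ Hij; have [_ _ _ _] := tabx x; apply.
have actV x : x < k -> (VS x < 2) = act x := active_VS H4 (x := x).
have SH_act x : x < k -> act x -> SH x = k \/ SH x < k /\ act (SH x).
  move=> Hx ax; case: (H5 x Hx ax) => [[-> _]|[o1 o2 _ _]]; [by left | right].
  by split=> //; rewrite /act o2.
have SV_act x : x < k -> act x -> SV x = k \/ SV x < k /\ act (SV x).
  move=> Hx ax; case: (H6 x Hx (etrans (actV x Hx) ax)) => [[-> _]|[o1 o2 _ _]].
    by left.
  by right; split=> //; rewrite -actV // o2 actV.
have dH : TH (4 * n.+1) = n.+1 by rewrite /TH /upd eqxx.
have dV : TV (4 * n.+1) = n.+1 by rewrite /TV /upd eqxx.
have inv : main_inv k act bs lim TH TV SH SV (4 * n.+1)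
    (ar s7 aPtr) (ar s7 aQ) (vr s7 xOk) 0 (vr s7 xTail).
  split.
  - move=> x Hx ax; rewrite P7 //; split; first by rewrite leqnn leq_addr.
    move=> ok1; case: ok7 => [[_ h]|[h _]]; last by rewrite h in ok1.
    rewrite -addn1 leq_add2l; case: (posnP (lim x)) => // l0.
    by case: (h x Hx ax); have := TH0 x Hx ax; rewrite l0 addn0.
  - by move=> J HJ x Hx ax; rewrite P7 // leq_addr.
  - case: ok7 => [[h _]|[h [x [Hx ax hx]]]]; [by left | right; split=> //].
    exists x; split=> //; rewrite P7 //.
    case: (posnP (lim x)) => [->|l0]; first by rewrite addn0.
    by have [] := TH_pos x 0 Hx ax l0; rewrite addn0 hx.
  - by split.
  - split=> // _ x Hx ax; left; have [q [q1 q2]] := Q7' x Hx ax.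
    by exists q.
apply: spec_seq (spec_main inp lim_le TH0 TH_pos TH_mono SH_act SV_act dH dV
  TH7 TV7 SH7 SV7 t7 inv) _ => s8 A8 H8.
have n8 : vr s8 xN = n by rewrite (agreev A8).
have k8 : vr s8 xK = k by rewrite (agreev A8).
have HS8 : ar s8 aHS = HS by rewrite (agreea A8) ?(agreea A7).
have VS8 : ar s8 aVS = VS by rewrite (agreea A8) ?(agreea A7).
have TH8 : ar s8 aTH = TH by rewrite (agreea A8).
have TV8 : ar s8 aTV = TV by rewrite (agreea A8).
set Ptr := ar s8 aPtr in H8.
apply: spec_seq (spec_max (aS := aHS) (aT := aTH) (aM := aMH) inp isT k8) _ => s9 A9.
rewrite HS8 TH8 -/Ptr => H9.
have n9 : vr s9 xN = n by rewrite (agreev A9).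
have k9 : vr s9 xK = k by rewrite (agreev A9).
have HS9 : ar s9 aHS = HS by rewrite (agreea A9).
have VS9 : ar s9 aVS = VS by rewrite (agreea A9).
have TV9 : ar s9 aTV = TV by rewrite (agreea A9).
have Ptr9 : ar s9 aPtr = Ptr by rewrite (agreea A9).
apply: spec_seq (spec_max (aS := aVS) (aT := aTV) (aM := aMV) inp isT k9) _ => s10 A10.
rewrite VS9 TV9 Ptr9 => H10.
set MH := ar s9 aMH in H9; set MV := ar s10 aMV in H10.
have n10 : vr s10 xN = n by rewrite (agreev A10).
have k10 : vr s10 xK = k by rewrite (agreev A10).
have HS10 : ar s10 aHS = HS by rewrite (agreea A10).
have MH10 : ar s10 aMH = MH by rewrite (agreea A10).
have isw x : x < k -> HS x = 2 -> white k pi x.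
  move=> Hx hx; case: (H4 x Hx) => [[_ _ //]|[h [v [h1 _ _ _ _]]]].
  by move: hx; rewrite h1; case: (h).
apply: spec_seq (spec_white n10 k10 HS10 Hpi.1 _ _) _.
- move=> a b d ab bd Hd ha hb hd'; apply: (white_monotone Hpi ab bd Hd);
    apply: isw => //; clear -ab bd Hd; lia.
- by move=> a b ab Hb /(Hpi.2 _ _ (ltn_trans ab Hb) Hb); clear -ab; lia.
move=> s11 A11 [m11 d11 H11].
set m := vr s11 xM in m11; set dir := vr s11 xDir in d11 H11.
have n11 : vr s11 xN = n by rewrite (agreev A11).
have k11 : vr s11 xK = k by rewrite (agreev A11).
have MH11 : ar s11 aMH = MH by rewrite (agreea A11).
have MV11 : ar s11 aMV = MV by rewrite (agreea A11).
have mk : vr s11 xM <= k.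
  by rewrite -/m m11; apply: leq_trans (count_size _ _) _; rewrite size_iota.
apply: spec_seq (spec_lis n11 k11 erefl mk erefl MH11 MV11 Htau.1) _.
move=> s12 A12 H12; rewrite -/m -/dir in H12.
have n12 : vr s12 xN = n by rewrite (agreev A12).
have m12 : vr s12 xM = m by rewrite (agreev A12).
have MH12 : ar s12 aMH = MH by rewrite (agreea A12).
have MV12 : ar s12 aMV = MV by rewrite (agreea A12).
have ok12 : vr s12 xOk = vr s8 xOk.
  by rewrite (agreev A12) ?(agreev A11) ?(agreev A10) ?(agreev A9).
rewrite /com_result; exec_block => /=.
rewrite n12 m12 MH12 MV12 ok12 addn1 !ltnS in E.
have [M1 M2] : (forall F, embeds n k tau pi F -> vr s8 xOk = 1 /\
    [/\ MH 0 + MH 1 <= n, MV 0 + MV 1 <= n & ar s12 aL m <= n]) /\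
  (vr s8 xOk = 1 -> MH 0 + MH 1 <= n -> MV 0 + MV 1 <= n -> ar s12 aL m <= n ->
    exists F, embeds n k tau pi F); last first.
  have ok8 : vr s8 xOk <= 1 by case: H8 => [[->]|[->]].
  split.
    move=> a0; have {a0} : vr s8 xOk + (MH 0 + MH 1 <= n) +
      ((MV 0 + MV 1 <= n) + (ar s12 aL m <= n)) == 4 by move: a0; rewrite E; case: eqP.
    move=> e4; apply: M2; move: e4 ok8; case: (MH 0 + _ <= n) => //;
    case: (MV 0 + _ <= n) => //; case: (_ <= n) => //; clear; lia.
  by move=> [F /M1 [h1 [h2 h3 h4]]]; rewrite E h1 h2 h3 h4.
split.
  move=> F HF.
  have [J [HJ JF]] := embeds_solution Htau Hpi H2 Htab H4 H5 H6 HF.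
  case: H8 => [[_ /(_ J) []//]|[ok1 HPtr Hgood]]; split=> //.
  have DF x : x < k -> HS x < 2 -> TH (Ptr x) <= hd n (HS x != 0) (F x) /\
      TV (Ptr x) <= vd n (VS x != 0) (tau (F x)).
    move=> Hx ax; have [<- <-] := JF x Hx ax.
    have [e [-> le /(_ J HJ) leJ]] := HPtr x Hx ax.
    have [lJ _ _] := HJ x Hx ax.
    case: (ltngtP e (J x)) leJ => // [lt _|->//].
    by have [] := TH_mono x e (J x) Hx ax ltac:(by rewrite lt lJ); split; apply: ltnW.
  have [h1 h2] := max_le (DH := fun x => TH (Ptr x)) (DV := fun x => TV (Ptr x))
    Htau Hpi H2 H4 HF DF H9 H10.
  split=> //; apply/H12; rewrite m11.
  exact: (white_chain (DH := fun x => TH (Ptr x)) (DV := fun x => TV (Ptr x))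
    Htau Hpi H4 HF DF H9 H10 H11).
move=> ok1 h1 h2 /H12 [ch Hch]; rewrite m11 in Hch.
case: H8 => [[ok0 _]|[_ HPtr Hgood]]; first by rewrite ok0 in ok1.
have HPtr' x : x < k -> HS x < 2 -> exists e, Ptr x = bs x + e /\ e < lim x.
  by move=> Hx ax; have [e [e1 e2 _]] := HPtr x Hx ax; exists e.
exact: (embeds_of_pointers Htau Hpi HP' Htab H4 H5 H6 HPtr' Hgood H9 H10
          (conj h1 h2) H11 Hch).
Qed.
End Core.

(** * The input encoding and the compiled program *)

Section Input.
Variables tau pi : seq nat.
Let n := size tau.
Let k := size pi.
Let inp := init_mem tau pi.

Lemma init_mem_tau i : i < n -> inp (i + 2) = nth 0 tau i.
Proof.
move=> Hi; rewrite /inp /init_mem -/n !addn2 /= !ltnS Hi.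
by congr nth; lia.
Qed.

Lemma init_mem_pi i : i < k -> inp (n + 2 + i) = nth 0 pi i.
Proof.
move=> Hi; rewrite /inp /init_mem -/n -/k.
have -> : (n + 2 + i == 0) = false by lia.
have -> : (n + 2 + i == 1) = false by lia.
have -> : (n + 2 + i < n.+2) = false by lia.
have -> : n + 2 + i < n + k + 2 by lia.
by congr nth; lia.
Qed.

Lemma init_mem_out a : n + k + 2 <= a -> inp a = 0.
Proof.
move=> Ha; rewrite /inp /init_mem -/n -/k.
have -> : (a == 0) = false by lia.
have -> : (a == 1) = false by lia.
have -> : (a < n.+2) = false by lia.
by have -> : (a < n + k + 2) = false by lia.
Qed.

(** [embeds] asks only for implications between strict inequalities; trichotomy, with the
    injectivity of pi for values, turns them into the equivalences of [embedding]. *)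
Lemma contains_embeds : permf n (fun i => nth 0 tau i) -> permf k (fun i => nth 0 pi i) ->
  contains tau pi <->
  exists F, embeds n k (fun i => inp (i + 2)) (fun i => inp (n + 2 + i)) F.
Proof.
move=> Ht Hp; split.
  case=> f [_ Hf]; pose F x := if insub x is Some i then nat_of_ord (f i) else 0.
  have FE (x : 'I_k) : F x = f x by rewrite /F insubT //= => Hx; congr (nat_of_ord (f _)); apply: val_inj.
  have Fn (x : 'I_k) : F x < n by rewrite FE.
  exists F; split.
  - by move=> x Hx; exact: (Fn (Ordinal Hx)).
  - move=> x y xy Hy; rewrite (FE (Ordinal (ltn_trans xy Hy))) (FE (Ordinal Hy)).
    by have [<- _] := Hf (Ordinal (ltn_trans xy Hy)) (Ordinal Hy).
  - move=> x y Hx Hy; rewrite !init_mem_pi // !init_mem_tau ?(Fn (Ordinal Hx)) ?(Fn (Ordinal Hy)) //.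
    rewrite (FE (Ordinal Hx)) (FE (Ordinal Hy)).
    by have [_ <-] := Hf (Ordinal Hx) (Ordinal Hy).
move=> [F [F1 F2 F3]].
pose f (x : 'I_k) : 'I_n := Ordinal (F1 x (ltn_ord x)).
have lt_eq (x y : 'I_k) : (x < y) = (f x < f y).
  case: (ltngtP x y) => [h|h|h] /=.
  - by rewrite F2.
  - by apply/esym/negbTE; rewrite -leqNgt ltnW // F2.
  - by rewrite h ltnn.
exists f; split=> [x y [E]|x y].
  apply: val_inj; move: (lt_eq x y) (lt_eq y x); rewrite /= E ltnn.
  by case: ltngtP.
split; first exact: lt_eq.
have F3' (u w : 'I_k) : nth 0 pi u < nth 0 pi w -> nth 0 tau (F u) < nth 0 tau (F w).
  by have := F3 u w (ltn_ord u) (ltn_ord w); rewrite !init_mem_pi // !init_mem_tau // F1.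
case: (ltngtP (nth 0 pi x) (nth 0 pi y)) => [h|h|h] /=.
- by rewrite F3'.
- by apply/esym/negbTE; rewrite -leqNgt ltnW // F3'.
- have -> : x = y by apply: val_inj; apply: (Hp.2 _ _ (ltn_ord x) (ltn_ord y) h).
  by rewrite ltnn.
Qed.
End Input.

Lemma is_perm_permf s : is_perm (size s) s -> permf (size s) (fun i => nth 0 s i).
Proof.
move=> Hs; split=> [p Hp|p q Hp Hq E].
  have : nth 0 s p \in iota 1 (size s) by rewrite -(perm_mem Hs) mem_nth.
  by rewrite mem_iota add1n ltnS.
have Us : uniq s by rewrite (perm_uniq Hs) iota_uniq.
by apply/eqP; rewrite -(nth_uniq 0 Hp Hq Us) E.
Qed.

Lemma permf_ext N f g : (forall i, i < N -> f i = g i) -> permf N g -> permf N f.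
Proof.
move=> E [H1 H2]; split=> [p Hp|p q Hp Hq]; first by rewrite E //; apply: H1.
by rewrite !E //; apply: H2.
Qed.

Lemma coloring_ext N f g P : (forall i, i < N -> f i = g i) ->
  coloring N g P -> coloring N f P.
Proof.
move=> E H p q pq; rewrite !E; [exact: H | lia | lia].
Qed.

(** Computes the input length [n + k + 2] into [rOff] from the sizes in cells 0 and 1. *)
Definition prologue : seq instr :=
  [:: IConst rOff 0; ILoad rOff rOff; IConst rTmp 1; ILoad rTmp rTmp;
      IAdd rOff rOff rTmp; IConst rTmp 2; IAdd rOff rOff rTmp].

Definition compile (c : com) : program := prologue ++ ccom c (size prologue).

Definition init_store : store := St (fun _ => 0) (fun _ _ => 0).

Lemma spec_all (tau pi : seq nat) :
  is_perm (size tau) tau -> skew_merged tau -> is_perm (size pi) pi -> skew_merged pi ->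
  spec (init_mem tau pi) init_store com_all
    (fun s' => vr s' xR <> 0 <-> contains tau pi) (50 * (size pi * size tau)).
Proof.
move=> pt [P HP] pp [P' HP'].
have ft := is_perm_permf pt; have fp := is_perm_permf pp.
have HC := contains_embeds ft fp.
rewrite /com_all; exec_step; exec_step.
rewrite /init_mem /= in E E0.
set s2 := setv _ _ _.
apply: spec_if => /=; rewrite E E0.
  move/nat_of_bool_true => lt; apply: spec_weaken (spec_asgn (Q := fun s' => vr s' xR = 0) _) _ _ => //.
  move=> s' _ ->; split=> // /HC [F [F1 F2 _]].
  have le : forall x, x < size pi -> x <= F x.
    elim=> // x IH Hx; have := IH (ltnW Hx); have := F2 x x.+1 (leqnn _) Hx; lia.
  have lt0 : 0 < size pi by apply: leq_ltn_trans lt.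
  have Hx : (size pi).-1 < size pi by rewrite prednK.
  have := le _ Hx; have := F1 _ Hx; lia.
move/nat_of_bool_false; rewrite -leqNgt => le.
apply: spec_if => /=; rewrite ?E0.
  move/nat_of_bool_true/eqP => k0; apply: spec_weaken (spec_asgn (Q := fun s' => vr s' xR = 1) _) _ _ => //.
  move=> s' _ ->; split=> // _; apply/HC; exists id.
  by split=> x; rewrite k0 // => y.
move/nat_of_bool_false/eqP => k0.
have Et i : i < size tau -> init_mem tau pi (i + 2) = nth 0 tau i by exact: init_mem_tau.
have Ep i : i < size pi -> init_mem tau pi (size tau + 2 + i) = nth 0 pi i.
  exact: init_mem_pi.
apply: (@spec_weaken _ _ _ (fun s' => vr s' xR <> 0 <-> exists F,
  embeds (size tau) (size pi) (fun i => init_mem tau pi (i + 2))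
    (fun i => init_mem tau pi (size tau + 2 + i)) F) _ (50 * (size pi * size tau)))
  => [|s' _ ->|//]; last exact: iff_sym.
apply: (@spec_core _ _ _ _ P P') => //.
- by lia.
- exact: permf_ext Et ft.
- exact: permf_ext Ep fp.
- exact: coloring_ext Et HP.
- exact: coloring_ext Ep HP'.
Qed.

Lemma compile_correct (tau pi : seq nat) c s i : wfc c ->
  run (init_mem tau pi) c init_store s i ->
  exists t, [/\ t <= 7 + i.+1 * size (compile c),
    halted (compile c) (exec (compile c) t (init_state tau pi))
  & reg (exec (compile c) t (init_state tau pi)) xR = vr s xR].
Proof.
move=> wc r; pose off := size tau + size pi + 2.
have pre : exec (compile c) 7 (init_state tau pi) =
    State 7 (runl prologue (fun _ => 0, init_mem tau pi)).1 (init_mem tau pi).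
  by rewrite (@exec_linear _ 0 prologue) // => j; do 7?[case: j => [//|j]].
set R := (runl _ _).1 in pre.
have Hrepr : repr (init_mem tau pi) off init_store R (init_mem tau pi).
  split=> //.
  - move=> x Hx; rewrite /R /runl /= /upd.
    have -> : (x == rOff) = false by lia.
    by have -> : (x == rTmp) = false by lia.
  - by move=> A j _; apply: init_mem_out; rewrite /off; lia.
have Hcode : code_at (compile c) 7 (ccom c 7).
  by move=> j Hj; rewrite /compile nth_cat /= addKn.
have [t [R' [M' [tt ex [Hv _ _ _]]]]] :=
  exec_ccom (@init_mem_out tau pi) r wc Hrepr Hcode.
exists (7 + t); rewrite exec_add pre ex; split.
- rewrite leq_add2l; apply: leq_trans tt _.
  by rewrite leq_mul2l /compile size_cat leq_addl orbT.
(* The compiled code has no halting instruction; control runs off its end, where [fetch] returns the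
   default [IHalt]. *)
- by rewrite /halted /fetch nth_default // size_cat.
- exact: Hv.
Qed.

(* There is a RAM program and a constant C such that, on every input consisting
   of a skew-merged permutation tau of size n and a skew-merged permutation pi
   of size k, the program halts within C * (k * n + 1) steps, and its output
   register R[0] is nonzero iff tau contains pi. *)
Theorem theorem2 :
  exists (p : program) (C : nat),
    forall (n k : nat) (tau pi : seq nat),
      size tau = n -> is_perm n tau -> skew_merged tau ->
      size pi = k -> is_perm k pi -> skew_merged pi ->
      exists t : nat,
        t <= C * (k * n + 1) /\
        halted p (exec p t (init_state tau pi)) /\
        (reg (exec p t (init_state tau pi)) 0 != 0 <-> contains tau pi).
Proof.
(* The 7 steps of the prologue and up to [50 * (k * n)] loop iterations, plus one pass over the
   code, which the summand 1 of [k * n + 1] absorbs. *)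
exists (compile com_all), (7 + 50 * size (compile com_all)).
move=> n k tau pi <- pt st <- pp sp.
have [s [i [r Hs it]]] := spec_all pt st pp sp.
have [t [tt ht et]] := compile_correct (isT : wfc com_all) r.
exists t; split; last first.
  by split=> //; rewrite et -Hs; split=> /eqP.
apply: leq_trans tt _; move: (size (compile _)) => S.
have : i.+1 * S <= (50 * (size pi * size tau)).+1 * S by rewrite leq_mul2r ltnS it orbT.
by move: (i.+1 * S) (size pi * size tau) => u q; nia.
Qed.
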